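(* Let $u_0\in C_0(\Omega)$ and, for $\varepsilon>0$, let $u_\varepsilon\in C(\bar\Omega\times[0,\infty))$ be the unique classical solution of $$\begin{cases}\partial_t u_\varepsilon-\varepsilon\Delta u_\varepsilon=K_0(u_\varepsilon)&\text{in }\Omega\times(0,\infty),\\ u_\varepsilon(x,t)=0&\text{on }\partial\Omega\times(0,\infty),\\ u_\varepsilon(x,0)=u_0(x)&\text{in }\Omega.\end{cases}$$ Then, as $\varepsilon\to0$, $u_\varepsilon$ converges pointwise in $\Omega\times(0,\infty)$ and in $L^\infty(\Omega\times(0,\infty))$-weak$\,\star$ to the unique solution $u\in C(\bar\Omega\times[0,\infty))$ of $$\begin{cases}\partial_t u=K_0(u)&\text{in }\Omega\times(0,\infty),\\ u(x,0)=u_0(x)&\text{in }\Omega.\end{cases}$$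
   Context: $\Omega\subset\mathbb{R}^n$ is open, bounded, connected and regular (i.e. with smooth boundary). $\mu\in L^1(\mathbb{R}^n)$ is a nonnegative function with $\int_{\mathbb{R}^n}\mu(z)\,dz=1$; the symbol $\mu$ also denotes the measure $d\mu(z)=\mu(z)\,dz$. $C_0(\Omega)$ denotes the continuous functions on $\bar\Omega$ that vanish on $\partial\Omega$. The nonlocal operator with zero boundary data is $$K_0(u)(x,t)=\int_{\{z:\,x+z\in\Omega\}}u(x+z,t)\,d\mu(z)-u(x,t).$$ For every $\varepsilon>0$ and $u_0\in C_0(\Omega)$ the viscous problem has exactly one classical solution (continuous on $\bar\Omega\times[0,\infty)$, with $\partial_t u_\varepsilon$ and the second-order space derivatives continuous in $\Omega\times(0,\infty)$). A solution of the limit problem satisfies $\partial_t u=K_0(u)$ in the sense of distributions in $\Omega\times(0,\infty)$, with $u(\cdot,0)=u_0$ in $\Omega$. *)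

(* Defs.v *)
From HB Require Import structures.
From mathcomp Require Import all_boot all_order all_algebra.
From mathcomp Require Import all_classical all_reals all_analysis.

Set Implicit Arguments.
Unset Strict Implicit.
Unset Printing Implicit Defensive.

Import Order.TTheory GRing.Theory Num.Theory.
Import numFieldNormedType.Exports.

Local Open Scope classical_set_scope.
Local Open Scope ring_scope.

(* 'rV[R]_n carries the sigma-algebra generated by its coordinates, as
   n.-tuple does in the library; it is the Borel sigma-algebra of R^n. *)
Section measurable_rV.
Context {R : realType} (n : nat).

Let coord (i : 'I_n) (x : 'rV[R]_n) : measurableTypeR R := x ord0 i.

Let rV_set0 : g_sigma_preimage coord set0.
Proof. exact: sigma_algebra0. Qed.

Let rV_setC A : g_sigma_preimage coord A -> g_sigma_preimage coord (~` A).
Proof. exact: sigma_algebraC. Qed.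

Let rV_bigcup (F : (set 'rV[R]_n)^nat) :
  (forall i, g_sigma_preimage coord (F i)) ->
  g_sigma_preimage coord (\bigcup_i F i).
Proof. exact: sigma_algebra_bigcup. Qed.

HB.instance Definition _ := @isMeasurable.Build default_measure_display
  'rV[R]_n (g_sigma_preimage coord) rV_set0 rV_setC rV_bigcup.

Lemma measurable_coord (i : 'I_n) :
  measurable_fun [set: 'rV[R]_n] (coord i).
Proof.
move=> _ Y mY; rewrite setTI; apply: sub_sigma_algebra => /=.
rewrite -bigcup_seq/=; exists i => /=; first by rewrite mem_index_enum.
by exists Y => //; rewrite setTI.
Qed.

Lemma measurable_fun_rV d (T : measurableType d) (f : T -> 'rV[R]_n) :
  (forall i, measurable_fun [set: T] (coord i \o f)) ->
  measurable_fun [set: T] f.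
Proof.
move=> mf; have pS : g_sigma_preimage (fun i => coord i \o f) `<=` measurable.
  apply: smallest_sub; first exact: sigma_algebra_measurable.
  move=> A; rewrite -bigcup_seq/= => -[i _ [B mB <-]].
  exact: mf.
move: pS; rewrite g_sigma_preimage_comp => pS _ A mA.
by apply: pS; exists A.
Qed.

End measurable_rV.

Section lebesgue_rV.
Context {R : realType}.

Definition consrV n (p : measurableTypeR R * 'rV[R]_n) : 'rV[R]_n.+1 :=
  \row_i oapp (p.2 ord0) p.1 (unlift ord0 i).

Definition unconsrV n (x : 'rV[R]_n.+1) : measurableTypeR R * 'rV[R]_n :=
  (x ord0 ord0, \row_j x ord0 (lift ord0 j)).

Lemma consrVK n : cancel (@consrV n) (@unconsrV n).
Proof.
case=> a x; congr pair; first by rewrite mxE unlift_none.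
by apply/rowP => j; rewrite !mxE liftK.
Qed.

Lemma measurable_consrV n : measurable_fun [set: _] (@consrV n).
Proof.
apply: measurable_fun_rV => i; case: (unliftP ord0 i) => [j ->|->].
  rewrite (_ : _ \o _ = (fun x : 'rV[R]_n => x ord0 j) \o snd).
    by apply: measurableT_comp => //; exact: measurable_coord.
  by apply/funext => p /=; rewrite mxE liftK.
rewrite (_ : _ \o _ = fst); first exact: measurable_fst.
by apply/funext => p /=; rewrite mxE unlift_none.
Qed.

Lemma measurable_unconsrV n : measurable_fun [set: _] (@unconsrV n).
Proof.
apply: measurable_fun_pair; first exact: measurable_coord.
apply: measurable_fun_rV => j.
rewrite (_ : _ \o _ = fun x : 'rV[R]_n.+1 => x ord0 (lift ord0 j)).
  exact: measurable_coord.
by apply/funext => x /=; rewrite mxE.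
Qed.

Section step.
Local Open Scope ereal_scope.
Variables (n : nat) (m : {sigma_finite_measure set 'rV[R]_n -> \bar R}).

Definition lebesgue_rV_step : set 'rV[R]_n.+1 -> \bar R :=
  pushforward (lebesgue_measure \x m) (@consrV n).

Let step0 : lebesgue_rV_step set0 = 0.
Proof. by rewrite /lebesgue_rV_step /pushforward preimage_set0 measure0. Qed.

Let step_ge0 A : 0 <= lebesgue_rV_step A.
Proof. by rewrite /lebesgue_rV_step /pushforward measure_ge0. Qed.

Let step_sigma_additive : semi_sigma_additive lebesgue_rV_step.
Proof.
have mc A : measurable A -> measurable (@consrV n @^-1` A).
  by move=> mA; rewrite -[X in measurable X]setTI; exact: measurable_consrV.
move=> F mF tF mUF; rewrite /lebesgue_rV_step /pushforward preimage_bigcup.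
apply: measure_semi_sigma_additive.
- by move=> k; exact: mc.
- apply/trivIsetP => /= i j _ _ ij; rewrite -preimage_setI.
  by move/trivIsetP : tF => /(_ _ _ _ _ ij) ->//; rewrite preimage_set0.
- by rewrite -preimage_bigcup; exact: mc.
Qed.

HB.instance Definition _ := isMeasure.Build _ _ _ lebesgue_rV_step
  step0 step_ge0 step_sigma_additive.

Let step_sigma_finite : sigma_finite setT lebesgue_rV_step.
Proof.
have /sigma_finiteP[F [FT ndF Foo]] := sigma_finiteT (@lebesgue_measure R).
have /sigma_finiteP[G [GT ndG Goo]] := sigma_finiteT m.
have FGT : \bigcup_k (F k `*` G k) = setT.
  rewrite -setXTT FT GT predeqE => -[x y]; split.
    by move=> [k _ []/= ? ?]; split; exists k.
  move=> [/= [k _ Fkx] [l _ Gly]]; exists (maxn k l) => //; split.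
  - by move: x Fkx; exact/subsetPset/ndF/leq_maxl.
  - by move: y Gly; exact/subsetPset/ndG/leq_maxr.
exists (fun k => @unconsrV n @^-1` (F k `*` G k)).
  by rewrite -preimage_bigcup FGT preimage_setT.
move=> k; have [mF Fkoo] := Foo k; have [mG Gkoo] := Goo k; split.
  rewrite -[X in measurable X]setTI; apply: measurable_unconsrV => //.
  exact: measurableX.
rewrite /lebesgue_rV_step /pushforward (_ : _ @^-1` _ = F k `*` G k).
  by rewrite product_measure1E// lte_mul_pinfty// ge0_fin_numE.
by rewrite -comp_preimage (_ : _ \o _ = id)//; exact/funext/consrVK.
Qed.

HB.instance Definition _ := Measure_isSigmaFinite.Build _ _ _
  lebesgue_rV_step step_sigma_finite.

End step.

Fixpoint lebesgue_rV n : {sigma_finite_measure set 'rV[R]_n -> \bar R} :=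
  match n with
  | 0 => \d_(0 : 'rV[R]_0)
  | n'.+1 => lebesgue_rV_step (lebesgue_rV n')
  end.

Lemma lebesgue_rV_box n (A : 'I_n -> set (measurableTypeR R)) :
  (forall i, measurable (A i)) ->
  lebesgue_rV n [set x : 'rV[R]_n | forall i, A i (x ord0 i)] =
  (\prod_(i < n) lebesgue_measure (A i))%E.
Proof.
elim: n A => [|n IH] A mA.
  rewrite big_ord0 /= diracE (_ : _ \in _ = true)//.
  by apply/mem_set => -[].
rewrite big_ord_recl /= /lebesgue_rV_step /pushforward.
have mB : measurable [set x : 'rV[R]_n | forall i, A (lift ord0 i) (x ord0 i)].
  rewrite (_ : [set x | _] = \bigcap_(i in [set: 'I_n])
      ((fun x : 'rV[R]_n => x ord0 i : measurableTypeR R)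
        @^-1` A (lift ord0 i))).
    apply: fin_bigcap_measurable; first exact: finite_finset.
    by move=> i _; rewrite -[X in measurable X]setTI; exact: measurable_coord.
  by apply/seteqP; split=> x /= h i; [move=> _|]; apply: h.
rewrite -IH; last by move=> i; exact: mA.
rewrite -product_measure1E//; congr (_ _).
apply/seteqP; split=> -[a x] /=.
  move=> h; split=> /=.
    by have := h ord0; rewrite mxE unlift_none.
  by move=> i; have := h (lift ord0 i); rewrite mxE liftK.
move=> [/= h1 h2] i; rewrite mxE; case: (unliftP ord0 i) => [j ->|->] //=.
Qed.

Definition lebesgue_cyl n :
    {measure set ('rV[R]_n * measurableTypeR R) -> \bar R} :=
  (lebesgue_rV n \x lebesgue_measure)%E.

End lebesgue_rV.

Section smoothness.
Context {R : realType}.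

(* This is C^oo only when V is finite-dimensional. *)
Definition smooth (V : normedModType R) (f : V -> R) : Prop :=
  forall vs : seq V,
    let g := foldr (fun v h => 'D_v h) f vs in
    continuous g /\ forall x v, derivable g x v.

Definition frontier (T : topologicalType) (A : set T) : set T :=
  closure A `\` A°.

(* Near each boundary point, up to relabelling and reversing a coordinate axis,
   Omega is the strict epigraph of a smooth function of the other n - 1
   coordinates. *)
Definition smooth_boundary n (Omega : set 'rV[R]_n) : Prop :=
  forall x0, frontier Omega x0 ->
    exists (i : 'I_n) (s : bool) (gamma : 'rV[R]_n.-1 -> R),
      smooth gamma /\
      \forall x \near x0,
        Omega x <-> 0 < (-1) ^+ s * (x ord0 i - gamma (col' i x)).

End smoothness.

Section problem.
Context {R : realType} (n : nat).
Implicit Types (Omega : set 'rV[R]_n) (mu : 'rV[R]_n -> R)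
  (u v phi g : 'rV[R]_n * R -> R).

Definition cyl Omega : set ('rV[R]_n * R) := Omega `*` [set t | 0 < t].

Definition closed_cyl Omega : set ('rV[R]_n * R) :=
  closure Omega `*` [set t | 0 <= t].

Definition e_t : 'rV[R]_n * R := (0, 1).
Definition e_x (i : 'I_n) : 'rV[R]_n * R := (delta_mx ord0 i, 0).

Definition C0 Omega (u0 : 'rV[R]_n -> R) : Prop :=
  {within closure Omega, continuous u0} /\
  forall x, frontier Omega x -> u0 x = 0.

Definition K0 Omega mu u (p : 'rV[R]_n * R) : R :=
  (\int[lebesgue_rV n]_(z in [set z | Omega (p.1 + z)])
     (u (p.1 + z, p.2) * mu z)) - u p.

Definition laplacian u (p : 'rV[R]_n * R) : R :=
  \sum_(i < n) 'D_(e_x i) ('D_(e_x i) u) p.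

Definition classical_regularity Omega u : Prop :=
  [/\ {within closed_cyl Omega, continuous u},
      forall p, cyl Omega p -> derivable u p e_t,
      {within cyl Omega, continuous ('D_(e_t) u)},
      forall i j p, cyl Omega p ->
        derivable u p (e_x i) /\ derivable ('D_(e_x i) u) p (e_x j) &
      forall i j, {within cyl Omega, continuous ('D_(e_x j) ('D_(e_x i) u))}].

Definition viscous_solution Omega mu (eps : R)
    (u0 : 'rV[R]_n -> R) u : Prop :=
  [/\ classical_regularity Omega u,
      forall p, cyl Omega p ->
        'D_(e_t) u p - eps * laplacian u p = K0 Omega mu u p,
      forall x t, frontier Omega x -> 0 < t -> u (x, t) = 0 &
      forall x, Omega x -> u (x, 0) = u0 x].

Definition test_function Omega phi : Prop :=
  let supp := closure [set p | phi p != 0] in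
  [/\ smooth phi, compact supp & supp `<=` cyl Omega].

(* d_t u = f in D'(Omega x (0, oo)) *)
Definition distributional_dt Omega u (f : 'rV[R]_n * R -> R) : Prop :=
  forall phi, test_function Omega phi ->
    - (\int[lebesgue_cyl n]_(p in cyl Omega) (u p * 'D_(e_t) phi p)) =
    (\int[lebesgue_cyl n]_(p in cyl Omega) (f p * phi p)).

Definition limit_solution Omega mu (u0 : 'rV[R]_n -> R) u : Prop :=
  [/\ {within closed_cyl Omega, continuous u},
      distributional_dt Omega u (K0 Omega mu u) &
      forall x, Omega x -> u (x, 0) = u0 x].

Definition Linfty (D : set ('rV[R]_n * R)) u : Prop :=
  u \_ D \in Lfun (lebesgue_cyl n) +oo%E.

(* f eps -> u in L^oo(D) weak-star as eps -> 0+ *)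
Definition weak_star_cvg0 (D : set ('rV[R]_n * R))
    (f : R -> 'rV[R]_n * R -> R) u : Prop :=
  [/\ forall eps, 0 < eps -> Linfty D (f eps),
      Linfty D u &
      forall g, (lebesgue_cyl n).-integrable D (EFin \o g) ->
        (\int[lebesgue_cyl n]_(p in D) (f eps p * g p)) @[eps --> 0^'+] -->
        (\int[lebesgue_cyl n]_(p in D) (u p * g p))].

End problem.

(* Main.v *)
Require Import Defs.
From HB Require Import structures.
From mathcomp Require Import all_boot all_order all_algebra.
From mathcomp Require Import all_classical all_reals all_analysis.
From mathcomp Require Import measurable_realfun.
From mathcomp Require Import ring lra.

Set Implicit Arguments.
Unset Strict Implicit.
Unset Printing Implicit Defensive.

Import Order.TTheory GRing.Theory Num.Theory.
Import numFieldNormedType.Exports.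

Local Open Scope classical_set_scope.
Local Open Scope ring_scope.

(** Write [A f x] for the integral of [f (x + z) mu z] over the jumps [z] from [x] that end
    in the domain ([gain]). [A] is linear, positive and bounded by 1 in the sup norm, and
    [K0 = A - 1].

    _The limit problem._ [A] maps bounded functions that are continuous in [Omega] to
    continuous functions on the whole space ([gain_continuous]): this is dominated
    convergence, since the boundary, locally a graph, is a null set ([frontier_null]).
    So the limit problem is an ordinary differential equation with a bounded operator,
    solved by [u = exp (- t) * \sum_k t ^ k / k! * A ^ k u0] ([jump_flow]).

    _Pointwise convergence._ The limit [u] need not vanish on the boundary whereas the
    viscous solutions do, so a boundary layer must be allowed for. For [s = 1] and
    [s = -1], compare [s * u_eps] with the barrier
    [V = s * u + exp (2 t) * (M * layer + eta)], where [layer] is 1 on the boundary and 0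
    at depth more than [r], and [M] bounds [u0]. Then [V > 0] on the boundary, and since
    [A layer] is uniformly small with [r] ([gain_layer_small]), [V] is a strict
    supersolution of the limit equation. Now [V] has no second derivatives in space; the
    comparison nevertheless passes by doubling the variables ([viscous_comparison]). At a
    maximum of [s * u_eps (x, t) - V (y, t) - kap / 2 * |x - y| ^ 2] the viscous term costs
    at most [eps * n * kap], where [kap] depends on the size and the moduli of continuity
    of [V] and [A V] only; it is absorbed by the margin of [V] when [eps] is small. At a
    fixed [x] one takes [r] less than the depth of [x], and gets [s * u_eps <= s * u + e]
    there ([viscous_upper]).

    _Weak-star convergence._ By the maximum principle [|u_eps| <= M] ([viscous_le]), so
    dominated convergence applies against every integrable function.

    _Uniqueness._ If [W] is continuous and its distributional time derivative is
    nonpositive, then [W] decreases along the time lines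
    ([distributional_nonincreasing]): its values at [(x, a)] and [(x, b)] are compared by
    a test function whose time derivative is concentrated near these two points. Let [z]
    be the difference of two solutions and [m] the maximum of [|z| * exp (- 4 t)] on a
    bounded time interval. As [|K0 z| <= 2 m * exp (4 t)], this applies to
    [W = z - m / 2 * exp (4 t)] and to its analogue for [- z]; it yields [m <= m / 2], that
    is [z = 0] ([limit_solution_unique]). *)

(** * Borel measurability in space and in space-time *)

Section borel.
Context {R : realType} {n : nat}.
Local Notation X := ('rV[R]_n).
Local Notation XT := (X * measurableTypeR R)%type.

Lemma rV_ballE (x : X) (e : R) (e0 : 0 < e) :
  ball x e = [set y | forall i, `|x ord0 i - y ord0 i| < e].
Proof.
apply/seteqP; split=> y.
  by move=> [_ h] i; exact: h.
by move=> h; split=> // i j; rewrite (ord1 i); exact: h.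
Qed.

Lemma rV_nbhsP (x : X) (A : set X) : nbhs x A <->
  exists2 e : R, 0 < e & forall y : X, (forall i, `|x ord0 i - y ord0 i| < e) -> A y.
Proof.
rewrite nbhs_ballP; split=> -[e e0 h]; exists e => // y hy; apply: h.
  by rewrite rV_ballE.
by move: hy; rewrite rV_ballE.
Qed.

Lemma cyl_nbhsP (p : X * R) (A : set (X * R)) : nbhs p A <->
  exists2 e : R, 0 < e & forall q : X * R, (forall i, `|p.1 ord0 i - q.1 ord0 i| < e) ->
    `|p.2 - q.2| < e -> A q.
Proof.
rewrite nbhs_ballP; split=> -[e e0 h]; exists e => // q.
  move=> h1 h2; apply: h; split => /=; last exact: h2.
  by rewrite rV_ballE.
by move=> [h1 h2]; apply: h => //; move: h1; rewrite rV_ballE.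
Qed.

Lemma rat_approx (x e : R) : 0 < e -> exists q : rat, `|x - ratr q| < e.
Proof.
move=> e0; have : x - e < x + e by lra.
move=> /rat_in_itvoo[q]; rewrite in_itv /= => /andP[h1 h2].
by exists q; rewrite ltr_norml; apply/andP; split; lra.
Qed.

Lemma rV_rat_approx (x : X) (e : R) : 0 < e ->
  exists q : {ffun 'I_n -> rat}, forall i, `|x ord0 i - ratr (q i)| < e.
Proof.
move=> e0; have [f hf] := choice (fun i => rat_approx (x ord0 i) e0).
by exists (finfun f) => i; rewrite ffunE.
Qed.

Lemma measurable_rVbox (c : 'I_n -> R) (e : R) :
  measurable [set y : X | forall i, `|c i - y ord0 i| < e].
Proof.
rewrite (_ : [set y | _] = \bigcap_(i in [set: 'I_n])
  ((fun x : X => x ord0 i : measurableTypeR R) @^-1` ball (c i) e)).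
  apply: fin_bigcap_measurable; first exact: finite_finset.
  move=> i _; rewrite -[X in measurable X]setTI.
  apply: measurable_coord => //; exact: measurable_ball.
by apply/seteqP; split=> x /= h i; [move=> _|]; apply: h.
Qed.

(** The boxes of rational centre and of radius [1 / k] that lie in [U] are countably
    many and cover [U]. *)
Lemma open_measurable_rV (U : set X) : open U -> measurable U.
Proof.
move=> oU.
pose B (i : {ffun 'I_n -> rat} * nat) :=
  [set y : X | forall j, `|ratr (i.1 j) - y ord0 j| < i.2.+1%:R^-1].
pose F i := if `[< B i `<=` U >] then B i else set0.
have -> : U = \bigcup_i F i.
  apply/seteqP; split=> [x Ux|x [i _]]; last first.
    by rewrite /F; case: ifPn => // /asboolP BU; exact: BU.
  have [e e0 he] : exists2 e : R, 0 < e &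
    forall y : X, (forall i, `|x ord0 i - y ord0 i| < e) -> U y.
    by apply/rV_nbhsP; exact: open_nbhs_nbhs.
  have e20 : 0 < e / 2 by lra.
  have [k _ /(_ k (leqnn k))/= ke] := near_infty_natSinv_lt (PosNum e20).
  have k0 : 0 < k.+1%:R^-1 :> R by rewrite invr_gt0.
  have [q hq] := rV_rat_approx x k0.
  exists (q, k) => //; rewrite /F ifT; first by move=> j /=; rewrite distrC.
  apply/asboolP => y /= hy; apply: he => j.
  rewrite (splitr e) (le_lt_trans (ler_distD (ratr (q j)) _ _))//.
  by rewrite ltrD// (lt_trans _ ke).
apply: countable_bigcupT_measurable; first exact: countableP.
move=> i; rewrite /F; case: ifP => // _; exact: measurable_rVbox.
Qed.

Lemma open_measurable_cyl (U : set XT) : open U -> measurable U.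
Proof.
move=> oU.
pose B (i : {ffun 'I_n -> rat} * rat * nat) : set XT :=
  [set y : X | forall j, `|ratr (i.1.1 j) - y ord0 j| < i.2.+1%:R^-1] `*`
  ball (ratr i.1.2 : measurableTypeR R) i.2.+1%:R^-1.
pose F i := if `[< B i `<=` U >] then B i else set0.
have -> : U = \bigcup_i F i.
  apply/seteqP; split=> [x Ux|x [i _]]; last first.
    by rewrite /F; case: ifPn => // /asboolP BU; exact: BU.
  have [e e0 he] : exists2 e : R, 0 < e & forall q : X * R,
    (forall i, `|x.1 ord0 i - q.1 ord0 i| < e) -> `|x.2 - q.2| < e -> U q.
    by apply/cyl_nbhsP; exact: open_nbhs_nbhs.
  have e20 : 0 < e / 2 by lra.
  have [k _ /(_ k (leqnn k))/= ke] := near_infty_natSinv_lt (PosNum e20).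
  have k0 : 0 < k.+1%:R^-1 :> R by rewrite invr_gt0.
  have [q hq] := rV_rat_approx x.1 k0.
  have [r hr] := rat_approx x.2 k0.
  exists (q, r, k) => //; rewrite /F ifT.
    by split => /= [j|]; rewrite /ball /= distrC.
  apply/asboolP => y [/= hy hy2]; apply: he => [j|].
    rewrite (splitr e) (le_lt_trans (ler_distD (ratr (q j)) _ _))//.
    by rewrite ltrD// (lt_trans _ ke).
  rewrite (splitr e) (le_lt_trans (ler_distD (ratr r) _ _))//.
  by rewrite ltrD// (lt_trans _ ke).
apply: countable_bigcupT_measurable; first exact: countableP.
move=> i; rewrite /F; case: ifP => // _; apply: measurableX.
  exact: measurable_rVbox.
exact: measurable_ball.
Qed.

End borel.

(** Stated for any measurable topological space whose open sets are measurable,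
    so that it serves both space and space-time. *)
Lemma within_continuous_measurable (R : realType) d (T : measurableType d)
    (TT : topologicalType) (g : T -> TT) (D : set T) (DD : set TT) (f : TT -> R) :
  (forall U, open U -> measurable (g @^-1` U)) ->
  measurable D -> D `<=` g @^-1` DD -> {within DD, continuous f} ->
  measurable_fun D (f \o g).
Proof.
move=> mo mD DDD cf.
apply: (measurability _ (RGenOpens.measurableE R)) => _ [_ [a [b ->] <-]].
have /continuousP/(_ `]a, b[%classic (interval_open _ _)) := cf.
move=> /(_ isT isT) /open_subspaceP[V oV VE].
have -> : D `&` (f \o g) @^-1` `]a, b[%classic = D `&` (g @^-1` V).
  apply/seteqP; split=> x [Dx h]; split=> //.
    have : (V `&` DD) (g x) by rewrite VE; split => //; exact: DDD.
    by case.
  have : (V `&` DD) (g x) by split => //; exact: DDD.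
  by rewrite VE => -[].
by apply: measurableI => //; exact: mo.
Qed.

Lemma rV_continuous_measurable (R : realType) (n : nat) (D E : set 'rV[R]_n)
    (f : 'rV[R]_n -> R) :
  open D -> D `<=` E -> {within E, continuous f} -> measurable_fun D f.
Proof.
move=> oD DE cf; rewrite -[f]/(f \o id).
apply: within_continuous_measurable DE cf; last exact: open_measurable_rV.
by move=> U oU; exact: open_measurable_rV.
Qed.

Lemma cyl_continuous_measurable (R : realType) (n : nat)
    (D : set ('rV[R]_n * measurableTypeR R)) (E : set ('rV[R]_n * R))
    (f : 'rV[R]_n * R -> R) :
  measurable D -> D `<=` E -> {within E, continuous f} ->
  measurable_fun D (f : 'rV[R]_n * measurableTypeR R -> R).
Proof.
move=> mD DE cf; rewrite -[f]/(f \o id).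
apply: (within_continuous_measurable _ mD DE cf).
by move=> U oU; exact: open_measurable_cyl.
Qed.

(** * The boundary is a null set *)

Section translation.
Context {R : realType}.
Local Open Scope ereal_scope.

Lemma lebesgue_measure_translation (a : R) (A : set (measurableTypeR R)) :
  measurable A ->
  lebesgue_measure ((fun x : measurableTypeR R => (a + x)%R) @^-1` A) =
  lebesgue_measure A.
Proof.
move=> mA.
have mt : measurable_fun [set: measurableTypeR R]
    (fun x : measurableTypeR R => (a + x)%R : measurableTypeR R).
  exact: measurable_funD.
apply/esym; rewrite -[RHS]/(pushforward lebesgue_measure
  (fun x : measurableTypeR R => (a + x)%R : measurableTypeR R) A).
apply: lebesgue_measure_unique => //= _ [[c d]] _ <-.
rewrite /pushforward.
rewrite (_ : _ @^-1` _ = `](c - a)%R, (d - a)%R]%classic); last first.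
  by apply/seteqP; split => x /=; rewrite !in_itv/= => /andP[? ?];
    apply/andP; split; lra.
rewrite /= !lebesgue_measure_itv/= !lte_fin ltrD2r.
by case: ifPn => // _; rewrite -!EFinB; congr EFin; lra.
Qed.

Lemma measurable_translation n (c : 'rV[R]_n) :
  measurable_fun [set: 'rV[R]_n] (fun x => (c + x)%R).
Proof.
apply: measurable_fun_rV => i.
rewrite (_ : _ \o _ = fun x : 'rV[R]_n => (c ord0 i + x ord0 i)%R).
  by apply: measurable_funD => //; exact: measurable_coord.
by apply/funext => x /=; rewrite mxE.
Qed.

(** By uniqueness of the product measure, as [consrV] turns a translation into a pair
    of translations. *)
Lemma lebesgue_rV_translation n (c : 'rV[R]_n) (A : set 'rV[R]_n) :
  measurable A ->
  lebesgue_rV n ((fun x => (c + x)%R) @^-1` A) = lebesgue_rV n A.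
Proof.
elim: n c A => [|n IH] c A mA.
  rewrite (_ : _ @^-1` A = A)//; apply/seteqP; split => x /=;
  by rewrite (_ : (c + x)%R = x)//; apply/rowP => -[].
rewrite /= /lebesgue_rV_step /pushforward.
pose a := c ord0 ord0; pose v : 'rV[R]_n := \row_j c ord0 (lift ord0 j).
pose tr (p : measurableTypeR R * 'rV[R]_n) : measurableTypeR R * 'rV[R]_n :=
  (a + p.1, v + p.2)%R.
have trE p : consrV (tr p) = (c + consrV p)%R.
  apply/rowP => i; rewrite !mxE; case: (unliftP ord0 i) => [j ->|->] /=.
    by rewrite !mxE.
  by [].
rewrite -comp_preimage (_ : _ \o _ = @consrV _ n \o tr); last first.
  by apply/funext => p /=; rewrite trE.
rewrite comp_preimage.
have mtr : measurable_fun setT tr.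
  apply: measurable_fun_pair.
    by apply: measurable_funD => //; exact: measurable_fst.
  apply: (@measurableT_comp _ _ _ _ _ _ (fun x => (v + x)%R)).
    exact: measurable_translation.
  exact: measurable_snd.
have mcA : measurable (@consrV _ n @^-1` A).
  by rewrite -[X in measurable X]setTI; exact: measurable_consrV.
apply/esym; rewrite -[RHS]/(pushforward (lebesgue_measure \x lebesgue_rV n)%E tr _).
apply: product_measure_unique => // B C mB mC.
rewrite /= /pushforward (_ : tr @^-1` _ =
    ((fun x : measurableTypeR R => (a + x)%R) @^-1` B) `*`
    ((fun x => (v + x)%R) @^-1` C)); last by apply/seteqP; split.
rewrite product_measure1E.
- rewrite IH//; congr (_ * _)%E; exact: lebesgue_measure_translation.
- by rewrite -[X in measurable X]setTI; apply: measurable_funD.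
- by rewrite -[X in measurable X]setTI; apply: measurable_translation.
Qed.

(** The translates of [A] by the vectors [- e / (k + 1)] are pairwise disjoint, of equal
    measure, and all lie in a set of finite measure. *)
Lemma lebesgue_rV_null n (e : 'rV[R]_n) (A D : set 'rV[R]_n) :
  measurable A -> measurable D -> lebesgue_rV n D < +oo ->
  (forall k : nat, A `<=` (fun x => (k.+1%:R^-1 *: e + x)%R) @^-1` D) ->
  (forall (x : 'rV[R]_n) (s : R), A x -> A (s *: e + x)%R -> s = 0%R) ->
  lebesgue_rV n A = 0.
Proof.
move=> mA mD Doo AD Ae.
pose F (k : nat) : set 'rV[R]_n := (fun x => (- (k.+1%:R^-1 *: e) + x)%R) @^-1` A.
have mF k : measurable (F k).
  by rewrite -[X in measurable X]setTI; exact: measurable_translation.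
have FD : \bigcup_k F k `<=` D.
  move=> x [k _ Fx]; have := AD k _ Fx.
  by rewrite /preimage/= addrA subrr add0r.
have tF : trivIset setT F.
  apply/trivIsetP => i j _ _ ij; apply/seteqP; split=> // x [Fi Fj].
  have := Ae (- (i.+1%:R^-1 *: e) + x)%R (i.+1%:R^-1 - j.+1%:R^-1)%R Fi.
  rewrite scalerBl [X in A X](_ : _ = (- (j.+1%:R^-1 *: e) + x)%R); last first.
    by rewrite addrA; congr (_ + _)%R; rewrite addrAC subrr add0r.
  move=> /(_ Fj)/eqP; rewrite subr_eq0 => /eqP/invr_inj/eqP.
  by rewrite eqr_nat eqSS (negbTE ij).
apply/eqP; rewrite eq_le measure_ge0 andbT leNgt; apply/negP => A0.
have FE k : lebesgue_rV n (F k) = lebesgue_rV n A.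
  exact: lebesgue_rV_translation.
have mUF : measurable (\bigcup_k F k) by exact: bigcup_measurable.
have UD : \sum_(i <oo) lebesgue_rV n (F i) <= lebesgue_rV n D.
  rewrite -(measure_semi_bigcup (lebesgue_rV n) mF tF mUF).
  by apply: le_measure; rewrite ?inE.
have {}UD : \sum_(i <oo) lebesgue_rV n A <= lebesgue_rV n D.
  suff -> : \sum_(i <oo) lebesgue_rV n A = \sum_(i <oo) lebesgue_rV n (F i).
    exact: UD.
  by apply: eq_eseriesr => k _; rewrite FE.
have A_fin : lebesgue_rV n A \is a fin_num.
  rewrite ge0_fin_numE//; apply: le_lt_trans Doo; apply: le_trans UD.
  apply: le_trans (nneseries_lim_ge 1%N _) => //.
  by rewrite big_nat1.
have D_fin : lebesgue_rV n D \is a fin_num by rewrite ge0_fin_numE.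
have NA N : (N%:R * fine (lebesgue_rV n A) <= fine (lebesgue_rV n D))%R.
  rewrite -lee_fin (fineK D_fin); apply: le_trans UD.
  apply: le_trans (nneseries_lim_ge N _) => //.
  rewrite big_mkord -(fineK A_fin) sumEFin /= sumr_const card_ord mulr_natl.
  by rewrite lee_fin.
have A0' : (0 < fine (lebesgue_rV n A))%R by rewrite fine_gt0// A0 -ge0_fin_numE.
have := archi_boundP (divr_ge0 (fine_ge0 (measure_ge0 (lebesgue_rV n) D)) (ltW A0')).
rewrite ltr_pdivrMr// => h.
by have := lt_le_trans h (NA _); rewrite ltxx.
Qed.

End translation.

Section frontier.
Context {R : realType} {n : nat}.
Local Notation X := ('rV[R]_n).
Implicit Types Omega : set X.

Lemma coord_rV_continuous (i : 'I_n) : continuous (fun x : X => x ord0 i).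
Proof. exact: coord_continuous. Qed.

Lemma col'_continuous (i : 'I_n) :
  continuous (fun x : X => col' i x : 'rV[R]_n.-1).
Proof.
move=> x A /rV_nbhsP[e e0 h]; apply/rV_nbhsP; exists e => // y hy.
by apply: h => j; rewrite !mxE; exact: hy.
Qed.

Lemma closed_frontier Omega : closed (frontier Omega).
Proof.
rewrite /frontier setDE; apply: closedI; first exact: closed_closure.
exact/open_closedC/open_interior.
Qed.

Lemma open_frontier_disjoint Omega x : open Omega -> Omega x -> ~ frontier Omega x.
Proof. by move=> oO Ox [_]; rewrite ((interior_id _).1 oO). Qed.

Lemma closure_or_frontier Omega x : open Omega -> closure Omega x ->
  Omega x \/ frontier Omega x.
Proof.
move=> oO cx; have [|h] := pselect (Omega x); first by left.
by right; split => //; rewrite ((interior_id _).1 oO).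
Qed.

(** The defining function is continuous: where it does not vanish, a whole
    neighbourhood lies in [Omega] or misses it. *)
Lemma frontier_graph Omega (i : 'I_n) (s : bool) (gamma : 'rV[R]_n.-1 -> R) x :
  continuous gamma ->
  (\forall y \near x, Omega y <-> 0 < (-1) ^+ s * (y ord0 i - gamma (col' i y))) ->
  frontier Omega x -> x ord0 i = gamma (col' i x).
Proof.
move=> cg nx [clx Nix]; pose g (y : X) := (-1) ^+ s * (y ord0 i - gamma (col' i y)).
have cg' : {for x, continuous g}.
  have cgc : {for x, continuous (gamma \o (fun y : X => col' i y))}.
    by apply: continuous_comp; [exact: col'_continuous|exact: cg].
  exact: cvgM (@cvg_cst _ _ _ _ _) (cvgB (@coord_rV_continuous i x) cgc).
have [gx|gx|gx] := ltgtP (g x) 0.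
- have ng : \forall y \near x, g y < 0.
    apply: (cg' [set r | r < 0]); apply: open_nbhs_nbhs; split; [exact: open_lt|exact: gx].
  have [y [Oy [h1 h2]]] := clx _ (filterI nx ng).
  by have := lt_trans (h1.1 Oy) h2; rewrite ltxx.
- exfalso; apply: Nix.
  have ng : \forall y \near x, 0 < g y.
    apply: (cg' [set r | 0 < r]); apply: open_nbhs_nbhs; split; [exact: open_gt|exact: gx].
  by near=> y; have -> : Omega y <-> 0 < g y; near: y.
- move: gx; rewrite /g => /eqP; rewrite mulf_eq0 signr_eq0/= subr_eq0.
  by move/eqP.
Unshelve. all: by end_near. Qed.

Lemma rV_box_open (c : 'I_n -> R) (r : R) (z : X) :
  (forall j, `|c j - z ord0 j| < r) ->
  exists2 e : R, 0 < e & forall y : X, (forall i, `|z ord0 i - y ord0 i| < e) ->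
    forall j, `|c j - y ord0 j| < r.
Proof.
move=> hz; pose e := \big[Order.min/1]_(j < n) (r - `|c j - z ord0 j|).
exists e.
  by rewrite /e; elim/big_ind : _ => // [a b a0 b0|j _];
    rewrite ?lt_min ?a0 ?subr_gt0.
move=> y hy j; rewrite (le_lt_trans (ler_distD (z ord0 j) _ _))//.
rewrite addrC -ltrBrDr (lt_le_trans (hy j))//.
by rewrite /e (bigD1 j)//= ge_min lexx.
Qed.

Lemma lebesgue_rVbox (c : X) (e : R) : 0 <= e ->
  (lebesgue_rV n [set y : X | (forall i, `|c ord0 i - y ord0 i| < e)%R] =
   (\prod_(i < n) (e *+ 2))%:E)%E.
Proof.
move=> e0.
rewrite (_ : [set y | _] = [set y : X | forall i,
   (ball (c ord0 i) e : set (measurableTypeR R)) (y ord0 i)])//.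
rewrite (@lebesgue_rV_box R n
  (fun i => ball (c ord0 i : R) e : set (measurableTypeR R))); last first.
  by move=> i; exact: measurable_ball.
by under eq_bigr do rewrite lebesgue_measure_ball//; rewrite prodEFin.
Qed.

(** Countably many rational boxes localize the problem; in a small one the boundary is a
    piece of a graph above a coordinate hyperplane, and the translates of a graph along
    its axis are disjoint. *)
Lemma frontier_null Omega : smooth_boundary Omega ->
  lebesgue_rV n (frontier Omega) = 0%E.
Proof.
move=> sb; have mF : measurable (frontier Omega).
  by rewrite -[frontier _]setCK; apply: measurableC; apply: open_measurable_rV;
    exact/closed_openC/closed_frontier.
pose B (i : {ffun 'I_n -> rat} * nat) :=
  [set y : X | forall j, `|ratr (i.1 j) - y ord0 j| < i.2.+1%:R^-1].
pose G i := if `[< lebesgue_rV n (frontier Omega `&` B i) = 0%E >]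
  then frontier Omega `&` B i else set0.
have mG i : measurable (G i).
  by rewrite /G; case: ifP => // _; apply: measurableI => //; exact: measurable_rVbox.
have G0 i : lebesgue_rV n (G i) = 0%E.
  by rewrite /G; case: ifPn => [/asboolP//|]; rewrite measure0.
pose H k := if unpickle k is Some i then G i else set0.
suff -> : frontier Omega = \bigcup_k H k.
  apply/negligibleP.
    by apply: bigcup_measurable => k _; rewrite /H; case: unpickle.
  apply: negligible_bigcup => k; rewrite /H; case: unpickle => [i|].
    exact/negligibleP/G0.
  exact: negligible_set0.
apply/seteqP; split => [x fx|x [k _]]; last first.
  by rewrite /H/G; case: unpickle => // i; case: ifP => // _ [].
have [i [s [gamma [sg /rV_nbhsP[e e0 he]]]]] := sb x fx.
have cg : continuous gamma by have [] := sg [::].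
have e20 : 0 < e / 2 by lra.
have [k _ /(_ k (leqnn k))/= ke] := near_infty_natSinv_lt (PosNum e20).
have k0 : 0 < k.+1%:R^-1 :> R by rewrite invr_gt0.
have [q hq] := rV_rat_approx x k0.
exists (pickle (q, k)) => //; rewrite /H pickleK /G; case: asboolP => [_|].
  by split => // j; rewrite distrC; exact: hq.
case.
have near_B y : B (q, k) y -> (\forall z \near y, Omega z <-> 0 < (-1) ^+ s * (z ord0 i - gamma (col' i z))).
  move=> By; have oB : open (B (q, k)).
    rewrite openE => z Bz; apply/rV_nbhsP.
    exact: rV_box_open Bz.
  have : \forall z \near y, B (q, k) z by exact: open_nbhs_nbhs.
  apply: filterS => z Bz; apply: he => j.
  rewrite (splitr e) (le_lt_trans (ler_distD (ratr (q j)) _ _))//.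
  by rewrite ltrD// (lt_trans _ ke)//; exact: Bz.
pose D := [set y : X | forall j, `|(\row_j ratr (q j) : X) ord0 j - y ord0 j| < 1 + k.+1%:R^-1].
apply: (@lebesgue_rV_null _ _ (delta_mx ord0 i) _ D).
- by apply: measurableI => //; exact: measurable_rVbox.
- exact: measurable_rVbox.
- by rewrite lebesgue_rVbox ?ltry// addr_ge0 ?ler01// ltW.
- move=> l y [_ By] j /=; rewrite !mxE eqxx /=.
  rewrite opprD addrCA (le_lt_trans (ler_normD _ _))// ler_ltD//.
    rewrite normrN normrM normr_nat gtr0_norm ?invr_gt0//.
    by case: (_ == _); rewrite ?mulr1 ?mulr0// invf_le1 ?ler1n.
- move=> y t [fy By] [ft Bt].
  have := frontier_graph cg (near_B _ By) fy.
  have := frontier_graph cg (near_B _ Bt) ft.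
  rewrite (_ : col' i (t *: _ + y) = col' i y).
    by rewrite !mxE !eqxx/= mulr1 => h1 h2; lra.
  apply/rowP => j; rewrite !mxE [_ == i]eq_sym (negbTE (neq_lift _ _)).
  by rewrite andbF mulr0 add0r.
Qed.

End frontier.

(** * The gain operator *)

(** A limit at a point is reduced to sequences in order to use dominated
    convergence. *)
Lemma within_cvg_seq (R : realType) (V : normedModType R) (W : topologicalType)
    (f : V -> W) (D : set V) (p : V) (l : W) :
  (forall s : nat -> V, (forall k, D (s k)) ->
     (forall k, `|p - s k| < k.+1%:R^-1) -> f (s k) @[k --> \oo] --> l) ->
  f x @[x --> within D (nbhs p)] --> l.
Proof.
move=> H; apply: contrapT => nf.
have [U [nU hU]] : exists U, nbhs l U /\ ~ (f x @[x --> within D (nbhs p)]) U.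
  apply: contrapT => h; apply: nf => U nU; apply: contrapT => hU.
  by apply: h; exists U.
have ex k : exists x, [/\ D x, `|p - x| < k.+1%:R^-1 & ~ U (f x)].
  apply: contrapT => h; apply: hU; rewrite /= /within /=.
  apply/nbhs_normP; exists k.+1%:R^-1; first by rewrite /= invr_gt0.
  move=> x px Dx; apply: contrapT => nUx; apply: h; exists x; split => //.
have [s hs] := choice ex.
have := H s (fun k => let: And3 a _ _ := hs k in a)
  (fun k => let: And3 _ a _ := hs k in a).
move=> /(_ U nU)[N _ /(_ N (leqnn N))] /=.
by have [_ _] := hs N.
Qed.

Lemma Rdominated_convergence d (T : measurableType d) (R : realType)
    (m : {measure set T -> \bar R}) (D : set T) (f_ : nat -> T -> R)
    (f g : T -> R) :
  measurable D -> (forall k, measurable_fun D (f_ k)) -> measurable_fun D f ->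
  {ae m, forall x, D x -> f_ k x @[k --> \oo] --> f x} ->
  m.-integrable D (EFin \o g) ->
  (forall x k, D x -> `|f_ k x| <= g x) ->
  \int[m]_(x in D) f_ k x @[k --> \oo] --> \int[m]_(x in D) f x.
Proof.
move=> mD mf_ mf ff ig fg.
have [|||||i1 _ c] := @dominated_convergence _ _ _ m D mD (fun k => EFin \o f_ k)
  (EFin \o f) (EFin \o g).
- by move=> k; exact/measurable_EFinP.
- exact/measurable_EFinP.
- apply: filterS ff => x + Dx => /(_ Dx) h.
  by apply: cvg_EFin => //; apply: nearW.
- exact: ig.
- by apply: aeW => x k Dx; rewrite /= lee_fin; exact: fg.
apply: (@fine_cvg _ _ _ _ _ (\int[m]_(x in D) f x)).
rewrite /Rintegral fineK; first exact: c.
exact: integrable_fin_num.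
Qed.

Lemma continuous_expR_snd {R : realType} {X : topologicalType} (c : R) :
  continuous (fun p : X * R => expR (c * p.2)).
Proof.
have cE : continuous (fun t : R => expR (c * t)).
  move=> t; apply: continuous_comp; last exact: continuous_expR.
  by apply: cvgM; [exact: cvg_cst|exact: cvg_id].
move=> p; apply: (@cvg_comp _ _ _ snd (fun t => expR (c * t)) _ (nbhs p.2)).
  exact: cvg_snd.
exact: cE.
Qed.

Section nonlocal.
Context {R : realType} {n : nat}.
Local Notation X := ('rV[R]_n).
Local Notation leb := (@lebesgue_rV R n).
Variables (Omega : set X) (mu : X -> R).
Hypothesis Omega_open : open Omega.
Hypothesis mu_ge0 : forall z, 0 <= mu z.
Hypothesis mu_L1 : leb.-integrable setT (EFin \o mu).
Hypothesis mu_mass1 : \int[leb]_z mu z = 1.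

Definition gain (f : X -> R) (x : X) : R :=
  \int[leb]_(z in [set z | Omega (x + z)]) (f (x + z) * mu z).

Lemma K0E u p : K0 Omega mu u p = gain (fun y => u (y, p.2)) p.1 - u p.
Proof. by []. Qed.

(** The functions on which [gain] is linear; what they do outside [Omega] is free. *)
Definition bounded_measurable (f : X -> R) : Prop :=
  measurable_fun Omega f /\ exists C, forall y, Omega y -> `|f y| <= C.

Lemma measurable_shift x : measurable [set z | Omega (x + z)].
Proof.
rewrite -[X in measurable X]setTI; apply: measurable_translation => //.
exact: open_measurable_rV.
Qed.

Lemma measurable_gain_integrand f x : bounded_measurable f ->
  measurable_fun [set z | Omega (x + z)] (fun z => f (x + z) * mu z).
Proof.
move=> [mf _]; apply: measurable_funM.
  apply: (measurable_comp (F := Omega)) => //.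
  - exact: open_measurable_rV.
  - by move=> _ [z Oz <-].
  - by apply: measurable_funTS; exact: measurable_translation.
apply: measurable_funTS; apply/measurable_EFinP.
by case/integrableP : mu_L1.
Qed.

Lemma mu_integrableZ C : leb.-integrable setT (EFin \o (fun z => C * mu z)).
Proof.
by apply: eq_integrable (integrableZl _ C mu_L1) => // z _; rewrite /= EFinM.
Qed.

Lemma integrable_gain f x : bounded_measurable f ->
  leb.-integrable [set z | Omega (x + z)] (EFin \o (fun z => f (x + z) * mu z)).
Proof.
move=> bf; have [mf [C hC]] := bf.
apply: (@le_integrable _ _ _ leb _ (measurable_shift x) _
  (EFin \o (fun z => C * mu z))).
- by apply/measurable_EFinP; exact: measurable_gain_integrand.
- move=> z Oz; rewrite /= lee_fin !normrM ler_wpM2r//.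
  by rewrite (le_trans (hC _ Oz)) // ler_norm.
- by apply: integrableS (mu_integrableZ C) => //; exact: measurable_shift.
Qed.

Lemma bounded_measurableD f g : bounded_measurable f -> bounded_measurable g ->
  bounded_measurable (fun y => f y + g y).
Proof.
move=> [mf [C hC]] [mg [C' hC']]; split; first exact: measurable_funD.
exists (C + C') => y Oy; rewrite (le_trans (ler_normD _ _))// lerD ?hC ?hC'//.
Qed.

Lemma bounded_measurableZ a f : bounded_measurable f ->
  bounded_measurable (fun y => a * f y).
Proof.
move=> [mf [C hC]]; split; first exact: measurable_funM.
by exists (`|a| * C) => y Oy; rewrite normrM ler_wpM2l ?hC.
Qed.

Lemma bounded_measurable_cst a : bounded_measurable (fun=> a).
Proof. by split; [exact: measurable_cst | exists `|a|]. Qed.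

Lemma gainD f g x : bounded_measurable f -> bounded_measurable g ->
  gain (fun y => f y + g y) x = gain f x + gain g x.
Proof.
move=> bf bg; rewrite /gain -RintegralD//; first last.
- exact: integrable_gain.
- exact: integrable_gain.
- exact: measurable_shift.
by apply: eq_Rintegral => z _; rewrite mulrDl.
Qed.

Lemma gainZ a f x : bounded_measurable f ->
  gain (fun y => a * f y) x = a * gain f x.
Proof.
move=> bf; rewrite /gain -RintegralZl//.
- by apply: eq_Rintegral => z _; rewrite mulrA.
- exact: measurable_shift.
- exact: integrable_gain.
Qed.

Lemma gainB f g x : bounded_measurable f -> bounded_measurable g ->
  gain (fun y => f y - g y) x = gain f x - gain g x.
Proof.
move=> bf bg; rewrite -[- gain g x]mulN1r -gainZ// -gainD//.
  by congr gain; apply/funext => y; rewrite mulN1r.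
exact: bounded_measurableZ.
Qed.

Lemma eq_gain f g x : (forall y, Omega y -> f y = g y) -> gain f x = gain g x.
Proof. by move=> fg; apply: eq_Rintegral => z; rewrite inE => /fg ->. Qed.

Lemma gain_cst_le a x : 0 <= a -> gain (fun=> a) x <= a.
Proof.
move=> a0; rewrite -[leRHS]mulr1 -mu_mass1 -RintegralZl//.
rewrite /gain Rintegral_mkcond; apply: le_Rintegral => //.
- rewrite -restrict_EFin; apply/(integrable_mkcond _ (measurable_shift x)).1.
  by apply: integrableS (mu_integrableZ a) => //; exact: measurable_shift.
- exact: mu_integrableZ.
- move=> z _; rewrite /restrict; case: ifP => // _; exact: mulr_ge0.
Qed.

Lemma gain_le f g x : bounded_measurable f -> bounded_measurable g ->
  (forall y, Omega y -> f y <= g y) -> gain f x <= gain g x.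
Proof.
move=> bf bg fg; apply: le_Rintegral => //.
- exact: measurable_shift.
- exact: integrable_gain.
- exact: integrable_gain.
- by move=> z /fg h; rewrite ler_wpM2r.
Qed.

Lemma gain_le_cst f a x : bounded_measurable f -> 0 <= a ->
  (forall y, Omega y -> f y <= a) -> gain f x <= a.
Proof.
move=> bf a0 fa; apply: le_trans (gain_cst_le x a0).
by apply: gain_le => //; exact: bounded_measurable_cst.
Qed.

Lemma norm_gain_le f a x : bounded_measurable f -> 0 <= a ->
  (forall y, Omega y -> `|f y| <= a) -> `|gain f x| <= a.
Proof.
move=> bf a0 fa; rewrite ler_norml; apply/andP; split.
  rewrite lerNl -mulN1r -gainZ//; apply: gain_le_cst => //.
    exact: bounded_measurableZ.
  by move=> y /fa; rewrite ler_norml mulN1r lerNl => /andP[].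
by apply: gain_le_cst => // y /fa; rewrite ler_norml => /andP[].
Qed.

End nonlocal.

(** * Continuity of the gain *)

Section gain_continuity.
Context {R : realType} {n : nat}.
Local Notation X := ('rV[R]_n).
Local Notation leb := (@lebesgue_rV R n).
Variables (Omega : set X) (mu : X -> R).
Hypothesis Omega_open : open Omega.
Hypothesis frontier0 : leb (frontier Omega) = 0%E.
Hypothesis mu_ge0 : forall z, 0 <= mu z.
Hypothesis mu_L1 : leb.-integrable setT (EFin \o mu).

Lemma slice_measurable (w : X * R -> R) t : 0 <= t ->
  {within Omega `*` [set t | 0 <= t], continuous w} ->
  measurable_fun Omega (fun y => w (y, t)).
Proof.
move=> t0 cw; rewrite (_ : (fun y => _) = w \o (fun y => (y, t)))//.
apply: (within_continuous_measurable _ _ _ cw).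
- move=> U oU; apply: open_measurable_rV.
  apply: open_comp oU => y _.
  exact: (@cvg_pair _ _ _ (nbhs y) (nbhs y) (nbhs t) _ _ _ id (cst t) cvg_id (@cvg_cst _ _ _ _ _)).
- exact: open_measurable_rV.
- by move=> y Oy; split.
Qed.

(** As the point varies, the integrand converges at each [z] for which [x + z] is off the
    frontier: by continuity if [x + z] is inside, and because it is eventually 0 if
    [x + z] is outside. The exceptional [z] form a translate of a null set. *)
Lemma gain_continuous (w : X * R -> R) :
  {within Omega `*` [set t | 0 <= t], continuous w} ->
  (forall T, exists C, forall y t, Omega y -> 0 <= t <= T -> `|w (y, t)| <= C) ->
  {within [set p : X * R | 0 <= p.2],
    continuous (fun p => gain Omega mu (fun y => w (y, p.2)) p.1)}.
Proof.
move=> cw bw.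
rewrite (_ : (fun p => _) = (fun q => \int[leb]_z
    (((fun z => w (q.1 + z, q.2) * mu z) \_ [set z | Omega (q.1 + z)]) z))).
2: by apply/funext => q; exact: Rintegral_mkcond.
apply/subspace_continuousP => p p0.
apply: within_cvg_seq => s s0 sp.
have sT k : 0 <= (s k).2 <= p.2 + 1.
  rewrite s0/=; have : `|(p - s k).2| < 1.
    apply: le_lt_trans (lt_le_trans (sp k) _).
      by rewrite [leRHS]prod_normE le_max lexx orbT.
    by rewrite invf_le1// ler1n.
  by rewrite ltr_norml /= => /andP[h _]; lra.
have [C hC] := bw (p.2 + 1).
have bm t : 0 <= t <= p.2 + 1 -> bounded_measurable Omega (fun y => w (y, t)).
  move=> /[dup] tT /andP[t0 _]; split; first exact: slice_measurable.
  by exists C => y Oy; exact: hC.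
have pT : 0 <= p.2 <= p.2 + 1 by rewrite p0 ler_wpDr.
have cs : s k @[k --> \oo] --> p.
  apply/cvgrPdist_lt => e e0; near=> k; rewrite (lt_trans (sp k))//.
  by near: k; exact: (near_infty_natSinv_lt (PosNum e0)).
have mres q : 0 <= q.2 <= p.2 + 1 -> measurable_fun setT
    ((fun z => w (q.1 + z, q.2) * mu z) \_ [set z | Omega (q.1 + z)]).
  move=> qT; exact: ((measurable_restrictT _ (measurable_shift Omega_open q.1)).1
    (@measurable_gain_integrand _ _ _ _ Omega_open mu_L1 _ q.1 (bm _ qT))).
apply: (Rdominated_convergence _ (g := fun z => `|C| * mu z)) => //.
- by move=> k; exact: mres.
- exact: mres.
- exists [set z | frontier Omega (p.1 + z)].
  have mF : measurable (frontier Omega).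
    by rewrite -[frontier _]setCK; apply: measurableC; apply: open_measurable_rV;
      exact/closed_openC/closed_frontier.
  split.
  + rewrite -[X in measurable X]setTI.
    by have := @measurable_translation R n p.1 measurableT _ mF.
  + by rewrite -frontier0; exact: lebesgue_rV_translation.
  + move=> z; rewrite /= => nz; apply: contrapT => Nz; apply: nz => _.
    have cs' : (s k + (z, 0)) @[k --> \oo] --> p + (z, 0).
      by apply: cvgD => //; exact: cvg_cst.
    have rIn (q : X * R) : Omega (q.1 + z) -> ((fun z => w (q.1 + z, q.2) * mu z)
        \_ [set z | Omega (q.1 + z)]) z = w (q.1 + z, q.2) * mu z.
      by move=> h; rewrite /restrict mem_set.
    have rOut (q : X * R) : ~ Omega (q.1 + z) ->
        ((fun z => w (q.1 + z, q.2) * mu z) \_ [set z | Omega (q.1 + z)]) z = 0.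
      by move=> h; rewrite /restrict memNset.
    have [Oz|nOz] := pselect (Omega (p.1 + z)).
      have near_O : \forall k \near \oo, Omega ((s k).1 + z).
        apply: (cs' [set q | Omega q.1]).
        apply: (@cvg_fst _ _ (nbhs (p.1 + z)) (nbhs (p.2 + 0)) _ Omega).
        exact: open_nbhs_nbhs.
      rewrite rIn//.
      apply: (@cvg_trans _ (w ((s k).1 + z, (s k).2) * mu z @[k --> \oo])).
        apply: near_eq_cvg; near=> k.
        by rewrite rIn//; near: k.
      apply: cvgM; last exact: cvg_cst.
      move=> U nU; have /subspace_continuousP/(_ (p.1 + z, p.2) (conj Oz p0)) := cw.
      move=> /(_ U nU) nw.
      have := cs'; rewrite (_ : p + (z, 0) = (p.1 + z, p.2)); last first.
        by rewrite [LHS]surjective_pairing /= addr0.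
      move=> /(_ _ nw) /= h.
      suff : \forall k \near \oo, U (w ((s k).1 + z, (s k).2)) by [].
      near=> k.
      have : ((s k + (z, 0)).1, (s k + (z,0)).2) = ((s k).1 + z, (s k).2).
        by rewrite /= addr0.
      rewrite -surjective_pairing => E.
      have : (Omega `*` [set t | 0 <= t]) (s k + (z, 0)) ->
          U (w (s k + (z, 0))) by near: k.
      rewrite E; apply; split; last exact: s0.
      by rewrite /=; near: k.
    have ncl : (~` closure Omega) (p.1 + z).
      by move=> /(closure_or_frontier Omega_open)[].
    have near_N : \forall k \near \oo, ~ Omega ((s k).1 + z).
      apply: (cs' [set q | ~ Omega q.1]).
      apply: (@cvg_fst _ _ (nbhs (p.1 + z)) (nbhs (p.2 + 0)) _ (~` Omega)).
      apply: filterS (open_nbhs_nbhs (conj _ ncl)).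
        by move=> y /= + Oy; apply; exact: subset_closure.
      exact/closed_openC/closed_closure.
    rewrite rOut//.
    apply: (@cvg_trans _ ((0 : R) @[k --> \oo])); last exact: cvg_cst.
    apply: near_eq_cvg; near=> k.
    by rewrite rOut//; near: k.
- exact: mu_integrableZ.
- move=> z k _; rewrite /restrict; case: ifPn => [|_].
    rewrite inE => Oz; rewrite normrM (ger0_norm (mu_ge0 z)) ler_wpM2r//.
    by rewrite (le_trans (hC _ _ Oz (sT k)))// ler_norm.
  by rewrite normr0 mulr_ge0.
Unshelve. all: by end_near. Qed.

End gain_continuity.

Lemma compact_uniformly_continuous (R : realType) (V : normedModType R)
    (K : set V) (f : V -> R) :
  compact K -> {within K, continuous f} -> forall e, 0 < e ->
  exists2 d, 0 < d & forall x y, K x -> K y -> `|x - y| < d -> `|f x - f y| < e.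
Proof.
move=> /compact_near_coveringP cK cf e e0.
have := cK R (0^'+) (fun d x => K x -> forall y, K y -> `|x - y| < d -> `|f x - f y| < e) _.
have main : forall x, K x -> \forall x' \near x & i \near 0^'+,
    K x' -> forall y, K y -> `|x' - y| < i -> `|f x' - f y| < e.
  move=> x Kx; have /subspace_continuousP/(_ x Kx) := cf.
  have e20 : 0 < e / 2 by lra.
  move=> /cvgrPdist_lt/(_ _ e20) /nbhs_normP[r /= r0 hr].
  have r20 : 0 < r / 2 by lra.
  near=> x' i => Kx' y Ky xy.
  have hx' : `|x - x'| < r / 2.
    near: x'; apply/nbhs_normP; exists (r / 2) => //.
  have hi : i < r / 2 by near: i; exact: nbhs_right_lt.
  have h1 : `|f x - f x'| < e / 2.
    by apply: hr => //; rewrite /= (lt_trans hx')//; lra.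
  have h2 : `|f x - f y| < e / 2.
    apply: hr => //; rewrite /= (le_lt_trans (ler_distD x' _ _))//.
    have := lt_trans xy hi; lra.
  rewrite (le_lt_trans (ler_distD (f x) _ _))// distrC; lra.
move=> /(_ _ main) h.
have : \forall d \near 0^'+, 0 < d /\ forall x, K x -> K x -> forall y, K y -> `|x - y| < d -> `|f x - f y| < e.
  near=> d; split; first by near: d; exact: nbhs_right_gt.
  by near: d; exact: h.
move=> /filter_ex[d [d0 hd]]; exists d => // x y Kx Ky.
exact: hd.
Unshelve. all: by end_near. Qed.

Section domain.
Context {R : realType} {n : nat}.
Local Notation X := ('rV[R]_n).
Variable Omega : set X.
Hypothesis Omega_bounded : bounded_set Omega.

Lemma domain_norm_le : exists2 M : R, 0 < M & forall x, Omega x -> `|x| <= M.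
Proof.
have [M [Mreal hM]] := Omega_bounded.
exists (`|M| + 1) => [|x Ox]; first by rewrite ltr_wpDl.
by apply: hM => //; rewrite (le_lt_trans (ler_norm _))// ltrDl.
Qed.

Lemma compact_closure_domain : compact (closure Omega).
Proof.
apply: bounded_closed_compact; last exact: closed_closure.
have [M M0 hM] := domain_norm_le.
exists M; split; first exact: num_real.
move=> N MN x cx; apply: le_trans (ltW MN).
have : closure Omega `<=` [set x : X | `|x| <= M].
  rewrite closureE; apply: smallest_sub => //.
  exact: (preimage_closed (fun x _ => @norm_continuous _ _ x) (@closed_le _ M)).
exact.
Qed.

Lemma compact_cylinder (T : R) : compact (closure Omega `*` `[0, T]%classic).
Proof. apply: compact_setX; [exact: compact_closure_domain|exact: segment_compact]. Qed.

End domain.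

(** * Boundary layers *)

Section layer.
Context {R : realType} {n : nat}.
Local Notation X := ('rV[R]_n).
Local Notation leb := (@lebesgue_rV R n).
Variables (Omega : set X) (mu : X -> R).
Hypothesis n_gt0 : (0 < n)%N.
Hypothesis Omega_open : open Omega.
Hypothesis Omega_bounded : bounded_set Omega.
Hypothesis frontier0 : leb (frontier Omega) = 0%E.
Hypothesis mu_ge0 : forall z, 0 <= mu z.
Hypothesis mu_L1 : leb.-integrable setT (EFin \o mu).
Hypothesis mu_mass1 : \int[leb]_z mu z = 1.

Definition depth (y : X) : R := inf [set `|y - z| | z in ~` Omega].

Lemma depth_set_neq0 y : [set `|y - z| | z in ~` Omega] !=set0.
Proof.
have [M M0 hM] := domain_norm_le Omega_bounded.
pose c : X := const_mx (M + 1).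
exists `|y - c|; exists c => // /hM.
apply/negP; rewrite -ltNge.
apply: (@lt_le_trans _ _ `|c ord0 (Ordinal n_gt0)|).
  by rewrite mxE ger0_norm; lra.
rewrite [leRHS]/Num.Def.normr/= mx_normrE.
by rewrite (bigD1 (ord0, Ordinal n_gt0))//= le_max lexx.
Qed.

Lemma depth_ge0 y : 0 <= depth y.
Proof. by apply: lb_le_inf; [exact: depth_set_neq0|move=> _ [z _ <-]]. Qed.

Lemma depth_out y : ~ Omega y -> depth y = 0.
Proof.
move=> ny; apply/eqP; rewrite eq_le depth_ge0 andbT.
apply: ge_inf; first by exists 0 => _ [z _ <-].
by exists y => //; rewrite subrr normr0.
Qed.

Lemma depth_lip x y : depth x <= `|x - y| + depth y.
Proof.
rewrite -lerBlDl; apply: lb_le_inf; first exact: depth_set_neq0.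
move=> _ [z nz <-]; rewrite lerBlDl (le_trans _ (ler_distD y x z))//.
by apply: ge_inf; [exists 0 => _ [? _ <-]|exists z].
Qed.

Lemma depth_gt0 y : Omega y -> 0 < depth y.
Proof.
move=> Oy; have /nbhs_normP[e /= e0 he] := open_nbhs_nbhs (conj Omega_open Oy).
apply: (lt_le_trans e0); apply: lb_le_inf; first exact: depth_set_neq0.
by move=> _ [z nz <-]; rewrite leNgt; apply/negP => h; apply: nz; exact: he.
Qed.

Lemma depth_continuous : continuous depth.
Proof.
move=> x; apply/(@cvgrPdist_lt _ _ _ (nbhs x) (nbhs_filter x)) => e e0.
have nx : \forall y \near x, `|x - y| < e by apply/nbhs_normP; exists e.
near=> y; apply: (@le_lt_trans _ _ `|x - y|).
  rewrite ler_norml; have := depth_lip y x; have := depth_lip x y.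
  by rewrite (distrC y x) => h1 h2; apply/andP; split; lra.
by near: y.
Unshelve. all: by end_near. Qed.

(** A cutoff equal to 1 on the boundary and to 0 at depth more than [r].
    At [r = 0] the quotient is [0 / 0 = 0], the limit of [layer y r] as
    [r -> 0] for every point [y] of the domain. *)
Definition layer (y : X) (r : R) : R := Num.max 0 (r - depth y) / r.

Lemma layer_ge0 y r : 0 <= r -> 0 <= layer y r.
Proof. by move=> r0; rewrite divr_ge0// le_max lexx. Qed.

Lemma layer_le1 y r : 0 <= r -> layer y r <= 1.
Proof.
rewrite le_eqVlt => /predU1P[<-|r0]; first by rewrite /layer invr0 mulr0.
rewrite /layer ler_pdivrMr// mul1r ge_max (ltW r0) /=.
by rewrite gerBl depth_ge0.
Qed.

Lemma layer_frontier y r : 0 < r -> ~ Omega y -> layer y r = 1.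
Proof.
move=> r0 ny; rewrite /layer depth_out// subr0 max_r ?ltW//.
by rewrite divff// gt_eqF.
Qed.

Lemma layer_deep y r : r <= depth y -> layer y r = 0.
Proof. by move=> h; rewrite /layer max_l ?mul0r// subr_le0. Qed.

Lemma layer_continuous r : continuous (layer ^~ r).
Proof.
suff gen (T : topologicalType) (f : T -> R) : continuous f ->
  continuous (fun y => Num.max 0 (r - f y) / r) by exact: gen depth_continuous.
move=> cf y; apply: cvgM; last exact: cvg_cst.
apply: (@continuous_max _ _ (cst 0) (fun y => r - f y)).
  exact: cst_continuous.
exact: (cvgB (@cvg_cst _ _ _ _ _) (cf y)).
Qed.

Lemma layer_continuous2 :
  {within Omega `*` [set t | 0 <= t], continuous (fun p : X * R => layer p.1 p.2)}.
Proof.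
have dc (p : X * R) : depth q.1 @[q --> p] --> depth p.1.
  by apply: (@cvg_comp _ _ _ fst depth _ (nbhs p.1)); [exact: cvg_fst|exact: depth_continuous].
apply/subspace_continuousP => -[y r] [/= Oy].
rewrite le_eqVlt => /predU1P[<-|r0].
  suff : layer q.1 q.2 @[q --> within (Omega `*` [set t | 0 <= t])
    (nbhs (y, 0 : R))] --> layer y 0 by [].
  rewrite (_ : layer y 0 = 0); last by rewrite /layer invr0 mulr0.
  apply: (@cvg_trans _ ((0 : R) @[q --> within (Omega `*` [set t | 0 <= t]) (nbhs (y, 0 : R))])); last exact: cvg_cst.
  apply: near_eq_cvg; apply: cvg_within.
  have d0 := depth_gt0 Oy.
  have : \forall q \near (y, 0 : R), q.2 < depth q.1.
    have h2 : 0 < depth y / 2 by lra.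
    have n1 : \forall q \near (y, 0 : R), `|depth y - depth q.1| < depth y / 2.
      exact: (cvgr_dist_lt _ _ (dc (y, 0)) _ h2).
    have n2 : \forall q \near (y, 0 : R), `|0 - q.2| < depth y / 2.
      have c2 : q.2 @[q --> (y, 0 : R)] --> (0 : R) by exact: cvg_snd.
      by move/cvgrPdist_lt : c2 => /(_ _ h2).
    near=> q.
    have : `|depth y - depth q.1| < depth y / 2 by near: q.
    have : `|0 - q.2| < depth y / 2 by near: q.
    by rewrite !ltr_norml => /andP[? ?] /andP[? ?]; lra.
  by apply: filterS => q /ltW h; rewrite layer_deep.
apply: cvg_within_filter; rewrite /layer /=.
apply: cvgM; last by apply: cvgV; [rewrite /= gt_eqF|exact: cvg_snd].
apply: (@continuous_max _ _ (cst 0) (fun q : X * R => q.2 - depth q.1)).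
  exact: cst_continuous.
exact: (cvgB (@cvg_snd _ _ _ _ _) (dc (y, r))).
Unshelve. all: by end_near. Qed.

Lemma layer_bounded_measurable r : 0 <= r -> bounded_measurable Omega (layer ^~ r).
Proof.
move=> r0; split.
  exact: (slice_measurable Omega_open r0 layer_continuous2).
by exists 1 => y _; rewrite ger0_norm ?layer_ge0 ?layer_le1.
Qed.

(** The thickness [r] of the layer takes the part of time in [gain_continuous]: the gain
    is continuous in [(x, r)] up to [r = 0], where it vanishes, and the compactness of the
    closure of [Omega] makes this uniform in [x]. *)
Lemma gain_layer_small (e : R) : 0 < e ->
  exists2 r0, 0 < r0 & forall r x, 0 < r < r0 -> closure Omega x ->
    gain Omega mu (layer ^~ r) x <= e.
Proof.
move=> e0.
have cg := gain_continuous Omega_open frontier0 mu_ge0 mu_L1 layer_continuous2.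
pose K := closure Omega `*` `[0, 1]%classic : set (X * R).
have cgK : {within K, continuous (fun p : X * R => gain Omega mu (fun y => layer y p.2) p.1)}.
  apply: (@continuous_subspaceW _ _ _ [set p : X * R | 0 <= p.2]).
    by move=> [x r] [_ /=]; rewrite in_itv/= => /andP[].
  apply: cg => T; exists 1 => y t _ /andP[t0 _].
  by rewrite /= ger0_norm ?layer_ge0 ?layer_le1.
have [d d0 hd] := compact_uniformly_continuous
  (compact_cylinder Omega_bounded (T := 1)) cgK e0.
exists (Num.min d 1); first by rewrite lt_min d0 ltr01.
move=> r x /andP[r0]; rewrite lt_min => /andP[rd r1] cx.
have := hd (x, r) (x, 0).
rewrite /= (_ : gain _ _ (fun y => layer y 0) x = 0); last first.
  rewrite -[RHS](mul0r (gain Omega mu (fun=> 1) x)) -gainZ//.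
    by apply: eq_gain => y _; rewrite mul0r /layer invr0 mulr0.
  exact: bounded_measurable_cst.
rewrite subr0 => h; apply: ltW; apply: le_lt_trans (ler_norm _) _; apply: h.
- by split => //=; rewrite in_itv/= !ltW.
- by split => //=; rewrite in_itv/= lexx ler01.
- rewrite prod_normE /= subrr normr0 subr0 gt_max d0 /=.
  by rewrite gtr0_norm.
Qed.

End layer.

(** * Exponential generating functions of bounded sequences *)

Section egf.
Context {R : realType}.
Implicit Types (b : nat -> R) (M t T : R).

Definition egf b t : R := limn (pseries (fun k => b k / k`!%:R) t).

Definition egf_trunc b (N : nat) t : R := pseries (fun k => b k / k`!%:R) t N.

Lemma egf_truncE b N t :
  egf_trunc b N t = \sum_(0 <= k < N) (t ^+ k / k`!%:R * b k).
Proof.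
rewrite /egf_trunc /pseries /series /=; apply: eq_bigr => k _.
by rewrite mulrAC [RHS]mulrC mulrA.
Qed.

Lemma egf_term_le b M t T k : (forall k, `|b k| <= M) -> `|t| <= T ->
  `|b k / k`!%:R * t ^+ k| <= M * exp_coeff T k.
Proof.
move=> bM tT; rewrite !normrM /exp_coeff /= -mulrA; apply: ler_pM => //.
rewrite mulrC normfV normr_nat ler_wpM2r// normrX lerXn2r// nnegrE//.
exact: le_trans tT.
Qed.

Lemma is_cvg_egf b M t : (forall k, `|b k| <= M) ->
  cvgn (pseries (fun k => b k / k`!%:R) t).
Proof.
move=> bM; apply: normed_cvg.
apply: (@series_le_cvg _ _ (fun k => M * exp_coeff `|t| k)) => //.
- by move=> k /=.
- move=> k /=; rewrite mulr_ge0//; first exact: le_trans (bM 0%N).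
  by rewrite /exp_coeff /= divr_ge0 ?exprn_ge0.
- by move=> k; exact: egf_term_le.
- exact: (is_cvg_seriesZ (k := M) (is_cvg_series_exp_coeff `|t|)).
Qed.

(** The bound depends on the sequence through [M] only: it makes the partial sums of
    the solution converge uniformly in space. *)
Lemma egf_tail b M t T N : (forall k, `|b k| <= M) -> `|t| <= T ->
  `|egf b t - egf_trunc b N t| <= M * (expR T - series (exp_coeff T) N).
Proof.
move=> bM tT; have T0 : 0 <= T by exact: le_trans tT.
have M0 : 0 <= M by exact: le_trans (bM 0%N).
have c0 : `|egf_trunc b m t - egf_trunc b N t| @[m --> \oo] -->
    `|egf b t - egf_trunc b N t|.
  apply: cvg_norm; apply: cvgB; last exact: cvg_cst.
  exact: (is_cvg_egf (M := M)).
rewrite -(cvg_lim _ c0)//; apply: limr_le; first by apply/cvg_ex; exists (`|egf b t - egf_trunc b N t|).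
near=> m; have Nm : (N <= m)%N by near: m; exists N.
rewrite /egf_trunc /pseries sub_series_geq//.
apply: (@le_trans _ _ (\sum_(N <= k < m) (M * exp_coeff T k))).
  by rewrite (le_trans (ler_norm_sum _ _ _))// ler_sum// => k _; exact: egf_term_le.
rewrite -mulr_sumr ler_wpM2l// -sub_series_geq// lerD2r.
apply: nondecreasing_cvgn_le; last exact: is_cvg_series_exp_coeff.
apply/nondecreasing_series => k _ _.
by rewrite /exp_coeff /= divr_ge0 ?exprn_ge0.
Unshelve. all: by end_near. Qed.

Lemma expR_tail_cvg T M : M * (expR T - series (exp_coeff T) N) @[N --> \oo] --> 0.
Proof.
rewrite -[X in _ --> X](mulr0 M); apply: cvgM; first exact: cvg_cst.
rewrite -(subrr (expR T)); apply: cvgB; first exact: cvg_cst.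
exact: is_cvg_series_exp_coeff.
Qed.

Lemma egf_le b M t : (forall k, `|b k| <= M) -> `|egf b t| <= M * expR `|t|.
Proof.
move=> bM; have := egf_tail 0 bM (lexx `|t|).
by rewrite /egf_trunc /pseries /series /= !big_geq// !subr0.
Qed.

Lemma egf0 b : egf b 0 = b 0%N.
Proof.
rewrite /egf; apply: cvg_lim => //; rewrite -cvg_shiftS /=.
rewrite (_ : (fun n => _) = cst (b 0%N)); first exact: cvg_cst.
apply/funext => N; rewrite /pseries /series /= big_nat_recl//= big1 ?addr0.
  by rewrite expr0 fact0 invr1 !mulr1.
by move=> i _; rewrite exprS mul0r mulr0.
Qed.

Lemma is_derive_egf b M t : (forall k, `|b k| <= M) ->
  is_derive t (1 : R) (egf b) (egf (b \o succn) t).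
Proof.
move=> bM.
have dE (c : nat -> R) : pseries_diffs (fun k => c k / k`!%:R) =
    (fun k => (c \o succn) k / k`!%:R).
  apply/funext => k; rewrite /pseries_diffs /= factS natrM.
  by rewrite invfM mulrCA mulVKf// pnatr_eq0.
have bM1 k : `|(b \o succn) k| <= M by exact: bM.
rewrite /egf -[X in limn (pseries X t)]dE.
apply: (@pseries_snd_diffs _ _ (`|t| + 1)).
- exact: (is_cvg_egf (M := M) bM).
- by rewrite dE; exact: (is_cvg_egf (M := M) bM1).
- rewrite !dE; apply: (is_cvg_egf (M := M)) => k; exact: bM.
- by rewrite [ltRHS]ger0_norm// ltrDl.
Qed.

End egf.

Section gain_slices.
Context {R : realType} {n : nat}.
Local Notation X := ('rV[R]_n).
Local Notation leb := (@lebesgue_rV R n).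
Variables (Omega : set X) (mu : X -> R).
Hypothesis Omega_open : open Omega.
Hypothesis frontier0 : leb (frontier Omega) = 0%E.
Hypothesis mu_ge0 : forall z, 0 <= mu z.
Hypothesis mu_L1 : leb.-integrable setT (EFin \o mu).

Lemma within_fst (D : set X) (E : set R) (f : X -> R) : {within D, continuous f} ->
  {within D `*` E, continuous (fun p : X * R => f p.1)}.
Proof.
move=> /subspace_continuousP cf; apply/subspace_continuousP => -[x t] [/= Dx Et].
move=> U nU; have nD := cf x Dx U nU.
have : \forall q \near (x, t), D q.1 -> U (f q.1).
  by apply: (@cvg_fst _ _ (nbhs x) (nbhs t) _ [set y | D y -> U (f y)]).
by apply: filterS => q h [/= /h].
Qed.

Lemma gain_continuous1 (f : X -> R) : {within Omega, continuous f} ->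
  (exists C, forall y, Omega y -> `|f y| <= C) -> continuous (gain Omega mu f).
Proof.
move=> cf [C hC] x.
have : {within [set p : X * R | 0 <= p.2],
    continuous (fun p => gain Omega mu (fun y => f (y, p.2).1) p.1)}.
  apply: (gain_continuous Omega_open frontier0 mu_ge0 mu_L1 (w := fun p => f p.1)).
    exact: within_fst.
  by move=> T; exists C => y t Oy _; exact: hC.
move=> /subspace_continuousP/(_ (x, 0) (lexx _)) h U nU.
have := h U nU; rewrite /= /within /=.
have c : (y, 0 : R) @[y --> x] --> (x, 0 : R).
  exact: (@cvg_pair _ _ _ (nbhs x) (nbhs x) (nbhs (0 : R)) _ _ _ id (cst 0) cvg_id
    (@cvg_cst _ _ _ _ _)).
by move=> /c h'; apply: (@filterS _ (nbhs x) (nbhs_filter x) _ _ _ h') => y /=; apply; exact: lexx.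
Qed.

End gain_slices.

(** * The solution of the limit problem *)

Section limit_solution.
Context {R : realType} {n : nat}.
Local Notation X := ('rV[R]_n).
Local Notation leb := (@lebesgue_rV R n).
Variables (Omega : set X) (mu : X -> R) (u0 : X -> R) (M : R).
Hypothesis Omega_open : open Omega.
Hypothesis frontier0 : leb (frontier Omega) = 0%E.
Hypothesis mu_ge0 : forall z, 0 <= mu z.
Hypothesis mu_L1 : leb.-integrable setT (EFin \o mu).
Hypothesis mu_mass1 : \int[leb]_z mu z = 1.
Hypothesis u0_continuous : {within closure Omega, continuous u0}.
Hypothesis M_ge0 : 0 <= M.
Hypothesis u0_le : forall x, closure Omega x -> `|u0 x| <= M.

Definition gain_iter k : X -> R := iter k (gain Omega mu) u0.

Lemma gain_iter_closure k : {within closure Omega, continuous (gain_iter k)} /\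
  forall x, closure Omega x -> `|gain_iter k x| <= M.
Proof.
elim: k => [|k [ck bk]]; first by split.
have ck' : {within Omega, continuous (gain_iter k)}.
  by apply: continuous_subspaceW ck; exact: subset_closure.
have bk' y : Omega y -> `|gain_iter k y| <= M.
  by move=> Oy; apply: bk; exact: subset_closure.
split.
  apply: continuous_subspaceT.
  by apply: gain_continuous1 => //; exists M.
move=> x _; apply: norm_gain_le => //; split; last by exists M.
exact: rV_continuous_measurable ck'.
Qed.

Lemma gain_iter_continuous k : {within closure Omega, continuous (gain_iter k)}.
Proof. by have [] := gain_iter_closure k. Qed.

Lemma gain_iter_le k x : closure Omega x -> `|gain_iter k x| <= M.
Proof. by have [_] := gain_iter_closure k; apply. Qed.

Lemma gain_iter_bounded k : bounded_measurable Omega (gain_iter k).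
Proof.
split.
  apply: rV_continuous_measurable (@gain_iter_continuous k) => //.
  exact: subset_closure.
by exists M => y Oy; apply: gain_iter_le; exact: subset_closure.
Qed.

Lemma gain_iterS_le k x : `|gain_iter k.+1 x| <= M.
Proof.
apply: norm_gain_le => //; first exact: gain_iter_bounded.
by move=> y Oy; apply: gain_iter_le; exact: subset_closure.
Qed.

(** [exp (t A) u0], where [A] is the gain operator. *)
Definition gain_flow (p : X * R) : R := egf (gain_iter ^~ p.1) p.2.

Lemma gain_flow_trunc_continuous N : {within closed_cyl Omega,
  continuous (fun p : X * R => egf_trunc (gain_iter ^~ p.1) N p.2)}.
Proof.
rewrite (_ : (fun p => _) = fun p : X * R =>
    \sum_(0 <= k < N) (p.2 ^+ k / k`!%:R * gain_iter k p.1)); last first.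
  by apply/funext => p; rewrite egf_truncE.
elim: N => [|N IH].
  rewrite (_ : (fun p => _) = cst 0); first by move=> p; exact: cvg_cst.
  by apply/funext => p; rewrite big_geq.
rewrite (_ : (fun p => _) = (fun p : X * R =>
    \sum_(0 <= k < N) (p.2 ^+ k / k`!%:R * gain_iter k p.1)) \+
    (fun p : X * R => p.2 ^+ N / N`!%:R * gain_iter N p.1)); last first.
  by apply/funext => p; rewrite big_nat_recr.
move=> p; apply: continuousD; first exact: IH.
apply: continuousM; last first.
  have cN : {within closed_cyl Omega, continuous (fun p : X * R => gain_iter N p.1)}.
    by apply: within_fst; exact: gain_iter_continuous.
  exact: cN.
apply: (@continuous_subspaceT _ _ _ (fun p : X * R => p.2 ^+ N / N`!%:R)).
move=> q; apply: cvgM; last exact: cvg_cst.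
apply: (@cvg_comp _ _ _ snd (fun t => t ^+ N) _ (nbhs q.2)); first exact: cvg_snd.
exact: exprn_continuous.
Qed.

(** A limit of continuous partial sums, uniform on bounded time intervals. *)
Lemma gain_flow_continuous : {within closed_cyl Omega, continuous gain_flow}.
Proof.
apply/subspace_continuousP => -[x t] [/= cx t0].
have {}t0 : 0 <= t by exact: t0.
apply/cvgrPdist_lt => e e0.
have e30 : 0 < e / 3 by lra.
have [N _ /(_ N (leqnn N)) hN] : \forall N \near \oo,
    `|0 - M * (expR (t + 1) - series (exp_coeff (t + 1)) N)| < e / 3.
  by move/cvgrPdist_lt : (expR_tail_cvg (t + 1) M) => /(_ _ e30).
rewrite sub0r normrN in hN.
have := @gain_flow_trunc_continuous N.
move=> /subspace_continuousP/(_ (x, t) (conj cx t0)) /cvgrPdist_lt/(_ _ e30) hc.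
have ht : \forall q \near within (closed_cyl Omega) (nbhs (x, t)), `|q.2| <= t + 1.
  apply: cvg_within.
  have c2 : q.2 @[q --> (x, t)] --> t by exact: cvg_snd.
  move/cvgrPdist_lt : c2 => /(_ 1 ltr01); apply: filterS => q /=.
  by rewrite !ltr_norml ler_norml => /andP[? ?]; apply/andP; split; lra.
have hD : \forall q \near within (closed_cyl Omega) (nbhs (x, t)), closed_cyl Omega q.
  by apply: withinT.
near=> q.
have Dq : closed_cyl Omega q by near: q.
have hq : `|q.2| <= t + 1 by near: q.
have tail r : closed_cyl Omega r -> `|r.2| <= t + 1 ->
    `|gain_flow r - egf_trunc (gain_iter ^~ r.1) N r.2| < e / 3.
  move=> [cr _] hr; apply: le_lt_trans hN; apply: le_trans (ler_norm _).
  by apply: egf_tail => // k; exact: gain_iter_le.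
have h1 := tail (x, t) (conj cx t0); have h2 := tail q Dq hq.
have h3 : `|egf_trunc (gain_iter ^~ x) N t - egf_trunc (gain_iter ^~ q.1) N q.2| < e / 3.
  by near: q.
have {}h1 : `|gain_flow (x, t) - egf_trunc (gain_iter ^~ x) N t| < e / 3.
  by apply: h1; rewrite /= ger0_norm // lerDl.
suff : `|gain_flow (x, t) - gain_flow q| < e by [].
rewrite (le_lt_trans (ler_distD (egf_trunc (gain_iter ^~ x) N t) _ _))//.
have := ler_distD (egf_trunc (gain_iter ^~ q.1) N q.2)
  (egf_trunc (gain_iter ^~ x) N t) (gain_flow q).
rewrite distrC in h2; lra.
Unshelve. all: by end_near. Qed.

Lemma gain_flow_le x t : closure Omega x -> 0 <= t ->
  `|gain_flow (x, t)| <= M * expR t.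
Proof.
move=> cx t0; have := @egf_le _ (gain_iter ^~ x) M t (fun k => gain_iter_le k cx).
by rewrite (ger0_norm t0).
Qed.

Lemma gain_flow_bounded t : 0 <= t ->
  bounded_measurable Omega (fun y => gain_flow (y, t)).
Proof.
move=> t0; split.
  apply: (slice_measurable Omega_open t0).
  apply: continuous_subspaceW gain_flow_continuous => -[x s] [/= Ox s0].
  by split => //; exact: subset_closure.
by exists (M * expR t) => y Oy; apply: gain_flow_le => //; exact: subset_closure.
Qed.

Lemma gain_egf_trunc x t N :
  bounded_measurable Omega (fun y => egf_trunc (gain_iter ^~ y) N t) /\
  gain Omega mu (fun y => egf_trunc (gain_iter ^~ y) N t) x =
  egf_trunc (fun k => gain_iter k.+1 x) N t.
Proof.
rewrite egf_truncE.
rewrite (_ : (fun y => _) = fun y =>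
    \sum_(0 <= k < N) (t ^+ k / k`!%:R * gain_iter k y)); last first.
  by apply/funext => y; rewrite egf_truncE.
elim: N => [|N [bN gN]].
  rewrite (_ : (fun y => _) = fun=> 0); last by apply/funext => y; rewrite big_geq.
  split; first exact: bounded_measurable_cst.
  rewrite big_geq// -[RHS](mul0r (gain Omega mu (fun=> 1) x)) -gainZ//.
    by apply: eq_gain => y _; rewrite mul0r.
  exact: bounded_measurable_cst.
rewrite (_ : (fun y => _) = fun y => (\sum_(0 <= k < N) (t ^+ k / k`!%:R * gain_iter k y)) +
    t ^+ N / N`!%:R * gain_iter N y); last first.
  by apply/funext => y; rewrite big_nat_recr.
have bN' := bounded_measurableZ (t ^+ N / N`!%:R) (gain_iter_bounded N).
split; first exact: bounded_measurableD.
rewrite gainD// gN big_nat_recr//= gainZ//; exact: gain_iter_bounded.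
Qed.

(** On partial sums this is linearity; these converge uniformly in space, and [gain] is
    bounded by 1 in the sup norm. *)
Lemma gain_gain_flow x t : 0 <= t ->
  gain Omega mu (fun y => gain_flow (y, t)) x = egf (fun k => gain_iter k.+1 x) t.
Proof.
move=> t0; have c1 : egf_trunc (fun k => gain_iter k.+1 x) N t @[N --> \oo] -->
    egf (fun k => gain_iter k.+1 x) t.
  by apply: (is_cvg_egf (M := M)) => k; exact: gain_iterS_le.
apply: (@cvg_unique _ (@Rhausdorff R) _ _ _ _ _ c1).
apply/cvgrPdist_lt => e e0.
move/cvgrPdist_lt : (expR_tail_cvg t M) => /(_ _ e0); apply: filterS => N.
rewrite sub0r normrN; apply: le_lt_trans.
have [bN <-] := gain_egf_trunc x t N.
have bt := gain_flow_bounded t0.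
rewrite -gainB//; apply: norm_gain_le => //.
  apply: bounded_measurableD => //.
  rewrite (_ : (fun y => _) = fun y => -1 * egf_trunc (gain_iter ^~ y) N t).
    exact: bounded_measurableZ.
  by apply/funext => y; rewrite mulN1r.
move=> y Oy; apply: le_trans (ler_norm _).
apply: egf_tail => [k|]; last by rewrite ger0_norm.
by apply: gain_iter_le; exact: subset_closure.
Qed.

(** [exp (t (A - 1)) u0]. *)
Definition jump_flow (p : X * R) : R := expR (- p.2) * gain_flow p.

Lemma jump_flow_continuous : {within closed_cyl Omega, continuous jump_flow}.
Proof.
rewrite (_ : jump_flow = (fun p : X * R => expR (- p.2)) \* gain_flow)//.
move=> p; apply: continuousM; last exact: gain_flow_continuous.
apply: (@continuous_subspaceT _ _ _ (fun p : X * R => expR (- p.2))) => q.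
apply: (@cvg_comp _ _ _ snd (fun t => expR (- t)) _ (nbhs q.2)); first exact: cvg_snd.
by apply: continuous_comp; [exact: opp_continuous|exact: continuous_expR].
Qed.

Lemma jump_flow0 x : jump_flow (x, 0) = u0 x.
Proof. by rewrite /jump_flow /gain_flow /= oppr0 expR0 mul1r egf0. Qed.

Lemma jump_flow_le x t : closure Omega x -> 0 <= t -> `|jump_flow (x, t)| <= M.
Proof.
move=> cx t0; rewrite normrM ger0_norm ?expR_ge0//= expRN ler_pdivrMl ?expR_gt0//.
by rewrite mulrC; exact: gain_flow_le.
Qed.

Lemma jump_flow_is_derive x (t : R) : closure Omega x -> 0 <= t ->
  is_derive t (1 : R) (fun s => jump_flow (x, s)) (K0 Omega mu jump_flow (x, t)).
Proof.
move=> cx t0; rewrite K0E /=.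
have -> : gain Omega mu (fun y => jump_flow (y, t)) x =
    expR (- t) * egf (fun k => gain_iter k.+1 x) t.
  rewrite -gain_gain_flow// -gainZ//; exact: gain_flow_bounded.
have h := @is_derive_egf _ (gain_iter ^~ x) M t (fun k => gain_iter_le k cx).
rewrite /jump_flow /gain_flow /=.
apply: is_derive_eq.
rewrite /GRing.scale /=; lra.
Qed.

End limit_solution.

(** * Comparison with the viscous problem *)

Lemma is_derive_line (R : realType) (V : normedModType R) (u : V -> R)
    (p e : V) (h d : R) :
  is_derive (h *: e + p) e u d ->
  is_derive h (1 : R) (fun k : R => u (k *: e + p)) d.
Proof.
move=> [du <-]; rewrite /derivable /derive in du *.
have E : (fun k : R => k^-1 *: (((fun k : R => u (k *: e + p)) \o shift h) (k *: (1 : R)) -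
      u (h *: e + p))) =
    (fun k : R => k^-1 *: ((u \o shift (h *: e + p)) (k *: e) - u (h *: e + p))).
  apply/funext => k /=; congr (_ *: (u _ - _)).
  by rewrite [k *: 1]mulr1 scalerDl addrA.
by split; rewrite /derivable /derive E.
Qed.

Lemma is_derive_time_line (R : realType) n (u : 'rV[R]_n * R -> R) x (t d : R) :
  is_derive (x, t) (e_t n) u d -> is_derive t (1 : R) (fun r => u (x, r)) d.
Proof.
move=> h; have := @is_derive_line R _ u (x, 0) (e_t n) t d.
rewrite (_ : t *: e_t n + (x, 0) = (x, t)); last first.
  by rewrite /e_t; congr pair; rewrite /= ?scaler0 ?add0r ?addr0 ?[_ *: _]mulr1.
rewrite (_ : (fun k => _) = (fun k => u (x, k))); last first.
  apply/funext => k; congr u; congr pair => /=.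
    by rewrite scaler0 add0r.
  by rewrite addr0 [_ *: _]mulr1.
exact.
Qed.

(** Without the parabola, [g] has a maximum at [0], hence a critical point there; if the
    second derivative were positive, the mean value theorem would make it increase just
    after [0]. *)
Lemma second_derivative_at_max (R : realType) (g g1 : R -> R) (g2 c kap r : R) :
  0 < r -> (forall h, `|h| < r -> is_derive h (1 : R) g (g1 h)) ->
  is_derive (0 : R) (1 : R) g1 g2 ->
  (forall h, `|h| < r -> g h <= g 0 + c * h + kap / 2 * h ^+ 2) -> g2 <= kap.
Proof.
move=> r0 dg dg1 gmax.
pose f h := g h - (c * h + kap / 2 * h ^+ 2).
pose f1 h := g1 h - (c + kap * h).
have df h : `|h| < r -> is_derive h (1 : R) f (f1 h).
  move=> hr; have dgh := dg h hr; apply: is_derive_eq.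
  by rewrite /f1 /GRing.scale /=; lra.
have df1 : is_derive (0 : R) (1 : R) f1 (g2 - kap).
  by apply: is_derive_eq; rewrite /GRing.scale /=; lra.
have fmax h : `|h| < r -> f h <= f 0.
  by move=> /gmax; rewrite /f expr0n /=; lra.
have f10 : f1 0 = 0.
  have r_itv h : (h \in `]-r, r[%R) = (`|h| < r) by rewrite in_itv/= ltr_norml.
  have h0 : is_derive (0 : R) 1 f 0.
    apply: (@derive1_at_max _ f (- r) r); first lra.
    - by move=> t; rewrite r_itv => /df [].
    - by rewrite r_itv normr0.
    - by move=> t; rewrite r_itv => /fmax.
  have hf : is_derive (0 : R) (1 : R) f (f1 0) by apply: df; rewrite normr0.
  by rewrite -(@derive_val _ _ _ _ _ _ _ hf) (@derive_val _ _ _ _ _ _ _ h0).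
rewrite leNgt; apply/negP => gk.
have [d1 E1] := df1.
have := d1; rewrite /derivable => c1.
have {}c1 : (fun h : R => h^-1 *: ((f1 \o shift 0) (h *: 1) - f1 0)) @ 0^' --> g2 - kap.
  by rewrite -E1; exact: c1.
have gk0 : 0 < g2 - kap by lra.
have [d /= d0 hd] : \forall h \near 0^', 0 < h^-1 *: ((f1 \o shift 0) (h *: 1) - f1 0).
  by apply: (c1 [set x | 0 < x]); apply: open_nbhs_nbhs; split; [exact: open_gt|].
pose h1 := Num.min d r / 2.
have m0 : 0 < Num.min d r by rewrite lt_min d0.
have h10 : 0 < h1 by rewrite /h1; lra.
have h1d : h1 < d by have : Num.min d r <= d by [rewrite ge_min lexx]; rewrite /h1; lra.
have h1r : h1 < r by have : Num.min d r <= r by [rewrite ge_min lexx orbT]; rewrite /h1; lra.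
have dfi x : x \in `]0, h1[%R -> is_derive x 1 f (f1 x).
  by rewrite in_itv/= => /andP[x0 x1]; apply: df; rewrite gtr0_norm//; lra.
have [|x] := @MVT R f f1 0 h1 h10 dfi.
  apply: derivable_within_continuous => x; rewrite in_itv/= => /andP[x0 x1].
  have xr : `|x| < r by rewrite ger0_norm//; lra.
  by have [] := df x xr.
rewrite in_itv/= => /andP[x0 x1]; rewrite subr0 => E.
have f1x : 0 < f1 x.
  have := hd x; rewrite /ball_ /= sub0r normrN gtr0_norm// => /(_ _ _).
  rewrite f10 subr0 addr0 [x *: 1]mulr1 => h.
  have : 0 < x^-1 *: f1 x by apply: h; [lra|rewrite gt_eqF].
  by rewrite /GRing.scale /= pmulr_rgt0// invr_gt0.
have : f h1 <= f 0 by apply: fmax; rewrite gtr0_norm.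
have : 0 < f1 x * h1 by rewrite mulr_gt0.
lra.
Qed.

Lemma derive_left_max (R : realType) (g : R -> R) (t d : R) :
  is_derive t (1 : R) g d -> 0 < t ->
  (forall s, 0 <= s <= t -> g s <= g t) -> 0 <= d.
Proof.
move=> [dg E] t0 gmax; rewrite leNgt; apply/negP => d0.
have c1 : (fun h : R => h^-1 *: ((g \o shift t) (h *: 1) - g t)) @ 0^' --> d.
  by rewrite -E; exact: dg.
have [e /= e0 he] : \forall h \near 0^', h^-1 *: ((g \o shift t) (h *: 1) - g t) < 0.
  by apply: (c1 [set x | x < 0]); apply: open_nbhs_nbhs; split; [exact: open_lt|].
pose h := - (Num.min e t / 2).
have m0 : 0 < Num.min e t by rewrite lt_min e0.
have h0 : h < 0 by rewrite /h; lra.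
have he' : - h < e by have : Num.min e t <= e by [rewrite ge_min lexx]; rewrite /h; lra.
have ht : - h < t by have : Num.min e t <= t by [rewrite ge_min lexx orbT]; rewrite /h; lra.
have := he h; rewrite /ball_ /= sub0r normrN ltr0_norm// => /(_ he').
rewrite lt_eqF// => /(_ isT); rewrite [h *: 1]mulr1 ltNge => /negP; apply.
rewrite /GRing.scale /= -mulrNN mulr_ge0//.
  by rewrite oppr_ge0 invr_le0 ltW.
by rewrite oppr_ge0 subr_le0; apply: gmax; apply/andP; split; lra.
Qed.

Section comparison.
Context {R : realType} {n : nat}.
Local Notation X := ('rV[R]_n).
Local Notation leb := (@lebesgue_rV R n).
Variables (Omega : set X) (mu : X -> R).
Hypothesis Omega_open : open Omega.
Hypothesis Omega_bounded : bounded_set Omega.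
Hypothesis frontier0 : leb (frontier Omega) = 0%E.
Hypothesis mu_ge0 : forall z, 0 <= mu z.
Hypothesis mu_L1 : leb.-integrable setT (EFin \o mu).

Definition dist2 (x y : X) : R := \sum_i (x ord0 i - y ord0 i) ^+ 2.

Lemma cylinder_bounded (w : X * R -> R) (T : R) :
  {within closed_cyl Omega, continuous w} ->
  exists2 C, 0 <= C &
    forall y t, closure Omega y -> 0 <= t <= T -> `|w (y, t)| <= C.
Proof.
move=> cw; pose K := closure Omega `*` `[0, T]%classic : set (X * R).
have cK : {within K, continuous w}.
  apply: continuous_subspaceW cw => -[y t] [cy /=].
  by rewrite in_itv/= => /andP[t0 _].
have /compact_bounded[C [Creal hC]] :=
  continuous_compact cK (compact_cylinder Omega_bounded (T := T)).
exists (`|C| + 1); first by rewrite addr_ge0.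
move=> y t cy tT; apply: hC; first by rewrite (le_lt_trans (ler_norm _))// ltrDl.
by exists (y, t) => //; split => //=; rewrite in_itv.
Qed.

Lemma closed_cyl_slice_bounded (w : X * R -> R) t : 0 <= t ->
  {within closed_cyl Omega, continuous w} ->
  bounded_measurable Omega (fun y => w (y, t)).
Proof.
move=> t0 cw; split.
  apply: (slice_measurable Omega_open t0).
  apply: continuous_subspaceW cw => -[x s] [/= Ox s0].
  by split => //; exact: subset_closure.
have [C _ hC] := cylinder_bounded t cw.
by exists C => y Oy; apply: hC; [exact: subset_closure|rewrite t0 lexx].
Qed.

Lemma gain_closed_cyl_continuous (w : X * R -> R) :
  {within closed_cyl Omega, continuous w} ->
  {within closed_cyl Omega,
    continuous (fun p => gain Omega mu (fun y => w (y, p.2)) p.1)}.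
Proof.
move=> cw.
have : {within [set p : X * R | 0 <= p.2],
    continuous (fun p => gain Omega mu (fun y => w (y, p.2)) p.1)}.
  apply: gain_continuous => //.
    apply: continuous_subspaceW cw => -[x s] [/= Ox s0].
    by split => //; exact: subset_closure.
  move=> T; have [C _ hC] := cylinder_bounded T cw.
  by exists C => y t Oy; apply: hC; exact: subset_closure.
by apply: continuous_subspaceW => -[x s] [].
Qed.

(** At [t = 0] the boundary condition is the limit of those at positive times. *)
Lemma viscous_frontier0 (eps : R) (u0 : X -> R) (u : X * R -> R) x t :
  viscous_solution Omega mu eps u0 u ->
  frontier Omega x -> 0 <= t -> u (x, t) = 0.
Proof.
move=> [[cu _ _ _ _] _ u_bd _] fx; rewrite le_eqVlt => /predU1P[<-|]; last exact: u_bd.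
apply/eqP; rewrite -normr_eq0; apply/eqP; apply/eqP.
rewrite eq_le normr_ge0 andbT leNgt; apply/negP => e0.
have cx : closed_cyl Omega (x, 0) by case: fx => cx _; split => //=.
move/subspace_continuousP : cu => /(_ _ cx) /cvgrPdist_lt /(_ _ e0).
move=> /nbhs_normP[d /= d0 hd].
have : `|u (x, 0) - u (x, d / 2)| < `|u (x, 0)|.
  apply: (hd (x, d / 2)).
    by rewrite /= prod_normE /= subrr normr0 gt_max d0 /= sub0r normrN gtr0_norm; lra.
  by case: fx => cx' _; split => //=; rewrite divr_ge0// ltW.
by rewrite (u_bd x (d / 2) fx) ?divr_gt0// subr0 ltxx.
Qed.

(** The maximum principle at an interior point: a function with a paraboloid of opening
    [kap] as spatial part touches [s * u] from above at [(x, t)], so that each second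
    derivative of [s * u] is at most [kap] there. The left derivative in time suffices,
    and [t] may be the final time. *)
Lemma viscous_touching (eps : R) (u0 : X -> R) (u : X * R -> R)
    (s kap : R) (x y : X) (t : R) (v : R -> R) (dv : R) :
  0 < eps -> viscous_solution Omega mu eps u0 u ->
  Omega x -> 0 < t ->
  (forall x', Omega x' -> s * u (x', t) - kap / 2 * dist2 x' y <=
     s * u (x, t) - kap / 2 * dist2 x y) ->
  (forall t', 0 <= t' <= t -> s * u (x, t') - v t' <= s * u (x, t) - v t) ->
  is_derive t (1 : R) v dv ->
  dv <= eps * (n%:R * kap) + gain Omega mu (fun z => s * u (z, t)) x - s * u (x, t).
Proof.
move=> eps0 [[cu du_t _ du_x _] u_eq _ _] Ox t0 xmax tmax dvt.
have Op : cyl Omega (x, t) by split.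
have ut : dv <= s * 'D_(e_t n) u (x, t).
  have h1 : is_derive t (1 : R) (fun k : R => u (x, k)) ('D_(e_t n) u (x, t)).
    by apply: is_derive_time_line; split => //; exact: du_t.
  have h2 : is_derive t (1 : R) (fun k : R => s * u (x, k) - v k)
      (s * 'D_(e_t n) u (x, t) - dv).
    by apply: is_derive_eq; rewrite /GRing.scale /=; lra.
  by rewrite -subr_ge0; apply: (derive_left_max h2 t0).
have lap : s * laplacian u (x, t) <= n%:R * kap.
  rewrite /laplacian mulr_sumr.
  rewrite (_ : n%:R * kap = \sum_(i < n) kap); last first.
    by rewrite sumr_const card_ord mulr_natl.
  apply: ler_sum => i _.
  have /nbhs_normP[r /= r0 hr] := open_nbhs_nbhs (conj Omega_open Ox).
  have lineE (k : R) : k *: e_x i + (x, t) = (x + k *: delta_mx ord0 i, t).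
    by rewrite /e_x; congr pair; rewrite /= ?scaler0 ?add0r// addrC.
  have Or (k : R) : `|k| < r -> Omega (x + k *: delta_mx ord0 i).
    move=> kr; apply: hr => /=; rewrite opprD addNKr normrN.
    rewrite [ltLHS]/Num.Def.normr/= mx_normrE.
    apply/bigmax_ltP; split => // -[a b] _ /=.
    rewrite !mxE normrM; case: (_ && _); rewrite ?normr1 ?normr0 ?mulr1 ?mulr0//.
  have cyl_line (k : R) : `|k| < r -> cyl Omega (k *: e_x i + (x, t)).
    by move=> /Or h; rewrite lineE; split.
  apply: (@second_derivative_at_max R (fun k : R => s * u (k *: e_x i + (x, t)))
    (fun k : R => s * 'D_(e_x i) u (k *: e_x i + (x, t)))
    _ (kap * (x ord0 i - y ord0 i)) kap r r0).
  - move=> k /cyl_line Ck.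
    have h1 : is_derive k (1 : R) (fun k : R => u (k *: e_x i + (x, t)))
        ('D_(e_x i) u (k *: e_x i + (x, t))).
      by apply: is_derive_line; split => //; have [] := du_x i i _ Ck.
    by apply: is_derive_eq; rewrite /GRing.scale /=; lra.
  - have h1 : is_derive (0 : R) (1 : R)
        (fun k : R => 'D_(e_x i) u (k *: e_x i + (x, t)))
        ('D_(e_x i) ('D_(e_x i) u) (x, t)).
      apply: (@is_derive_line _ _ ('D_(e_x i) u)); rewrite scale0r add0r.
      by split => //; have [] := du_x i i _ Op.
    by apply: is_derive_eq; rewrite /GRing.scale /=; lra.
  - move=> k /Or /xmax; rewrite scale0r add0r lineE.
    have -> : dist2 (x + k *: delta_mx ord0 i) y =
        dist2 x y + (2 * k * (x ord0 i - y ord0 i) + k ^+ 2).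
      rewrite /dist2 (bigD1 i)//= [in RHS](bigD1 i)//= !mxE !eqxx /= mulr1.
      rewrite (eq_bigr (fun j => (x ord0 j - y ord0 j) ^+ 2)); last first.
        by move=> j ji; rewrite !mxE (negbTE ji) andbF mulr0 addr0.
      ring.
    by move=> h; nra.
have := u_eq _ Op; rewrite K0E /= => ueq.
have bu := closed_cyl_slice_bounded (ltW t0) cu.
rewrite gainZ//.
have : eps * (s * laplacian u (x, t)) <= eps * (n%:R * kap).
  by rewrite ler_pM2l.
move: ut; rewrite (_ : 'D_(e_t n) u (x, t) = eps * laplacian u (x, t) +
  (gain Omega mu (fun y => u (y, t)) x - u (x, t))); last by lra.
by move=> h1 h2; lra.
Qed.

End comparison.

Lemma within_continuous_comp (T U S : topologicalType) (g : T -> U) (f : U -> S)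
    (D : set U) (E : set T) :
  continuous g -> E `<=` g @^-1` D -> {within D, continuous f} ->
  {within E, continuous (f \o g)}.
Proof.
move=> cg ED /subspace_continuousP cf; apply/subspace_continuousP => x Ex A nA.
have := cg x _ (cf (g x) (ED _ Ex) A nA).
move=> h0; apply: (@filterS _ (nbhs x) (nbhs_filter x) _ _ _ h0) => y h Ey; apply: h; exact: ED.
Qed.

Section comparison_theorem.
Context {R : realType} {n : nat}.
Local Notation X := ('rV[R]_n).
Local Notation leb := (@lebesgue_rV R n).
Variables (Omega : set X) (mu : X -> R).
Hypothesis Omega_open : open Omega.
Hypothesis Omega_bounded : bounded_set Omega.
Hypothesis frontier0 : leb (frontier Omega) = 0%E.
Hypothesis mu_ge0 : forall z, 0 <= mu z.
Hypothesis mu_L1 : leb.-integrable setT (EFin \o mu).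
Hypothesis mu_mass1 : \int[leb]_z mu z = 1.

Lemma dist2_continuous : continuous (fun q : X * X * R => dist2 q.1.1 q.1.2).
Proof.
have c1 (i : 'I_n) : continuous (fun q : X * X * R => q.1.1 ord0 i - q.1.2 ord0 i).
  move=> q; apply: (@cvgB _ _ _ (nbhs q)).
    apply: (@cvg_comp _ _ _ (fun q : X * X * R => q.1.1) (fun x : X => x ord0 i)
      _ (nbhs q.1.1)); last exact: coord_rV_continuous.
    by apply: (@cvg_comp _ _ _ fst fst _ (nbhs q.1)); exact: cvg_fst.
  apply: (@cvg_comp _ _ _ (fun q : X * X * R => q.1.2) (fun x : X => x ord0 i)
    _ (nbhs q.1.2)); last exact: coord_rV_continuous.
  by apply: (@cvg_comp _ _ _ fst snd _ (nbhs q.1)); [exact: cvg_fst|exact: cvg_snd].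
suff cs (r : seq 'I_n) : continuous (fun q : X * X * R =>
    \sum_(i <- r) (q.1.1 ord0 i - q.1.2 ord0 i) ^+ 2) by exact: cs.
elim: r => [|i r IH].
  rewrite (_ : (fun q => _) = cst 0); first exact: cst_continuous.
  by apply/funext => q; rewrite big_nil.
rewrite (_ : (fun q => _) = (fun q : X * X * R =>
    (q.1.1 ord0 i - q.1.2 ord0 i) * (q.1.1 ord0 i - q.1.2 ord0 i) +
    \sum_(i <- r) (q.1.1 ord0 i - q.1.2 ord0 i) ^+ 2)); last first.
  by apply/funext => q; rewrite big_cons expr2.
move=> q; apply: (@cvgD _ _ _ (nbhs q)); last exact: IH.
by apply: cvgM; exact: c1.
Qed.

Lemma dist2_xx (x : X) : dist2 x x = 0.
Proof. by rewrite /dist2 big1// => i _; rewrite subrr expr0n. Qed.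

Lemma dist2_small (x y : X) (d : R) : 0 < d -> dist2 x y < d ^+ 2 -> `|x - y| < d.
Proof.
move=> d0 h; rewrite [ltLHS]/Num.Def.normr/= mx_normrE.
apply/bigmax_ltP; split => // -[a i] _ /=; rewrite (ord1 a) !mxE.
rewrite -ltr_sqr ?nnegrE ?normr_ge0 ?ltW// real_normK ?num_real//.
apply: le_lt_trans h; rewrite /dist2 (bigD1 i)//= lerDl.
by apply: sumr_ge0 => j _; exact: sqr_ge0.
Qed.

(** Doubling the space variable spares [V] any regularity in space: at a maximum
    of [s u(x, t) - V(y, t) - kap/2 |x - y|^2] the Laplacian of [u] is at most
    [n kap], and [|x - y|] is small uniformly in [eps]. *)
Lemma viscous_comparison (s T th : R) (u0 : X -> R) (V : X * R -> R)
    (dV : X -> R -> R) :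
  0 < th ->
  {within closed_cyl Omega, continuous V} ->
  (forall y t, closure Omega y -> 0 < t <= T ->
     is_derive t (1 : R) (fun r => V (y, r)) (dV y t)) ->
  (forall y t, closure Omega y -> 0 < t <= T ->
     th <= dV y t - (gain Omega mu (fun z => V (z, t)) y - V (y, t))) ->
  (forall y, Omega y -> s * u0 y + th <= V (y, 0)) ->
  (forall y t, frontier Omega y -> 0 <= t <= T -> th <= V (y, t)) ->
  exists2 e0, 0 < e0 & forall eps u, 0 < eps < e0 ->
    viscous_solution Omega mu eps u0 u ->
    forall x t, Omega x -> 0 <= t <= T -> s * u (x, t) <= V (x, t).
Proof.
move=> th0 cV dVt Vsup Vinit Vbd.
have [C C0 hC] := cylinder_bounded Omega_bounded T cV.
pose KT := closure Omega `*` `[0, T]%classic : set (X * R).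
have cKT : compact KT by exact: compact_cylinder.
have KTD : KT `<=` closed_cyl Omega.
  by move=> [y t] [cy /=]; rewrite in_itv/= => /andP[t0 _].
have KTin y t : closure Omega y -> 0 <= t <= T -> KT (y, t).
  by move=> cy tT; split => //=; rewrite in_itv.
have th20 : 0 < th / 2 by lra.
have th40 : 0 < th / 4 by lra.
have [d1 d10 hd1] := compact_uniformly_continuous cKT
  (continuous_subspaceW KTD cV) th20.
have [d2 d20 hd2] := compact_uniformly_continuous cKT
  (continuous_subspaceW KTD (gain_closed_cyl_continuous Omega_open Omega_bounded
    frontier0 mu_ge0 mu_L1 cV)) th40.
pose d := Num.min d1 d2.
have d0 : 0 < d by rewrite lt_min d10.
(* At a maximum of the doubled function, [kap * dist2 x y <= 4 * C]: this choice of [kap]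
   gives [dist2 x y < d ^+ 2]. *)
pose kap := (4 * C + 1) / d ^+ 2.
have d2_gt0 : 0 < d ^+ 2 by rewrite exprn_gt0.
have kap0 : 0 < kap by rewrite divr_gt0//; lra.
have nk0 : 0 <= n%:R * kap by rewrite mulr_ge0// ltW.
(* Below this threshold the viscous term [eps * n * kap] is at most [th / 2]; together with
   the oscillation [th / 4] of the gain it stays under the margin [th]. *)
exists (th / (2 * (n%:R * kap + 1))); first by rewrite divr_gt0//; lra.
move=> eps u /andP[eps0 eps_lt] usol xs ts Oxs tsT.
rewrite leNgt; apply/negP => contra.
have [[cu _ _ _ _] _ _ u_init] := usol.
have u_bd := @viscous_frontier0 _ _ _ _ _ _ _ _ _ usol.
pose K := closure Omega `*` closure Omega `*` `[0, T]%classic : set (X * X * R).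
pose Phi (q : X * X * R) :=
  s * u (q.1.1, q.2) - V (q.1.2, q.2) - kap / 2 * dist2 q.1.1 q.1.2.
have cK : compact K.
  apply: compact_setX; last exact: segment_compact.
  by apply: compact_setX; exact: compact_closure_domain.
have cg1 : continuous (fun q : X * X * R => (q.1.1, q.2)).
  move=> q; apply: (@cvg_pair _ _ _ (nbhs q) (nbhs q.1.1) (nbhs q.2)); last exact: cvg_snd.
  by apply: (@cvg_comp _ _ _ fst fst _ (nbhs q.1)); exact: cvg_fst.
have cg2 : continuous (fun q : X * X * R => (q.1.2, q.2)).
  move=> q; apply: (@cvg_pair _ _ _ (nbhs q) (nbhs q.1.2) (nbhs q.2)); last exact: cvg_snd.
  by apply: (@cvg_comp _ _ _ fst snd _ (nbhs q.1)); [exact: cvg_fst|exact: cvg_snd].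
have cPhi : {within K, continuous Phi}.
  have c1 : {within K, continuous (u \o (fun q : X * X * R => (q.1.1, q.2)))}.
    apply: within_continuous_comp cu => // -[[x y] t] [[/= cx _]].
    by rewrite in_itv/= => /andP[t0 _].
  have c2 : {within K, continuous (V \o (fun q : X * X * R => (q.1.2, q.2)))}.
    apply: within_continuous_comp cV => // -[[x y] t] [[/= _ cy]].
    by rewrite in_itv/= => /andP[t0 _].
  have c3 : {within K, continuous (fun q : X * X * R => dist2 q.1.1 q.1.2)}.
    by apply: continuous_subspaceT; exact: dist2_continuous.
  rewrite (_ : Phi = ((cst s \* (u \o (fun q : X * X * R => (q.1.1, q.2)))) \-
     (V \o (fun q : X * X * R => (q.1.2, q.2)))) \-
     (cst (kap / 2) \* (fun q : X * X * R => dist2 q.1.1 q.1.2)))//.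
  move=> q; apply: continuousB; first apply: continuousB.
  - by apply: continuousM; [exact: cvg_cst|exact: c1].
  - exact: c2.
  - by apply: continuousM; [exact: cvg_cst|exact: c3].
have K0 : K !=set0.
  exists (xs, xs, ts); split => /=; last by rewrite in_itv.
  by split; exact: subset_closure.
have [[[x y] t]] := compact_EVT_max K0 cK cPhi.
rewrite inE => -[[/= cx cy]]; rewrite in_itv/= => tT Pmax.
have {}Pmax x' y' t' : closure Omega x' -> closure Omega y' -> 0 <= t' <= T ->
    s * u (x', t') - V (y', t') - kap / 2 * dist2 x' y' <=
    s * u (x, t) - V (y, t) - kap / 2 * dist2 x y.
  move=> cx' cy' tT'; apply: (Pmax (x', y', t')); rewrite inE.
  by split => //=; rewrite in_itv.
have cxs : closure Omega xs by exact: subset_closure.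
have m0 : 0 < s * u (x, t) - V (y, t) - kap / 2 * dist2 x y.
  apply: lt_le_trans (Pmax xs xs ts cxs cxs tsT).
  by rewrite dist2_xx mulr0 subr0 subr_gt0.
have dist_ge0 : 0 <= dist2 x y by apply: sumr_ge0 => j _; exact: sqr_ge0.
have kd0 : 0 <= kap / 2 * dist2 x y.
  by rewrite mulr_ge0// divr_ge0// ltW.
have xy : `|x - y| < d.
  apply: dist2_small => //.
  have := Pmax x x t cx cx tT; rewrite dist2_xx mulr0 subr0.
  have := hC x t cx tT; have := hC y t cy tT.
  rewrite !ler_norml => /andP[? ?] /andP[? ?] h.
  have : kap * dist2 x y <= 4 * C by lra.
  rewrite /kap mulrAC ler_pdivrMr// => h2.
  rewrite -(@ltr_pM2l _ (4 * C + 1)); last lra.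
  by rewrite (le_lt_trans h2)// mulrC [ltRHS]mulrC ltr_pM2l//; lra.
have Vxy : `|V (x, t) - V (y, t)| < th / 2.
  apply: hd1; [exact: KTin|exact: KTin|].
  rewrite prod_normE /= subrr normr0 gt_max d10 andbT.
  by rewrite (lt_le_trans xy)// ge_min lexx.
have Gxy : `|gain Omega mu (fun z => V (z, t)) x - gain Omega mu (fun z => V (z, t)) y| < th / 4.
  apply: (hd2 (x, t) (y, t)); [exact: KTin|exact: KTin|].
  rewrite prod_normE /= subrr normr0 gt_max d20 andbT.
  by rewrite (lt_le_trans xy)// ge_min lexx orbT.
have t0 : 0 <= t by case/andP : tT.
have [Ox|fx] := closure_or_frontier Omega_open cx; last first.
  have := Vbd x t fx tT; rewrite u_bd// mulr0 in m0.
  by move: Vxy; rewrite ltr_norml => /andP[? ?]; lra.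
move: t0; rewrite le_eqVlt => /predU1P[t00|t0].
  have := Vinit x Ox; move: m0 Vxy; rewrite -t00 (u_init _ Ox) ltr_norml => m0 /andP[? ?]; lra.
have tT' : 0 < t <= T by rewrite t0; case/andP : tT.
have bu := closed_cyl_slice_bounded Omega_open Omega_bounded (ltW t0) cu.
have bV := closed_cyl_slice_bounded Omega_open Omega_bounded (ltW t0) cV.
have := @viscous_touching _ _ _ _ Omega_open Omega_bounded mu_L1 _ _ _ s kap x y t
  (fun r => V (y, r)) (dV y t) eps0 usol Ox t0 _ _ (dVt y t cy tT').
have gsu : gain Omega mu (fun z => s * u (z, t)) x - gain Omega mu (fun z => V (z, t)) x <=
    s * u (x, t) - V (y, t).
  have bsu := bounded_measurableZ s bu.
  rewrite -gainB//; apply: gain_le_cst => //; try lra.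
    apply: bounded_measurableD => //.
    rewrite (_ : (fun y => _) = fun y => -1 * V (y, t)).
      exact: bounded_measurableZ.
    by apply/funext => z; rewrite mulN1r.
  move=> z Oz; have cz : closure Omega z by exact: subset_closure.
  by have := Pmax z z t cz cz tT; rewrite dist2_xx mulr0 subr0; lra.
move=> h; have {}h := h _ _.
have := Vsup y t cy tT'.
have : eps * (n%:R * kap) <= th / 2.
  have : eps * (2 * (n%:R * kap + 1)) < th by rewrite -ltr_pdivlMr//; lra.
  by rewrite mulrDr mulrDr mulr1; nra.
move: Gxy; rewrite ltr_norml => /andP[? ?].
have : dV y t <= eps * (n%:R * kap) + gain Omega mu (fun z => s * u (z, t)) x - s * u (x, t).
  apply: h.
    move=> x' Ox'; have cx' : closure Omega x' by exact: subset_closure.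
    by have := Pmax x' y t cx' cy tT; lra.
  move=> t' /andP[t'0 t't].
  have t'T : 0 <= t' <= T by rewrite t'0 (le_trans t't)//; case/andP : tT.
  by have := Pmax x y t' cx cy t'T; lra.
lra.
Qed.

(** A maximum of [s * u - th * t] above [M] would be interior, and there
    [viscous_touching] with [kap = 0] would give [th <= 0]. *)
Lemma viscous_le (eps s M : R) (u0 : X -> R) (u : X * R -> R) x t :
  0 < eps -> viscous_solution Omega mu eps u0 u -> 0 <= M ->
  (forall y, Omega y -> s * u0 y <= M) ->
  Omega x -> 0 <= t -> s * u (x, t) <= M.
Proof.
move=> eps0 usol M0 u0M Ox t0; have [[cu _ _ _ _] _ _ u_init] := usol.
have u_bd := @viscous_frontier0 _ _ _ _ _ _ _ _ _ usol.
suff key th : 0 < th -> s * u (x, t) - th * t <= M.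
  apply/ler_addgt0Pr => e e0.
  have e1 : 0 < e / (t + 1) by rewrite divr_gt0//; lra.
  have := key _ e1; rewrite -mulrA => h.
  have : (t + 1)^-1 * t <= 1 by rewrite mulrC ler_pdivrMr ?mul1r; lra.
  by move=> h2; nra.
move=> th0; rewrite leNgt; apply/negP => contra.
pose K := closure Omega `*` `[0, t]%classic : set (X * R).
have cK : compact K by exact: compact_cylinder.
pose Phi (q : X * R) := s * u q - th * q.2.
have cPhi : {within K, continuous Phi}.
  have c1 : {within K, continuous u}.
    apply: continuous_subspaceW cu => -[y r] [cy /=].
    by rewrite in_itv/= => /andP[r0 _].
  have c2 : {within K, continuous (fun q : X * R => th * q.2)}.
    apply: continuous_subspaceT => q; apply: cvgM; first exact: cvg_cst.
    exact: cvg_snd.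
  rewrite (_ : Phi = (cst s \* u) \- (fun q : X * R => th * q.2))//.
  move=> q; apply: continuousB; last exact: c2.
  by apply: continuousM; [exact: cvg_cst|exact: c1].
have K0 : K !=set0.
  exists (x, t); split => /=; first exact: subset_closure.
  by rewrite in_itv/= lexx t0.
have [[y r]] := compact_EVT_max K0 cK cPhi.
rewrite inE => -[/= cy]; rewrite in_itv/= => /andP[r0 rt] Pmax.
have {}Pmax x' t' : closure Omega x' -> 0 <= t' <= t ->
    s * u (x', t') - th * t' <= s * u (y, r) - th * r.
  move=> cx' tT'; apply: (Pmax (x', t')); rewrite inE.
  by split => //=; rewrite in_itv.
have m0 : M < s * u (y, r) - th * r.
  apply: lt_le_trans contra (Pmax x t _ _); first exact: subset_closure.
  by rewrite t0 lexx.
have thr : 0 <= th * r by rewrite mulr_ge0// ltW.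
have [Oy|fy] := closure_or_frontier Omega_open cy; last first.
  by rewrite u_bd// in m0; lra.
move: r0; rewrite le_eqVlt => /predU1P[r00|r0].
  by have := u0M y Oy; move: m0; rewrite -r00 (u_init _ Oy); lra.
have dth : is_derive r (1 : R) (fun r => th * r) th.
  by apply: is_derive_eq; rewrite /GRing.scale /=; lra.
have := @viscous_touching _ _ _ _ Omega_open Omega_bounded mu_L1 _ _ _ s 0 y y r
  (fun r => th * r) th eps0 usol Oy r0 _ _ dth.
have bu := bounded_measurableZ s
  (closed_cyl_slice_bounded Omega_open Omega_bounded (ltW r0) cu).
have : gain Omega mu (fun z => s * u (z, r)) y <= s * u (y, r).
  apply: gain_le_cst => //; first lra.
  move=> z Oz; have cz : closure Omega z by exact: subset_closure.
  by have := Pmax z r cz; rewrite (ltW r0) rt => /(_ isT); lra.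
move=> h1 h2; have : th <= eps * (n%:R * 0) + gain Omega mu (fun z => s * u (z, r)) y - s * u (y, r).
  apply: h2.
    move=> z Oz; have cz : closure Omega z by exact: subset_closure.
    by have := Pmax z r cz; rewrite (ltW r0) rt => /(_ isT); lra.
  move=> t' /andP[t'0 t'r].
  by have := Pmax y t' cy; rewrite t'0 (le_trans t'r)//= => /(_ isT); lra.
rewrite mulr0 mulr0; lra.
Qed.

End comparison_theorem.

(** * Convergence of the viscous solutions *)

Section convergence.
Context {R : realType} {n : nat}.
Local Notation X := ('rV[R]_n).
Local Notation XT := (X * measurableTypeR R)%type.
Local Notation leb := (@lebesgue_rV R n).
Variables (Omega : set X) (mu : X -> R).
Hypothesis n_gt0 : (0 < n)%N.
Hypothesis Omega_open : open Omega.
Hypothesis Omega_bounded : bounded_set Omega.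
Hypothesis frontier0 : leb (frontier Omega) = 0%E.
Hypothesis mu_ge0 : forall z, 0 <= mu z.
Hypothesis mu_L1 : leb.-integrable setT (EFin \o mu).
Hypothesis mu_mass1 : \int[leb]_z mu z = 1.
Variables (u0 : X -> R) (M : R).
Hypothesis u0_C0 : C0 Omega u0.
Hypothesis M_ge0 : 0 <= M.
Hypothesis u0_le : forall x, closure Omega x -> `|u0 x| <= M.

Local Notation jf := (jump_flow Omega mu u0).

(** The barrier is the limit [s * jf] raised by [M] on a boundary layer of
    thickness [r], where the viscous solution cannot follow [jf]; the factor
    [expR (2 * t)] makes it a strict supersolution, since jumps out of the layer
    contribute little. *)
Lemma viscous_upper (s : R) x (T e : R) : `|s| = 1 -> Omega x -> 0 <= T -> 0 < e ->
  exists2 e0, 0 < e0 & forall eps u, 0 < eps < e0 ->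
    viscous_solution Omega mu eps u0 u ->
    forall t, 0 <= t <= T -> s * u (x, t) <= s * jf (x, t) + e.
Proof.
move=> s1 Ox T0 e0; have [cu0 _] := u0_C0.
(* The barrier exceeds [s * jf] by [expR (2 * t) * eta] off the layer: at most [e] up to
   time [T]. *)
pose eta := e * expR (- (2 * T)).
have eta0 : 0 < eta by rewrite mulr_gt0// expR_gt0.
have [r1 r10 hr1] := gain_layer_small n_gt0 Omega_open Omega_bounded frontier0
  mu_ge0 mu_L1 (e := eta / (M + 1)) (divr_gt0 eta0 (ltr_wpDl M_ge0 ltr01)).
have dx0 : 0 < depth Omega x by exact: depth_gt0.
pose r := Num.min r1 (depth Omega x) / 2.
have m0 : 0 < Num.min r1 (depth Omega x) by rewrite lt_min r10.
have r0 : 0 < r by rewrite /r; lra.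
have rr1 : r < r1.
  by have : Num.min r1 (depth Omega x) <= r1 by [rewrite ge_min lexx]; rewrite /r; lra.
have rdx : r < depth Omega x.
  by have : Num.min r1 (depth Omega x) <= depth Omega x by [rewrite ge_min lexx orbT]; rewrite /r; lra.
pose l (y : X) := layer Omega y r.
have bl : bounded_measurable Omega l by exact: layer_bounded_measurable (ltW r0).
have gl y : closure Omega y -> M * gain Omega mu l y <= eta.
  move=> cy; have := hr1 r y; rewrite r0 rr1 => /(_ isT cy).
  rewrite ler_pdivlMr; last by rewrite ltr_wpDl.
  have : 0 <= gain Omega mu l y.
    by apply: Rintegral_ge0 => z _; rewrite mulr_ge0// layer_ge0// ltW.
  by rewrite -/l => h1 h2; nra.
pose b (y : X) := M * l y + eta.
pose V (p : X * R) := s * jf p + expR (2 * p.2) * b p.1.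
pose dV (y : X) (t : R) := s * K0 Omega mu jf (y, t) + 2 * expR (2 * t) * b y.
have cjf : {within closed_cyl Omega, continuous jf}.
  exact: (jump_flow_continuous (M := M)).
have b_ge y : eta <= b y by rewrite /b lerDr mulr_ge0// layer_ge0// ltW.
have cV : {within closed_cyl Omega, continuous V}.
  have c1 : {within closed_cyl Omega, continuous (fun p : X * R => expR (2 * p.2) * b p.1)}.
    apply: continuous_subspaceT => p; apply: cvgM.
      exact: (@continuous_expR_snd R X 2 p).
    apply: (@cvg_comp _ _ _ fst b _ (nbhs p.1)); first exact: cvg_fst.
    rewrite (_ : b = (cst M \* l) \+ cst eta)//.
    apply: (@cvgD _ _ _ (nbhs p.1) (nbhs_filter p.1) (cst M \* l) (cst eta)).
      apply: (@cvgM _ _ (nbhs p.1) (nbhs_filter p.1) (cst M) l).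
        exact: (@cvg_cst _ _ _ (nbhs p.1)).
      exact: layer_continuous.
    exact: (@cvg_cst _ _ _ (nbhs p.1)).
  rewrite (_ : V = (cst s \* jf) \+ (fun p : X * R => expR (2 * p.2) * b p.1))//.
  move=> p; apply: continuousD; last exact: c1.
  by apply: continuousM; [exact: cvg_cst|exact: cjf].
have expR_ge1 (t : R) : 0 <= t -> 1 <= expR (2 * t).
  by move=> t0; rewrite -expR0 ler_expR mulr_ge0.
have [||||e1 e10 H] := viscous_comparison (s := s) (T := T) (u0 := u0) (dV := dV)
  Omega_open Omega_bounded frontier0 mu_ge0 mu_L1 mu_mass1 eta0 cV.
- move=> y t cy /andP[t0 _].
  have h1 : is_derive t (1 : R) (fun r => jf (y, r)) (K0 Omega mu jf (y, t)).
    by apply: (jump_flow_is_derive (M := M)) => //; exact: ltW.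
  rewrite /V /dV /=; apply: is_derive_eq.
  by rewrite /GRing.scale /=; lra.
- move=> y t cy /andP[/ltW t0 _].
  have bjf := closed_cyl_slice_bounded Omega_open Omega_bounded t0 cjf.
  have -> : gain Omega mu (fun z => V (z, t)) y = s * gain Omega mu (fun z => jf (z, t)) y +
      expR (2 * t) * (M * gain Omega mu l y + gain Omega mu (fun=> eta) y).
    have bc := @bounded_measurable_cst R n Omega eta.
    have bMl := bounded_measurableZ M bl.
    rewrite /V /= -gainZ// -[M * _]gainZ// -[gain _ _ _ _ + gain _ _ (fun=> eta) _]gainD//.
    rewrite -[expR _ * _]gainZ//; last exact: bounded_measurableD.
    rewrite -gainD//; first exact: bounded_measurableZ.
    by apply: bounded_measurableZ; exact: bounded_measurableD.
  rewrite /dV /V K0E /=.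
  have := gl y cy; have := gain_cst_le Omega_open mu_ge0 mu_L1 mu_mass1 y (ltW eta0).
  have := b_ge y; have := expR_ge1 t t0.
  set E := expR _; set G := gain _ _ (fun=> eta) y; set L := M * gain _ _ l y.
  move=> E1 b1 G1 L1; nra.
- move=> y Oy; rewrite /V /= mulr0 expR0 mul1r jump_flow0 lerD2l.
  exact: b_ge.
- move=> y t fy /andP[t0 _]; have cy : closure Omega y by case: fy.
  have ny : ~ Omega y by move=> Oy; exact: (open_frontier_disjoint Omega_open Oy).
  rewrite /V /b /l layer_frontier//= mulr1.
  have sjf : `|s * jf (y, t)| <= M.
    by rewrite normrM s1 mul1r; exact: jump_flow_le.
  have h1 := expR_ge1 t t0.
  have h2 : 0 <= (expR (2 * t) - 1) * (M + eta).
    by rewrite mulr_ge0 ?subr_ge0// addr_ge0// ltW.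
  by move: sjf; rewrite ler_norml => /andP[h _]; lra.
exists e1 => // eps u epsI usol t tT; apply: le_trans (H _ _ epsI usol _ _ Ox tT) _.
rewrite /V /= lerD2l /b /l layer_deep; last exact: ltW.
rewrite mulr0 add0r /eta mulrCA -expRD; rewrite -[leRHS]mulr1 ler_pM2l//.
by rewrite -[leRHS]expR0 ler_expR; move/andP : tT => [? ?]; lra.
Qed.

Variable ueps : R -> X * R -> R.
Hypothesis ueps_solution : forall eps, 0 < eps ->
  viscous_solution Omega mu eps u0 (ueps eps).

Lemma viscous_pointwise p : cyl Omega p -> ueps eps p @[eps --> 0^'+] --> jf p.
Proof.
case: p => x t [/= Ox t0]; have t0' : 0 <= t by exact: ltW.
apply/cvgrPdist_le => e e0.
have n1 : `|(-1 : R)| = 1 by rewrite normrN normr1.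
have [e1 e10 h1] := viscous_upper (normr1 R) Ox t0' e0.
have [e2 e20 h2] := viscous_upper n1 Ox t0' e0.
near=> eps.
have eps0 : 0 < eps by near: eps; exact: nbhs_right_gt.
have eps1 : eps < e1 by near: eps; exact: nbhs_right_lt.
have eps2 : eps < e2 by near: eps; exact: nbhs_right_lt.
have tt : 0 <= t <= t by rewrite t0' lexx.
have := h1 eps _ _ (ueps_solution eps0) t tt; rewrite eps0 eps1 => /(_ isT) H1.
have := h2 eps _ _ (ueps_solution eps0) t tt; rewrite eps0 eps2 => /(_ isT) H2.
by rewrite ler_norml; apply/andP; split; lra.
Unshelve. all: by end_near. Qed.

Lemma viscous_bound eps p : 0 < eps -> cyl Omega p -> `|ueps eps p| <= M.
Proof.
move=> eps0; case: p => x t [/= Ox /ltW t0]; have sol := ueps_solution eps0.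
have u0M y : Omega y -> - M <= u0 y <= M.
  by move=> Oy; rewrite -ler_norml; apply: u0_le; exact: subset_closure.
have h s := @viscous_le _ _ _ _ Omega_open Omega_bounded mu_ge0 mu_L1 mu_mass1
  eps s M u0 (ueps eps) x t eps0 sol M_ge0.
rewrite ler_norml; apply/andP; split.
  rewrite lerNl -mulN1r; apply: h => // y /u0M /andP[? ?]; lra.
by rewrite -[ueps eps (x, t)]mul1r; apply: h => // y /u0M /andP[? ?]; lra.
Qed.

Lemma open_cyl : open (cyl Omega).
Proof.
have c1 : continuous (fst : X * R -> X) by move=> p; exact: cvg_fst.
have c2 : continuous (snd : X * R -> R) by move=> p; exact: cvg_snd.
move/continuousP : c1 => /(_ _ Omega_open) o1.
move/continuousP : c2 => /(_ _ (@open_gt _ 0)) o2.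
exact: openI o1 o2.
Qed.

Lemma cyl_closed_cyl : cyl Omega `<=` closed_cyl Omega.
Proof. by move=> [x t] [/= Ox /ltW t0]; split => //; exact: subset_closure. Qed.

Lemma measurable_cyl : measurable (cyl Omega : set XT).
Proof. by apply: open_measurable_cyl; exact: open_cyl. Qed.

Lemma closed_cyl_measurable (w : X * R -> R) :
  {within closed_cyl Omega, continuous w} ->
  measurable_fun (cyl Omega : set XT) (w : XT -> R).
Proof.
by move=> cw; apply: cyl_continuous_measurable cw;
  [exact: measurable_cyl|exact: cyl_closed_cyl].
Qed.

Lemma closed_cyl_Linfty (w : X * R -> R) :
  {within closed_cyl Omega, continuous w} ->
  (forall p, cyl Omega p -> `|w p| <= M) -> Linfty (cyl Omega) w.
Proof.
move=> cw wM; rewrite /Linfty inE; apply/andP; split; rewrite inE /=.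
  exact: ((measurable_restrictT _ measurable_cyl).1 (closed_cyl_measurable cw)).
rewrite /finite_norm unlock; case: ifPn => [_|]; last by rewrite ltry.
apply: (@le_lt_trans _ _ M%:E); last by rewrite ltry.
apply/ess_sup_inf.ess_supP; apply: nearW => p.
rewrite /= lee_fin /restrict; case: ifPn => [|_]; last by rewrite normr0.
by rewrite inE; exact: wM.
Qed.

(** The uniform bound [M] dominates the pointwise convergence. *)
Lemma viscous_weak_star : weak_star_cvg0 (cyl Omega) ueps jf.
Proof.
have [cu0 _] := u0_C0.
have cjf : {within closed_cyl Omega, continuous jf}.
  exact: (jump_flow_continuous (M := M)).
have ceps eps : 0 < eps -> {within closed_cyl Omega, continuous (ueps eps)}.
  by move=> /ueps_solution[[]].
split.
- move=> eps eps0; apply: closed_cyl_Linfty; first exact: ceps.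
  by move=> p; exact: viscous_bound.
- apply: closed_cyl_Linfty => // -[x t] [/= Ox /ltW t0].
  by apply: jump_flow_le => //; exact: subset_closure.
move=> g ig; have mg : measurable_fun (cyl Omega : set XT) g.
  by apply/measurable_EFinP; case/integrableP : ig.
apply/cvg_at_rightP => e_ [e_gt0 e_cvg0].
apply: (@Rdominated_convergence _ XT R (lebesgue_cyl n) (cyl Omega)
  (fun k p => ueps (e_ k) p * g p) (fun p => jf p * g p) (fun p => M * `|g p|)).
- exact: measurable_cyl.
- move=> k; apply: measurable_funM => //; apply: closed_cyl_measurable.
  exact: ceps.
- by apply: measurable_funM => //; exact: closed_cyl_measurable.
- apply: aeW => p Dp; apply: cvgM; last exact: cvg_cst.
  have /cvg_at_rightP := viscous_pointwise Dp; apply.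
  by split.
- have := integrableZl measurable_cyl M (integrable_norm ig).
  by apply: eq_integrable => //; exact: measurable_cyl.
- move=> p k Dp; rewrite normrM ler_wpM2r//.
  exact: viscous_bound.
Qed.

End convergence.

(** * Distributional time derivatives *)

Lemma cvg_pairl (T U : topologicalType) (x : T) (t : U) :
  (x, r) @[r --> t] --> (x, t).
Proof. by apply: cvg_pair; [exact: cvg_cst|exact: cvg_id]. Qed.

Section distributions.
Context {R : realType} {n : nat}.
Local Notation X := ('rV[R]_n).
Local Notation XT := (X * measurableTypeR R)%type.
Local Notation leb := (@lebesgue_rV R n).
Variables (Omega : set X).
Hypothesis Omega_open : open Omega.
Hypothesis Omega_bounded : bounded_set Omega.

Definition supported_between (a b : R) (psi : X * R -> R) : Prop :=
  forall p, psi p != 0 -> Omega p.1 /\ a < p.2 < b.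

Lemma smooth_continuous (V : normedModType R) (f : V -> R) : smooth f -> continuous f.
Proof. by move=> /(_ [::]) []. Qed.

Lemma smooth_derivable (V : normedModType R) (f : V -> R) x v :
  smooth f -> derivable f x v.
Proof. by move=> /(_ [::]) [_]; apply. Qed.

Lemma smooth_derive_continuous (V : normedModType R) (f : V -> R) v :
  smooth f -> continuous ('D_v f).
Proof. by move=> /(_ [:: v]) []. Qed.

Lemma derive_off_support (V : normedModType R) (f : V -> R) p v :
  ~ closure [set q | f q != 0] p -> 'D_v f p = 0.
Proof.
move=> np; have [->|v0] := eqVneq v 0; first by rewrite derive0.
rewrite (@near_eq_derive _ _ _ f (cst 0)) ?derive_cst//.
have oS : open (~` closure [set q | f q != 0]) by exact/closed_openC/closed_closure.
apply: filterS (open_nbhs_nbhs (conj oS np)) => q nq.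
by apply/eqP; apply: contrapT => /negP fq; apply: nq; exact: subset_closure.
Qed.

Lemma test_function_between (phi : X * R -> R) : test_function Omega phi ->
  exists a b, [/\ 0 < a, a < b, supported_between a b phi &
    supported_between a b ('D_(e_t n) phi)].
Proof.
move=> [sphi cS SD]; set S := closure _ in cS SD.
have [S0|nS0] := pselect (S !=set0); last first.
  have nS p : ~ S p by move=> Sp; apply: nS0; exists p.
  exists 1, 2; split => //; first by lra.
    move=> p fp; exfalso; apply: (nS p); exact: subset_closure.
  by move=> p /eqP[]; apply: derive_off_support; exact: nS.
have c2 : {within S, continuous (snd : X * R -> R)}.
  by apply: continuous_subspaceT => p; exact: cvg_snd.
have [p1] := compact_EVT_min S0 cS c2; rewrite inE => Sp1 min1.
have [p2] := compact_EVT_max S0 cS c2; rewrite inE => Sp2 max2.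
have [_ /= p10] := SD _ Sp1.
have h p : S p -> Omega p.1 /\ p1.2 / 2 < p.2 < p2.2 + 1.
  move=> Sp; have [Op _] := SD _ Sp; split => //.
  have := min1 p; rewrite inE => /(_ Sp); have := max2 p; rewrite inE => /(_ Sp).
  by move=> ? ?; apply/andP; split; lra.
exists (p1.2 / 2), (p2.2 + 1); split.
- by rewrite divr_gt0.
- by have [_ /andP[]] := h _ Sp1; exact: lt_trans.
- by move=> p fp; apply: h; exact: subset_closure.
- move=> p Dp; apply: h; apply: contrapT => nS; move/eqP : Dp; apply.
  exact: derive_off_support.
Qed.

Lemma lebesgue_domain_lty : (leb Omega < +oo)%E.
Proof.
have [M M0 hM] := domain_norm_le Omega_bounded.
have M10 : 0 <= M + 1 by lra.
apply: (@le_lt_trans _ _ (leb [set y : X | forall i, (`|(0 : X) ord0 i - y ord0 i| < M + 1)%R])).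
  2: by rewrite lebesgue_rVbox// ltry.
apply: le_measure; rewrite ?inE.
- exact: open_measurable_rV.
- exact: measurable_rVbox.
- move=> x /hM xM i /=; rewrite mxE sub0r normrN.
  apply: le_lt_trans (le_lt_trans xM _); last by rewrite ltrDl.
  rewrite [leRHS]/Num.Def.normr/= mx_normrE.
  by rewrite (bigD1 (ord0, i))//= le_max lexx.
Qed.

Lemma supported_integrable (w psi : X * R -> R) (a b : R) : 0 < a ->
  {within closed_cyl Omega, continuous w} -> continuous psi ->
  supported_between a b psi ->
  (lebesgue_cyl n).-integrable (cyl Omega : set XT) (EFin \o (fun p => w p * psi p)).
Proof.
move=> a0 cw cpsi spsi.
pose D : set XT := Omega `*` (`]a, b[%classic : set (measurableTypeR R)).
have mO : measurable Omega by exact: open_measurable_rV.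
have mD : measurable D by apply: measurableX.
have mC : measurable (cyl Omega : set XT) by exact: measurable_cyl.
have cwp : {within closed_cyl Omega, continuous (fun p => w p * psi p)}.
  move=> p; apply: continuousM; first exact: cw.
  by apply: (@continuous_subspaceT _ _ _ psi).
have E : (EFin \o (fun p => w p * psi p)) \_ (cyl Omega) =
    (EFin \o (fun p : XT => w p * psi p)) \_ D.
  apply/funext => -[x t]; rewrite /restrict.
  have [p0|/spsi[/= Ox /andP[ta tb]]] := eqVneq (psi (x, t)) 0.
    by rewrite /= p0 mulr0 !if_same.
  rewrite !mem_set//; first by split => //=; rewrite in_itv/= ta.
  by split => //=; exact: lt_trans ta.
apply/(integrable_mkcond _ mC).2; rewrite E; apply/(integrable_mkcond _ mD).1.
have DC : D `<=` closed_cyl Omega.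
  move=> [x t] [/= Ox]; rewrite in_itv/= => /andP[ta tb]; split => /=.
    exact: subset_closure.
  by rewrite ltW// (lt_trans a0).
have [C C0 hC] := cylinder_bounded Omega_bounded b cwp.
apply: measurable_bounded_integrable => //.
- rewrite /D /lebesgue_cyl /= product_measure1E// lte_mul_pinfty//.
    by rewrite ge0_fin_numE//; exact: lebesgue_domain_lty.
  suff : (@lebesgue_measure R `]a, b[%classic < +oo)%E by [].
  by rewrite lebesgue_measure_itv/=; case: ifPn => // _; rewrite -EFinB ltry.
- exact: (cyl_continuous_measurable mD DC cwp).
- exists C; split; first exact: num_real.
  move=> B CB [x t] /= Dp; apply: le_trans (ltW CB).
  have [cx t0] := DC _ Dp; apply: hC => //; rewrite t0/=.
  by case: Dp => _ /=; rewrite in_itv/= => /andP[_ /ltW].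
Qed.

(** Fubini reduces to the lines parallel to the time axis, along which the
    product [w * phi] vanishes at both ends. *)
Lemma integration_by_parts_in_time (w w' phi : X * R -> R) :
  {within closed_cyl Omega, continuous w} ->
  {within closed_cyl Omega, continuous w'} ->
  (forall x (t : R), Omega x -> 0 < t ->
    is_derive t (1 : R) (fun r => w (x, r)) (w' (x, t))) ->
  test_function Omega phi ->
  - (\int[lebesgue_cyl n]_(p in (cyl Omega : set XT)) (w p * 'D_(e_t n) phi p)) =
  (\int[lebesgue_cyl n]_(p in (cyl Omega : set XT)) (w' p * phi p)).
Proof.
move=> cw cw' dw tphi; have [a [b [a0 ab s1 s2]]] := test_function_between tphi.
have sphi : smooth phi by case: tphi.
have mC : measurable (cyl Omega : set XT) by exact: measurable_cyl.
have i1 := supported_integrable a0 cw (smooth_derive_continuous (v := e_t n) sphi) s2.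
have i2 := supported_integrable a0 cw' (smooth_continuous sphi) s1.
pose h (p : XT) := w p * 'D_(e_t n) phi p + w' p * phi p.
have ih : (lebesgue_cyl n).-integrable (cyl Omega : set XT) (EFin \o h).
  by have := integrableD mC i1 i2; apply: eq_integrable.
apply/eqP; rewrite eq_sym -addr_eq0 addrC -RintegralD//; apply/eqP.
rewrite -[LHS]/(Rintegral _ _ h) /Rintegral.
rewrite integral_mkcond -[RHS]/(fine 0%E); congr fine.
have ihT : (lebesgue_cyl n).-integrable setT ((EFin \o h) \_ (cyl Omega : set XT)).
  exact: ((integrable_mkcond _ mC).1 ih).
rewrite -(integral12_prod_meas1 ihT).
rewrite (eq_integral (fun=> 0%E)) ?integral0// => x _.
have [Ox|nOx] := pselect (Omega x); last first.
  rewrite /fubini_F (eq_integral (fun=> 0%E)) ?integral0// => t _.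
  by rewrite /restrict memNset// => -[].
have hab (t : R) : ~ (`[a, b]%classic t) -> h (x, t) = 0.
  move=> nt; rewrite /h.
  have nab psi : supported_between a b psi -> psi (x, t) = 0.
    move=> sp; apply/eqP; apply: contrapT => /negP /sp[_ /= /andP[ta tb]].
    by apply: nt; rewrite /= in_itv/= !ltW.
  by rewrite (nab _ s1) (nab _ s2) !mulr0 addr0.
have FE : (\int[lebesgue_measure]_y ((EFin \o h) \_ (cyl Omega : set XT)) (x, y) =
    \int[lebesgue_measure]_(t in `[a, b]) (h (x, t))%:E)%E.
  rewrite [in RHS]integral_mkcond; apply: eq_integral => t _.
  rewrite !patchE; case: ifPn => [c1|c1]; case: ifPn => // c2.
  - rewrite /= hab// => tt.
    by move/negP : c2; apply; rewrite inE.
  - move: c2; rewrite inE /= in_itv/= => /andP[ta _].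
    move/negP : c1; case; rewrite inE.
    by split => //=; exact: lt_le_trans ta.
rewrite /fubini_F FE.
have dphi (t : R) : is_derive t (1 : R) (fun r => phi (x, r)) ('D_(e_t n) phi (x, t)).
  by apply: is_derive_time_line; split => //; exact: smooth_derivable.
pose F (t : R) := w (x, t) * phi (x, t).
have dF (t : R) : 0 < t -> is_derive t (1 : R) F (h (x, t)).
  move=> t0; have h1 := dw x t Ox t0; have h2 := dphi t.
  by rewrite /F /h; apply: is_derive_eq; rewrite /GRing.scale /=; lra.
have cF (t : R) : 0 < t -> {for t, continuous F}.
  by move=> /dF[d _]; apply: differentiable_continuous; exact/derivable1_diffP.
have b0 : 0 < b by exact: lt_trans ab.
have phi0 (t : R) : ~~ (a < t < b) -> phi (x, t) = 0.
  by move=> nt; apply/eqP; apply: contrapT => /negP /s1[_ /= tab]; move/negP : nt.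
rewrite (@continuous_FTC2 _ _ F)//.
- by rewrite /F !phi0 ?ltxx ?andbF// !mulr0 -EFinB subrr.
- apply/subspace_continuousP => t /=; rewrite in_itv/= => /andP[ta tb].
  have t0 : 0 < t by exact: lt_le_trans ta.
  have ct : closed_cyl Omega (x, t) by apply: cyl_closed_cyl; split.
  have cpt : (x, r) @[r --> t] --> (x, t) by exact: cvg_pairl.
  have wc (v : X * R -> R) : {within closed_cyl Omega, continuous v} ->
      v (x, r) @[r --> t] --> v (x, t).
    move=> /(continuous_subspaceW (@cyl_closed_cyl _ _ Omega)).
    rewrite continuous_open_subspace; last exact: open_cyl.
    move=> cv; apply: (cvg_comp _ _ cpt); apply: cv.
    by rewrite inE; split.
  apply: cvg_within_filter; rewrite /h.
  have pc (v : X * R -> R) : continuous v -> v (x, r) @[r --> t] --> v (x, t).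
    by move=> cv; exact: (cvg_comp _ _ cpt (cv (x, t))).
  exact: cvgD (cvgM (wc w cw) (pc _ (smooth_derive_continuous (v := e_t n) sphi)))
    (cvgM (wc w' cw') (pc _ (smooth_continuous sphi))).
- split.
  + move=> t; rewrite in_itv/= => /andP[ta tb].
    by have [] := dF t (lt_trans a0 ta).
  + by apply: cvg_at_right_filter; exact: cF.
  + by apply: cvg_at_left_filter; exact: cF.
- move=> t; rewrite in_itv/= => /andP[ta tb].
  by rewrite derive1E; have [_] := dF t (lt_trans a0 ta).
Qed.

End distributions.

(** * Smooth functions *)

Section smooth_calculus.
Context {R : realType}.
Implicit Types (V : normedModType R).

(** [smooth] graded by the order of differentiation: closure under products and
    inverses goes by induction on that order. *)
Fixpoint smooth_upto V (k : nat) (f : V -> R) : Prop :=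
  [/\ continuous f, forall x v, derivable f x v &
    if k is k'.+1 then forall v, smooth_upto k' ('D_v f) else True].

Lemma smooth_uptoP V (f : V -> R) : (forall k, smooth_upto k f) -> smooth f.
Proof.
move=> sf vs.
suff H (ws : seq V) (g : V -> R) : smooth_upto (size ws) g ->
    let g' := foldr (fun v h => 'D_v h) g (rev ws) in
    continuous g' /\ forall x v, derivable g' x v.
  by rewrite -[vs]revK; apply: H; exact: sf.
elim: ws g => [|w ws IH] g /=; first by case.
by move=> [_ _ sg]; rewrite rev_cons foldr_rcons; apply: IH; exact: sg.
Qed.

Lemma smooth_uptoS V k (f : V -> R) : smooth_upto k.+1 f -> smooth_upto k f.
Proof.
elim: k f => [|k IH] f [cf df sf]; first by split.
by split => // v; apply: IH; exact: sf.
Qed.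

Lemma smooth_upto_cst V k (c : R) : smooth_upto k (cst c : V -> R).
Proof.
elim: k c => [|k IH] c.
  by split; [move=> x; exact: cvg_cst|move=> x v; exact: derivable_cst|].
split; [by move=> x; exact: cvg_cst|by move=> x v; exact: derivable_cst|].
move=> v; rewrite (_ : 'D_v _ = cst 0); first exact: IH.
by apply/funext => x; rewrite derive_cst.
Qed.

Lemma smooth_uptoD V k (f g : V -> R) : smooth_upto k f -> smooth_upto k g ->
  smooth_upto k (fun x => f x + g x).
Proof.
elim: k f g => [|k IH] f g [cf df sf] [cg dg sg]; split => //.
- by move=> x; apply: cvgD; [exact: cf|exact: cg].
- by move=> x v; apply: derivableD.
- by move=> x; apply: cvgD; [exact: cf|exact: cg].
- by move=> x v; apply: derivableD.
- move=> v; rewrite (_ : 'D_v _ = fun x => 'D_v f x + 'D_v g x).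
    by apply: IH; [exact: sf|exact: sg].
  by apply/funext => x; rewrite -deriveD.
Qed.

Lemma smooth_uptoM V k (f g : V -> R) : smooth_upto k f -> smooth_upto k g ->
  smooth_upto k (fun x => f x * g x).
Proof.
elim: k f g => [|k IH] f g /[dup] sf0 [cf df sf] /[dup] sg0 [cg dg sg]; split => //.
- by move=> x; apply: cvgM; [exact: cf|exact: cg].
- by move=> x v; apply: derivableM.
- by move=> x; apply: cvgM; [exact: cf|exact: cg].
- by move=> x v; apply: derivableM.
- move=> v; rewrite (_ : 'D_v _ = fun x => f x * 'D_v g x + g x * 'D_v f x).
    apply: smooth_uptoD; apply: IH.
    + exact: (smooth_uptoS sf0).
    + exact: sg.
    + exact: (smooth_uptoS sg0).
    + exact: sf.
  by apply/funext => x; rewrite (@deriveM _ _ f g).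
Qed.

Lemma smooth_uptoV V k (f : V -> R) : (forall x, f x != 0) -> smooth_upto k f ->
  smooth_upto k (fun x => (f x)^-1).
Proof.
move=> f0; elim: k => [|k IH] /[dup] sf0 [cf df sf]; split => //.
- by move=> x; apply: cvgV; [exact: f0|exact: cf].
- by move=> x v; apply: derivableV.
- by move=> x; apply: cvgV; [exact: f0|exact: cf].
- by move=> x v; apply: derivableV.
- have sV := IH (smooth_uptoS sf0).
  move=> v; rewrite (_ : 'D_v _ = fun x => - 1 * 'D_v f x * ((f x)^-1 * (f x)^-1)).
    apply: smooth_uptoM; last exact: smooth_uptoM.
    by apply: smooth_uptoM; [exact: smooth_upto_cst|exact: sf].
  apply/funext => x; rewrite deriveV// /GRing.scale /= expr2 invfM; ring.
Qed.

Lemma derive_direction (f : R -> R) (x v : R) : derivable f x 1 ->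
  is_derive x v f (v * 'D_1 f x).
Proof.
move=> /derivable1_diffP df; split; first exact: diff_derivable.
rewrite deriveE// deriveE// -[X in 'd f x X](mulr1 v).
exact: linearZ.
Qed.

(** [l] is an affine form of linear part [l0], so that differentiating [f \o l] along [v]
    only brings out the constant [l0 v]. *)
Lemma smooth_upto_comp V k (f : R -> R) (l l0 : V -> R) : continuous l ->
  (forall x v (h : R), l (h *: v + x) = h * l0 v + l x) ->
  smooth_upto k f -> smooth_upto k (f \o l).
Proof.
move=> cl lE.
have dl (g : R -> R) x v : derivable g (l x) (1 : R) ->
    is_derive x v (g \o l) (l0 v * 'D_1 g (l x)).
  move=> /(@derive_direction g (l x) (l0 v)) [dg E].
  have H : (fun h : R => h^-1 *: (((g \o l) \o shift x) (h *: v) - (g \o l) x)) =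
      (fun h : R => h^-1 *: ((g \o shift (l x)) (h *: l0 v) - g (l x))).
    by apply/funext => h /=; rewrite lE.
  by split; rewrite /derivable /derive H.
elim: k f => [|k IH] f [cf df sf]; split => //.
- by move=> x; apply: continuous_comp; [exact: cl|exact: cf].
- by move=> x v; have [] := dl f x v (df (l x) 1).
- by move=> x; apply: continuous_comp; [exact: cl|exact: cf].
- by move=> x v; have [] := dl f x v (df (l x) 1).
- move=> v; rewrite (_ : 'D_v _ = fun x => cst (l0 v) x * ('D_1 f \o l) x).
    by apply: smooth_uptoM; [exact: smooth_upto_cst|apply: IH; exact: sf].
  by apply/funext => x; have [_] := dl f x v (df (l x) 1).
Qed.

End smooth_calculus.

Section flat.
Context {R : realType}.

(** The family [t ^ -j * exp (- 1 / t)], extended by 0: closed under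
    differentiation up to linear combinations. *)
Definition flat (j : nat) (t : R) : R :=
  if 0 < t then t^-1 ^+ j * expR (- t^-1) else 0.

Lemma flat_le0 j t : t <= 0 -> flat j t = 0.
Proof. by rewrite leNgt /flat => /negbTE ->. Qed.

Lemma flat_gt0 j t : 0 < t -> 0 < flat j t.
Proof. by move=> t0; rewrite /flat t0 mulr_gt0 ?expR_gt0// exprn_gt0// invr_gt0. Qed.

Lemma flat_ge0 j t : 0 <= flat j t.
Proof. by have [/flat_le0 ->|/flat_gt0/ltW] := leP t 0. Qed.

(** A quadratic bound is what the derivative at 0 requires. *)
Lemma flat_shrink j t : 0 < t -> flat j t <= j.+2`!%:R * t ^+ 2.
Proof.
move=> t0; rewrite /flat t0; set s := t^-1.
have s0 : 0 < s by rewrite invr_gt0.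
rewrite expRN ler_pdivrMr ?expR_gt0//.
have h := expR_ge1Dxn j.+1 (ltW s0).
have {}h : s ^+ j.+2 <= j.+2`!%:R * expR s.
  rewrite -ler_pdivrMl ?ltr0n ?fact_gt0// mulrC; apply: le_trans h.
  by rewrite lerDr.
rewrite mulrAC -ler_pdivrMr ?exprn_gt0// -exprVn -/s -exprD addn2.
exact: h.
Qed.

Lemma is_derive_flat j t :
  is_derive t (1 : R) (flat j) (flat j.+2 t - j%:R * flat j.+1 t).
Proof.
have [t0|t0|->] := ltgtP t 0.
- rewrite !flat_le0 ?ltW// mulr0 subr0.
  apply: (@near_eq_is_derive _ _ _ (cst 0)) => //.
  near=> s; rewrite flat_le0//; apply: ltW; near: s.
  exact: lt_nbhsl.
- have tN0 : t != 0 by rewrite gt_eqF.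
  apply: (@near_eq_is_derive _ _ _
      ((fun y : R => y^-1) ^+ j * (fun y : R => expR (- y^-1)))).
    near=> s; have s0 : 0 < s by near: s; exact: lt_nbhsr.
    by rewrite /flat s0 !fctE.
  have dV : is_derive t (1 : R) (fun y : R => y^-1) (- t^-1 ^+ 2).
    split; first exact: derivableV.
    by rewrite (@deriveV _ _ id)// derive_id /GRing.scale /= mulr1 exprVn.
  have dE : is_derive t (1 : R) (fun y : R => expR (- y^-1))
      (expR (- t^-1) * t^-1 ^+ 2).
    have dN : is_derive t (1 : R) (fun y : R => - y^-1) (t^-1 ^+ 2).
      by apply: is_derive_eq; rewrite opprK.
    by apply: is_derive_eq; rewrite /GRing.scale /= mulrC.
  apply: (is_derive_eq (is_deriveM (is_deriveX j dV) dE)).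
  rewrite /flat t0 /GRing.scale /= !fctE; set s := t^-1; set E := expR _.
  by case: j => [|j] /=; rewrite ?expr0 ?exprS; ring.
- rewrite !flat_le0// mulr0 subr0.
  have H : (fun h : R => h^-1 *: ((flat j \o shift 0) (h *: 1) - flat j 0)) @ 0^' --> (0 : R).
    apply/cvgrPdist_le => e e0; near=> h.
    rewrite /= sub0r normrN addr0 [h *: 1]mulr1 (flat_le0 _ (lexx 0)) subr0.
    have [h0|h0] := leP h 0; first by rewrite flat_le0// scaler0 normr0 ltW.
    rewrite /GRing.scale /= normrM !ger0_norm ?invr_ge0 ?flat_ge0 ?(ltW h0)//.
    rewrite ler_pdivrMl//; apply: le_trans (flat_shrink j h0) _.
    rewrite expr2 mulrCA ler_wpM2l ?(ltW h0)//.
    rewrite -ler_pdivlMl ?ltr0n ?fact_gt0//.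
    have : `|h| < j.+2`!%:R^-1 * e.
      near: h; apply: dnbhs0_lt; rewrite mulr_gt0// invr_gt0 ltr0n fact_gt0//.
    by rewrite gtr0_norm// => /ltW.
  split; first by apply/cvg_ex; exists 0.
  exact: cvg_lim H.
Unshelve. all: by end_near. Qed.

Lemma flat_smooth k j : smooth_upto k (flat j).
Proof.
have cf i : continuous (flat i).
  move=> t; apply: differentiable_continuous; apply/derivable1_diffP.
  by have [] := is_derive_flat i t.
have df i t v : is_derive t v (flat i) (v * (flat i.+2 t - i%:R * flat i.+1 t)).
  have [d E] := is_derive_flat i t.
  by rewrite -E; exact: derive_direction.
elim: k j => [|k IH] j; split; try exact: cf; try by move=> t v; have [] := df j t v.
  by [].
move=> v; rewrite (_ : 'D_v _ =
    fun t => cst v t * (flat j.+2 t + cst (- j%:R) t * flat j.+1 t)).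
  apply: smooth_uptoM; first exact: smooth_upto_cst.
  apply: smooth_uptoD; first exact: IH.
  by apply: smooth_uptoM; [exact: smooth_upto_cst|exact: IH].
by apply/funext => t; have [_ ->] := df j t v; rewrite /= mulNr.
Qed.

Lemma flat_smooth_affine (V : normedModType R) k j (l l0 : V -> R) : continuous l ->
  (forall x v (h : R), l (h *: v + x) = h * l0 v + l x) ->
  smooth_upto k (fun x => flat j (l x)).
Proof.
move=> cl lE; rewrite (_ : (fun x => _) = flat j \o l)//.
by apply: smooth_upto_comp lE _ => //; exact: flat_smooth.
Qed.

(** [step h] rises from 0 to 1 on the interval from [- h] to [h], the denominator being
    positive since one of its two terms always is; [dstep h] is its derivative. *)
Definition step (h t : R) : R := flat 0 (t + h) / (flat 0 (t + h) + flat 0 (h - t)).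

Definition dstep (h t : R) : R :=
  (flat 2 (t + h) * flat 0 (h - t) + flat 0 (t + h) * flat 2 (h - t)) /
  (flat 0 (t + h) + flat 0 (h - t)) ^+ 2.

Lemma step_den_gt0 h t : 0 < h -> 0 < flat 0 (t + h) + flat 0 (h - t).
Proof.
move=> h0; have [th|th] := leP (t + h) 0.
  by rewrite (flat_le0 _ th) add0r flat_gt0//; lra.
by rewrite ltr_pwDl ?flat_gt0// flat_ge0.
Qed.

Lemma step_ge0 h t : 0 <= step h t.
Proof. by rewrite divr_ge0 ?addr_ge0 ?flat_ge0. Qed.

Lemma step_le1 h t : 0 < h -> step h t <= 1.
Proof.
by move=> h0; rewrite ler_pdivrMr ?step_den_gt0// mul1r lerDl flat_ge0.
Qed.

Lemma step0 h t : t <= - h -> step h t = 0.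
Proof. by move=> th; rewrite /step flat_le0 ?mul0r//; lra. Qed.

Lemma step1 h t : 0 < h -> h <= t -> step h t = 1.
Proof.
move=> h0 th; rewrite /step (@flat_le0 _ (h - t)) ?addr0 ?divff//; last lra.
by rewrite gt_eqF// flat_gt0//; lra.
Qed.

Lemma dstep_ge0 h t : 0 <= dstep h t.
Proof. by rewrite divr_ge0 ?exprn_ge0 ?addr_ge0 ?mulr_ge0 ?flat_ge0. Qed.

Lemma dstep0 h t : h <= `|t| -> dstep h t = 0.
Proof.
move=> ht; have [t0|t0] := leP 0 t.
  rewrite (ger0_norm t0) in ht.
  by rewrite /dstep !(@flat_le0 _ (h - t)) ?mulr0 ?addr0 ?mul0r//; lra.
rewrite (ltr0_norm t0) in ht.
by rewrite /dstep !(@flat_le0 _ (t + h)) ?mul0r ?addr0 ?mul0r//; lra.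
Qed.

Lemma dstep_center h : 0 < h -> 0 < dstep h 0.
Proof.
move=> h0; rewrite /dstep divr_gt0 ?exprn_gt0 ?step_den_gt0//.
by rewrite add0r subr0 addr_gt0// mulr_gt0// flat_gt0.
Qed.

Lemma step_is_derive h t : 0 < h -> is_derive t (1 : R) (step h) (dstep h t).
Proof.
move=> h0; have den0 := step_den_gt0 t h0.
have dA : is_derive t (1 : R) (fun t => flat 0 (t + h)) (flat 2 (t + h)).
  have d0 := is_derive_flat 0 (t + h).
  have d1 : is_derive t (1 : R) (fun t => t + h) 1.
    by apply: is_derive_eq; lra.
  by apply: is_derive_eq; rewrite /GRing.scale /=; lra.
have dB : is_derive t (1 : R) (fun t => flat 0 (h - t)) (- flat 2 (h - t)).
  have d0 := is_derive_flat 0 (h - t).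
  have d1 : is_derive t (1 : R) (fun t => h - t) (- 1).
    by apply: is_derive_eq; lra.
  by apply: is_derive_eq; rewrite /GRing.scale /=; lra.
pose D (t : R) := flat 0 (t + h) + flat 0 (h - t).
have dD : is_derive t (1 : R) D (flat 2 (t + h) - flat 2 (h - t)).
  by apply: is_derive_eq.
have dV : is_derive t (1 : R) (fun y => (D y)^-1)
    (- (flat 2 (t + h) - flat 2 (h - t)) / D t ^+ 2).
  have Dn0 : D t != 0 by rewrite gt_eqF.
  split; first by apply: derivableV.
  rewrite deriveV// (@derive_val _ _ _ _ _ _ _ dD) /GRing.scale /=.
  by rewrite mulrC mulrN mulNr.
apply: (is_derive_eq (is_deriveM dA dV)).
rewrite /GRing.scale /= /dstep -/(D t).
have Dn0 : flat 0 (t + h) + flat 0 (h - t) != 0 by rewrite gt_eqF.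
by rewrite /D; field.
Qed.

Lemma step_smooth_affine (V : normedModType R) k h c (l l0 : V -> R) : 0 < h ->
  continuous l -> (forall x v (h : R), l (h *: v + x) = h * l0 v + l x) ->
  smooth_upto k (fun x => step h (l x - c)).
Proof.
move=> h0 cl lE.
have sA : smooth_upto k (fun x => flat 0 (l x - c + h)).
  apply: (@flat_smooth_affine _ _ _ (fun x => l x - c + h) l0) => [x|x v r].
    apply: cvgD; last exact: cvg_cst.
    by apply: cvgB; [exact: cl|exact: cvg_cst].
  by rewrite lE; ring.
have sB : smooth_upto k (fun x => flat 0 (h - (l x - c))).
  apply: (@flat_smooth_affine _ _ _ (fun x => h - (l x - c)) (fun v => - l0 v)) => [x|x v r].
    apply: cvgB; first exact: cvg_cst.
    by apply: cvgB; [exact: cl|exact: cvg_cst].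
  by rewrite lE; ring.
apply: smooth_uptoM => //; apply: smooth_uptoV; last exact: smooth_uptoD.
by move=> x; rewrite gt_eqF// step_den_gt0.
Qed.

End flat.

Section bump.
Context {R : realType} {n : nat}.
Local Notation X := ('rV[R]_n).

Definition bump (x0 : X) (h : R) (x : X) : R :=
  \prod_(i < n) (flat 0 (h - (x ord0 i - x0 ord0 i)) * flat 0 (h + (x ord0 i - x0 ord0 i))).

Lemma bump_ge0 x0 h x : 0 <= bump x0 h x.
Proof. by apply: prodr_ge0 => i _; rewrite mulr_ge0 ?flat_ge0. Qed.

Lemma bump_center x0 h : 0 < h -> 0 < bump x0 h x0.
Proof.
by move=> h0; apply: prodr_gt0 => i _; rewrite subrr subr0 addr0 mulr_gt0 ?flat_gt0.
Qed.

Lemma bump_out (x0 : X) h (x : X) i : h <= `|x ord0 i - x0 ord0 i| -> bump x0 h x = 0.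
Proof.
move=> hx; rewrite /bump (bigD1 i)//=; set d := x ord0 i - x0 ord0 i in hx *.
have [d0|d0] := leP 0 d.
  by rewrite (ger0_norm d0) in hx; rewrite flat_le0 ?mul0r//; lra.
by rewrite (ltr0_norm d0) in hx; rewrite (@flat_le0 _ _ (h + d)) ?mulr0 ?mul0r//; lra.
Qed.

Lemma bump_smooth k x0 h : smooth_upto k (fun p : X * R => bump x0 h p.1).
Proof.
have ci (i : 'I_n) : continuous (fun p : X * R => p.1 ord0 i).
  move=> p; apply: (@cvg_comp _ _ _ fst (fun x : X => x ord0 i) _ (nbhs p.1)).
    exact: cvg_fst.
  exact: coord_rV_continuous.
rewrite /bump; elim: (index_enum _) => [|i r IH].
  rewrite (_ : (fun p => _) = cst 1); first exact: smooth_upto_cst.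
  by apply/funext => p; rewrite big_nil.
rewrite (_ : (fun p => _) = (fun p : X * R =>
   flat 0 (h - (p.1 ord0 i - x0 ord0 i)) * flat 0 (h + (p.1 ord0 i - x0 ord0 i)) *
   \prod_(i <- r) (flat 0 (h - (p.1 ord0 i - x0 ord0 i)) *
      flat 0 (h + (p.1 ord0 i - x0 ord0 i))))); last first.
  by apply/funext => p; rewrite big_cons.
apply: smooth_uptoM => //; apply: smooth_uptoM.
- apply: (@flat_smooth_affine _ _ _ _ (fun p : X * R => h - (p.1 ord0 i - x0 ord0 i))
    (fun p : X * R => - p.1 ord0 i)) => [p|p v r'].
    apply: cvgB; first exact: cvg_cst.
    by apply: cvgB; [exact: ci|exact: cvg_cst].
  by rewrite /= !mxE; ring.
- apply: (@flat_smooth_affine _ _ _ _ (fun p : X * R => h + (p.1 ord0 i - x0 ord0 i))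
    (fun p : X * R => p.1 ord0 i)) => [p|p v r'].
    apply: cvgD; first exact: cvg_cst.
    by apply: cvgB; [exact: ci|exact: cvg_cst].
  by rewrite /= !mxE; ring.
Qed.

(** A bump in space times a plateau in time that rises around [a] and falls around [b].
    The subtraction is a product with [cst (- 1)], to match the closure properties of
    [smooth_upto]. *)
Definition plateau (x0 : X) (h a b : R) (p : X * R) : R :=
  bump x0 h p.1 * (step h (p.2 - a) + cst (- 1) p * step h (p.2 - b)).

Lemma plateau_smooth x0 h a b : 0 < h -> smooth (plateau x0 h a b).
Proof.
move=> h0; apply: smooth_uptoP => k.
have cs : continuous (snd : X * R -> R) by move=> p; exact: cvg_snd.
have ls (p v : X * R) (r : R) : snd (r *: v + p) = r * snd v + snd p by [].
apply: smooth_uptoM; first exact: bump_smooth.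
apply: smooth_uptoD; first exact: (step_smooth_affine k a h0 cs ls).
apply: smooth_uptoM; first exact: smooth_upto_cst.
exact: (step_smooth_affine k b h0 cs ls).
Qed.

Lemma plateau_ge0 x0 h a b p : 0 < h -> a + h <= b - h -> 0 <= plateau x0 h a b p.
Proof.
move=> h0 ab; rewrite mulr_ge0 ?bump_ge0//= mulN1r subr_ge0.
have [tb|tb] := leP (p.2 - b) (- h); first by rewrite (step0 tb) step_ge0.
by rewrite (@step1 _ _ (p.2 - a))// ?step_le1//; lra.
Qed.

Lemma plateau_derive x0 h a b p : 0 < h ->
  'D_(e_t n) (plateau x0 h a b) p =
  bump x0 h p.1 * (dstep h (p.2 - a) - dstep h (p.2 - b)).
Proof.
move=> h0; case: p => x t /=.
have h1 : is_derive t (1 : R) (fun r => plateau x0 h a b (x, r))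
    ('D_(e_t n) (plateau x0 h a b) (x, t)).
  by apply: is_derive_time_line; split => //; apply: smooth_derivable;
    exact: plateau_smooth.
have dshift (c : R) : is_derive t (1 : R) (fun r => step h (r - c)) (dstep h (t - c)).
  have d0 := step_is_derive (t - c) h0.
  have d1 : is_derive t (1 : R) (fun r : R => r - c) 1.
    by apply: is_derive_eq; lra.
  by apply: is_derive_eq; rewrite /GRing.scale /=; lra.
rewrite -(@derive_val _ _ _ _ _ _ _ h1) {h1}; apply: derive_val.
have da := dshift a; have db := dshift b.
rewrite /plateau /=; apply: is_derive_eq.
by rewrite /GRing.scale /=; ring.
Qed.

Lemma plateau_test_function (Omega : set X) (x0 : X) h a b : 0 < h -> h < a -> a < b ->
  (forall x : X, (forall i, `|x ord0 i - x0 ord0 i| <= h) -> Omega x) ->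
  test_function Omega (plateau x0 h a b).
Proof.
move=> h0 ha ab xO.
pose B : set X := [set x : X | forall i, `[x0 ord0 i - h, x0 ord0 i + h]%classic (x ord0 i)].
pose K : set (X * R) := B `*` `[a - h, b + h]%classic.
have cK : compact K.
  apply: compact_setX; last exact: segment_compact.
  by apply: (@rV_compact _ _ (fun i => `[x0 ord0 i - h, x0 ord0 i + h]%classic)) => i;
    exact: segment_compact.
have SK : closure [set p | plateau x0 h a b p != 0] `<=` K.
  rewrite closureE; apply: smallest_sub.
    by apply: compact_closed => //; exact: norm_hausdorff.
  move=> [x t] /= pn0; split => /=.
    move=> i /=; rewrite in_itv/=; apply: contraNT pn0 => hx.
    rewrite /plateau (@bump_out _ _ _ i) ?mul0r// leNgt ltr_norml.
    by apply: contra hx => /andP[? ?]; apply/andP; split; lra.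
  rewrite in_itv/=; apply: contraNT pn0; rewrite negb_and -!ltNge => /orP[ht|ht].
    by rewrite /plateau /= !step0 ?mulr0 ?addr0 ?mulr0//; lra.
  by rewrite /plateau /= !step1 ?mulr1 ?subrr ?mulr0//; lra.
split.
- exact: plateau_smooth.
- by apply: subclosed_compact cK SK; exact: closed_closure.
- move=> p /SK[Bp]; rewrite /= in_itv/= => /andP[pa _]; split => /=; last by lra.
  apply: xO => i; have := Bp i; rewrite /= in_itv/= ler_norml => /andP[? ?].
  by apply/andP; split; lra.
Qed.

End bump.

(** * Uniqueness of the limit solution *)

Section uniqueness.
Context {R : realType} {n : nat}.
Local Notation X := ('rV[R]_n).
Local Notation XT := (X * measurableTypeR R)%type.
Local Notation leb := (@lebesgue_rV R n).
Variable Omega : set X.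
Hypothesis Omega_open : open Omega.
Hypothesis Omega_bounded : bounded_set Omega.

Let mC : measurable (cyl Omega : set XT).
Proof. exact: measurable_cyl. Qed.

Local Notation integral_cyl f := (\int[lebesgue_cyl n]_(p in (cyl Omega : set XT)) f p).

Lemma lebesgue_cyl_box_gt0 (p : X * R) (e : R) : 0 < e ->
  (0 < fine (lebesgue_cyl n ([set y : X | (forall i, `|p.1 ord0 i - y ord0 i| < e)%R] `*`
     (ball p.2 e : set (measurableTypeR R)) : set XT)))%R.
Proof.
move=> e0; rewrite /lebesgue_cyl /= product_measure1E//; last first.
- exact: measurable_ball.
- exact: measurable_rVbox.
have E1 := lebesgue_rVbox p.1 (ltW e0).
have E2 := lebesgue_measure_ball p.2 (ltW e0).
suff : 0 < fine (leb [set y : X | (forall i, `|p.1 ord0 i - y ord0 i| < e)%R] *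
  lebesgue_measure (ball p.2 e))%E by [].
rewrite E1 E2 -EFinM /= mulr_gt0 ?mulrn_wgt0//.
by apply: prodr_gt0 => i _; rewrite mulrn_wgt0.
Qed.

(** On a small box around [p] the integrand is above [G p / 2]. *)
Lemma integral_cyl_gt0 (G : X * R -> R) p : cyl Omega p ->
  (lebesgue_cyl n).-integrable (cyl Omega : set XT) (EFin \o G) ->
  (forall q, cyl Omega q -> 0 <= G q) -> G q @[q --> p] --> G p -> 0 < G p ->
  0 < integral_cyl G.
Proof.
move=> Cp iG G0 cG Gp; pose c := G p / 2.
have c0 : 0 < c by rewrite divr_gt0.
have nG : \forall q \near p, c < G q.
  apply: (cG [set r | c < r]); apply: open_nbhs_nbhs; split; first exact: open_gt.
  by rewrite /= /c; lra.
have nC : \forall q \near p, cyl Omega q.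
  by apply: open_nbhs_nbhs; split => //; exact: open_cyl.
have [e e0 he] := (cyl_nbhsP _ _).1 (filterI nG nC).
pose B : set XT := [set y : X | forall i, `|p.1 ord0 i - y ord0 i| < e] `*`
  (ball p.2 e : set (measurableTypeR R)).
have BG q : B q -> c < G q /\ cyl Omega q.
  by move=> [h1 h2]; apply: he.
have mB : measurable B.
  by apply: measurableX; [exact: measurable_rVbox|exact: measurable_ball].
have BC : cyl Omega `&` B = B by apply/seteqP; split => q; [case|move=> Bq; split => //; have [] := BG q Bq].
have mcB : measurable_fun (cyl Omega : set XT) ((cst c : XT -> R) \_ B).
  by apply: ((measurable_restrict _ mB mC).1 _); exact: measurable_cst.
have icB : (lebesgue_cyl n).-integrable (cyl Omega : set XT) (EFin \o ((cst c : XT -> R) \_ B)).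
  apply: (le_integrable mC _ _ iG); first exact/measurable_EFinP.
  move=> q Cq; rewrite /= lee_fin patchE; case: ifPn => [|_]; last by rewrite normr0.
  rewrite inE => /BG[cG' _]; rewrite !ger0_norm ?(ltW c0)//; first exact: ltW.
  exact: G0.
apply: (@lt_le_trans _ _ (integral_cyl ((cst c : XT -> R) \_ B))).
  rewrite -Rintegral_mkcondr BC Rintegral_cst// mulr_gt0//.
  exact: lebesgue_cyl_box_gt0.
apply: le_Rintegral => // q Cq; rewrite patchE; case: ifPn => [|_]; last exact: G0.
by rewrite inE => /BG[/ltW].
Qed.

Lemma closed_cyl_continuous_at (W : X * R -> R) p :
  {within closed_cyl Omega, continuous W} -> cyl Omega p -> W q @[q --> p] --> W p.
Proof.
move=> /(continuous_subspaceW (@cyl_closed_cyl _ _ Omega)).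
rewrite continuous_open_subspace; last exact: open_cyl.
by move=> cW Cp; apply: cW; rewrite inE.
Qed.

(** If [W (x, a) < c < W (x, b)], testing against a plateau localized near [x] that
    rises near [a] and falls near [b] gives a negative value. *)
Lemma distributional_nonincreasing (W : X * R -> R) (T : R) :
  {within closed_cyl Omega, continuous W} ->
  (forall phi, test_function Omega phi -> (forall p, 0 <= phi p) ->
     (forall p, T < p.2 -> phi p = 0) ->
     0 <= integral_cyl (fun p => W p * 'D_(e_t n) phi p)) ->
  forall x a b, Omega x -> 0 < a -> a < b -> b < T -> W (x, b) <= W (x, a).
Proof.
move=> cW H x a b Ox a0 ab bT; rewrite leNgt; apply/negP => Wab.
pose c := (W (x, a) + W (x, b)) / 2.
have Ca : cyl Omega (x, a) by split.
have Cb : cyl Omega (x, b) by split => //=; lra.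
have nA : \forall q \near (x, a), W q < c.
  have cWa := closed_cyl_continuous_at cW Ca.
  apply: (cWa [set r | r < c]).
  by apply: open_nbhs_nbhs; split; [exact: open_lt|rewrite /= /c; lra].
have nB : \forall q \near (x, b), c < W q.
  have cWb := closed_cyl_continuous_at cW Cb.
  apply: (cWb [set r | c < r]).
  by apply: open_nbhs_nbhs; split; [exact: open_gt|rewrite /= /c; lra].
have [e1 e10 h1] := (cyl_nbhsP _ _).1 nA.
have [e2 e20 h2] := (cyl_nbhsP _ _).1 nB.
have /rV_nbhsP[e3 e30 h3] := open_nbhs_nbhs (conj Omega_open Ox).
pose m := Num.min e1 (Num.min e2 (Num.min e3 (Num.min a (Num.min (T - b) ((b - a) / 2))))).
have m0 : 0 < m by rewrite /m !lt_min e10 e20 e30 a0 /=; apply/andP; split; lra.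
have : m <= m by []; rewrite {2}/m !le_min.
case/and5P => m1 m2 m3 ma /andP[mT mab].
pose h := m / 2.
have h0 : 0 < h by rewrite /h; lra.
have hm : h < m by rewrite /h; lra.
pose phi := plateau x h a b.
have tphi : test_function Omega phi.
  apply: plateau_test_function => //; first lra.
  by move=> y hy; apply: h3 => i; rewrite distrC (le_lt_trans (hy i))//; lra.
have sphi : smooth phi by case: tphi.
have [a' [b' [a'0 _ _ s2]]] := test_function_between tphi.
have cphi := smooth_derive_continuous (v := e_t n) sphi.
have i1 := supported_integrable Omega_open Omega_bounded a'0 cW cphi s2.
have c1 : {within closed_cyl Omega, continuous (cst 1 : X * R -> R)}.
  by move=> p; exact: cvg_cst.
have c0 : {within closed_cyl Omega, continuous (cst 0 : X * R -> R)}.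
  by move=> p; exact: cvg_cst.
have i2 := supported_integrable Omega_open Omega_bounded a'0 c1 cphi s2.
(* As [phi] has compact support, subtracting the constant [c] from [W] changes nothing. *)
have I0 : integral_cyl (fun p => cst 1 p * 'D_(e_t n) phi p) = 0.
  apply/eqP; rewrite -oppr_eq0; apply/eqP.
  have dcst y (t : R) : Omega y -> 0 < t ->
      is_derive t (1 : R) (fun r => cst (1 : R) (y, r) : R) (cst (0 : R) (y, t)).
    by move=> _ _; exact: is_derive_cst.
  rewrite (integration_by_parts_in_time Omega_open Omega_bounded c1 c0 dcst tphi).
  under eq_Rintegral => p _ do rewrite /= mul0r.
  by rewrite Rintegral_cst// mul0r.
pose G q := c * (cst 1 q * 'D_(e_t n) phi q) - W q * 'D_(e_t n) phi q.
have i3 : (lebesgue_cyl n).-integrable (cyl Omega : set XT)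
    (EFin \o (fun q => c * (cst 1 q * 'D_(e_t n) phi q))).
  by have := integrableZl mC c i2; apply: eq_integrable.
have iG : (lebesgue_cyl n).-integrable (cyl Omega : set XT) (EFin \o G).
  by have := integrableB mC i3 i1; apply: eq_integrable.
have GE q : G q = (c - W q) * (bump x h q.1 * (dstep h (q.2 - a) - dstep h (q.2 - b))).
  by rewrite /G plateau_derive//=; ring.
have : 0 < integral_cyl G.
  apply: (integral_cyl_gt0 Ca iG).
  - move=> q Cq; rewrite GE.
    have [[i hi]|Nhi] := pselect (exists i, h <= `|q.1 ord0 i - x ord0 i|).
      by rewrite (bump_out hi) mul0r mulr0.
    have {}Nhi i : `|q.1 ord0 i - x ord0 i| < h.
      by rewrite ltNge; apply/negP => hi; apply: Nhi; exists i.
    have b0 := bump_ge0 x h q.1.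
    have [hb|hb] := leP h `|q.2 - b|.
      rewrite (dstep0 hb) subr0; have [ha|ha] := leP h `|q.2 - a|.
        by rewrite (dstep0 ha) !mulr0.
      rewrite mulr_ge0//; last by rewrite mulr_ge0// dstep_ge0.
      rewrite subr_ge0 ltW//; apply: h1 => [i|].
        by rewrite distrC (lt_trans (Nhi i))//=; lra.
      by rewrite distrC (lt_trans ha)//=; lra.
    have ha : h <= `|q.2 - a|.
      move: hb; rewrite ltr_norml => /andP[? ?].
      by rewrite ger0_norm; lra.
    rewrite (dstep0 ha) sub0r mulrN mulrN -mulNr opprB.
    rewrite mulr_ge0//; last by rewrite mulr_ge0// dstep_ge0.
    rewrite subr_ge0 ltW//; apply: h2 => [i|].
      by rewrite distrC (lt_trans (Nhi i))//=; lra.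
    by rewrite distrC (lt_trans hb)//=; lra.
  - have cWa := closed_cyl_continuous_at cW Ca.
    apply: cvgB; last by apply: cvgM; [exact: cWa|exact: cphi].
    apply: cvgM; first exact: cvg_cst.
    by apply: cvgM; [exact: cvg_cst|exact: cphi].
  - rewrite GE /= subrr (@dstep0 _ _ (a - b)); last first.
      by rewrite ltr0_norm; lra.
    rewrite subr0 mulr_gt0//; first by rewrite /c; lra.
    by rewrite mulr_gt0 ?bump_center// dstep_center.
rewrite /G RintegralB// RintegralZl// I0 mulr0 sub0r oppr_gt0 ltNge => /negP; apply.
apply: H => //.
- by move=> p; apply: plateau_ge0 => //; lra.
- move=> p pT; rewrite /phi /plateau /= !step1 ?mulr1 ?subrr ?mulr0//; lra.
Qed.

End uniqueness.

Section limit_uniqueness.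
Context {R : realType} {n : nat}.
Local Notation X := ('rV[R]_n).
Local Notation XT := (X * measurableTypeR R)%type.
Local Notation leb := (@lebesgue_rV R n).
Variables (Omega : set X) (mu : X -> R).
Hypothesis Omega_open : open Omega.
Hypothesis Omega_bounded : bounded_set Omega.
Hypothesis frontier0 : leb (frontier Omega) = 0%E.
Hypothesis mu_ge0 : forall z, 0 <= mu z.
Hypothesis mu_L1 : leb.-integrable setT (EFin \o mu).
Hypothesis mu_mass1 : \int[leb]_z mu z = 1.

Local Notation integral_cyl f := (\int[lebesgue_cyl n]_(p in (cyl Omega : set XT)) f p).

Lemma K0_continuous (w : X * R -> R) : {within closed_cyl Omega, continuous w} ->
  {within closed_cyl Omega, continuous (K0 Omega mu w)}.
Proof.
move=> cw.
have cg := gain_closed_cyl_continuous Omega_open Omega_bounded frontier0 mu_ge0 mu_L1 cw.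
rewrite (_ : K0 Omega mu w =
  (fun p => gain Omega mu (fun y => w (y, p.2)) p.1) \- w)//.
by move=> p; apply: continuousB; [exact: cg|exact: cw].
Qed.

(** Every point of the closed cylinder is a limit of points of its interior. *)
Lemma closed_cyl_le (f : X * R -> R) (T C : R) : 0 < T ->
  {within closed_cyl Omega, continuous f} ->
  (forall x t, Omega x -> 0 < t -> t < T -> f (x, t) <= C) ->
  forall x t, closure Omega x -> 0 <= t <= T -> f (x, t) <= C.
Proof.
move=> T0 cf fC x t cx /andP[t0 tT]; rewrite leNgt; apply/negP => h.
have Cxt : closed_cyl Omega (x, t) by split.
move/subspace_continuousP : cf => /(_ _ Cxt) cf.
have : \forall q \near (x, t), closed_cyl Omega q -> C < f q.
  by apply: (cf [set r | C < r]); apply: open_nbhs_nbhs; split; [exact: open_gt|].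
move=> /cyl_nbhsP[e e0 he].
have nx : nbhs x [set y : X | forall i, `|x ord0 i - y ord0 i| < e].
  by apply/rV_nbhsP; exists e.
have [y [Oy yx]] := cx _ nx.
pose d := Num.min e T / 2.
have m0 : 0 < Num.min e T by rewrite lt_min e0.
have de : d < e by have : Num.min e T <= e by [rewrite ge_min lexx]; rewrite /d; lra.
have dT : d < T by have : Num.min e T <= T by [rewrite ge_min lexx orbT]; rewrite /d; lra.
have d0 : 0 < d by rewrite /d; lra.
have [s [s0 sT ts]] : exists s, [/\ 0 < s, s < T & `|t - s| < e].
  have [tT2|tT2] := ltP t (T - d).
    exists (t + d / 2); split; try lra.
    by rewrite opprD addNKr normrN gtr0_norm; lra.
  by exists (T - d / 2); split; try lra; rewrite ltr_norml; apply/andP; split; lra.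
have : C < f (y, s).
  apply: he => //=; split; [exact: subset_closure|exact: ltW].
by rewrite ltNge fC.
Qed.

Variables (u0 : X -> R) (M : R).
Hypothesis u0_continuous : {within closure Omega, continuous u0}.
Hypothesis M_ge0 : 0 <= M.
Hypothesis u0_le : forall x, closure Omega x -> `|u0 x| <= M.

Local Notation jf := (jump_flow Omega mu u0).

Let cjf : {within closed_cyl Omega, continuous jf}.
Proof. exact: (jump_flow_continuous (M := M)). Qed.

Lemma jump_flow_limit_solution : limit_solution Omega mu u0 jf.
Proof.
split => //.
- move=> phi tphi; apply: integration_by_parts_in_time => //.
    exact: K0_continuous.
  move=> x t Ox t0; apply: (jump_flow_is_derive (M := M)) => //.
    exact: subset_closure.
  exact: ltW.
- by move=> x _; exact: jump_flow0.
Qed.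

(** With [m] the maximum of [|z| e^(-4t)], [|K0 z| <= 2 m e^(4t)] is the derivative of
    [(m/2) e^(4t)], so that [z] minus the latter decreases in time and
    [|z| <= (m/2) e^(4t)]: hence [m = 0]. *)
Lemma limit_solution_unique v : limit_solution Omega mu u0 v ->
  forall p, closed_cyl Omega p -> v p = jf p.
Proof.
move=> [cv dv v0]; pose z p := v p - jf p.
have cz : {within closed_cyl Omega, continuous z}.
  rewrite (_ : z = v \- jf)//.
  by move=> p; apply: continuousB; [exact: cv|exact: cjf].
have z0 x : Omega x -> z (x, 0) = 0 by move=> Ox; rewrite /z v0// jump_flow0 subrr.
case=> x1 t1 [/= cx1 t10]; apply/eqP; rewrite -subr_eq0 -[_ - _]/(z (x1, t1)).
pose T := t1 + 1.
have T0 : 0 < T by rewrite /T; lra.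
pose K : set (X * R) := closure Omega `*` `[0, T]%classic.
have cK : compact K by exact: compact_cylinder.
pose zw (p : X * R) := expR (-4 * p.2) * `|z p|.
have czw : {within closed_cyl Omega, continuous zw}.
  have c1 : continuous (fun p : X * R => expR (-4 * p.2)).
    by move=> p; exact: (@continuous_expR_snd R X (-4) p).
  rewrite (_ : zw = (fun p : X * R => expR (-4 * p.2)) \* (fun p => `|z p|))//.
  move=> p; apply: continuousM; first exact: (continuous_subspaceT c1).
  exact: (cvg_norm (cz p)).
have czwK : {within K, continuous zw}.
  apply: continuous_subspaceW czw => -[y t] [cy /=].
  by rewrite in_itv/= => /andP[].
have K0' : K !=set0.
  by exists (x1, t1); split => //=; rewrite in_itv/= t10 /T; lra.
have [[xm tm]] := compact_EVT_max K0' cK czwK.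
rewrite inE => -[/= cxm]; rewrite in_itv/= => tmT zmax.
pose m := zw (xm, tm).
have m0 : 0 <= m by rewrite /m /zw mulr_ge0 ?expR_ge0.
have zm y t : closure Omega y -> 0 <= t <= T -> `|z (y, t)| <= m * expR (4 * t).
  move=> cy tT; have := zmax (y, t); rewrite inE => /(_ _); rewrite -/m.
  rewrite /zw /= mulNr expRN => h; rewrite -ler_pdivrMr ?expR_gt0// mulrC; apply: h.
  by split => //=; rewrite in_itv.
pose g (p : X * R) := m / 2 * expR (4 * p.2).
pose g' (p : X * R) := 2 * m * expR (4 * p.2).
have cexp : continuous (fun p : X * R => expR (4 * p.2)).
  by move=> p; exact: (@continuous_expR_snd R X 4 p).
have cg : {within closed_cyl Omega, continuous g}.
  by apply: continuous_subspaceT => p; apply: cvgM; [exact: cvg_cst|exact: cexp].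
have cg' : {within closed_cyl Omega, continuous g'}.
  by apply: continuous_subspaceT => p; apply: cvgM; [exact: cvg_cst|exact: cexp].
have dg y (t : R) : Omega y -> 0 < t -> is_derive t (1 : R) (fun r => g (y, r)) (g' (y, t)).
  by move=> _ _; rewrite /g /g' /=; apply: is_derive_eq; rewrite /GRing.scale /=; lra.
have key (s : R) : `|s| = 1 -> forall y t, Omega y -> 0 < t -> t < T ->
    s * z (y, t) <= m / 2 * expR (4 * t).
  move=> s1; pose W (p : X * R) := s * z p - g p.
  have cW : {within closed_cyl Omega, continuous W}.
    rewrite (_ : W = (cst s \* z) \- g)//.
    move=> p; apply: continuousB; last exact: cg.
    by apply: continuousM; [exact: cvg_cst|exact: cz].
  have Wmono := @distributional_nonincreasing _ _ _ Omega_open Omega_bounded W T cW _.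
  move=> y t Oy t0 tT.
  have Wt a : 0 < a -> a < t -> W (y, t) <= W (y, a).
    move=> a0 at'; apply: Wmono => //.
    move=> phi tphi phi0 phiT.
    have sphi : smooth phi by case: tphi.
    have [a' [b' [a'0 _ s1' s2]]] := test_function_between tphi.
    have mC : measurable (cyl Omega : set XT) by exact: measurable_cyl.
    have int w := @supported_integrable _ _ _ Omega_open Omega_bounded w _ a' b' a'0.
    have c1 := smooth_derive_continuous (v := e_t n) sphi.
    have c2 := smooth_continuous sphi.
    have E1 := dv phi tphi.
    have [_ djf _] := jump_flow_limit_solution.
    have E2 := djf phi tphi.
    have E3 := integration_by_parts_in_time Omega_open Omega_bounded cg cg' dg tphi.
    have iv := int _ _ cv c1 s2; have ij := int _ _ cjf c1 s2.
    have ig := int _ _ cg c1 s2.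
    have iKv := int _ _ (K0_continuous cv) c2 s1'.
    have iKj := int _ _ (K0_continuous cjf) c2 s1'.
    have ig' := int _ _ cg' c2 s1'.
    have I1 : integral_cyl (fun p => W p * 'D_(e_t n) phi p) =
        s * (integral_cyl (fun p => v p * 'D_(e_t n) phi p) -
             integral_cyl (fun p => jf p * 'D_(e_t n) phi p)) -
        integral_cyl (fun p => g p * 'D_(e_t n) phi p).
      rewrite -RintegralB// -RintegralZl//; last first.
        by have := integrableB mC iv ij; apply: eq_integrable.
      rewrite -RintegralB//; last first.
        have := integrableZl mC s (integrableB mC iv ij); apply: eq_integrable => //.
      by apply: eq_Rintegral => p _; rewrite /W /z; ring.
    have I2 : integral_cyl (fun p => (g' p - s * (K0 Omega mu v p - K0 Omega mu jf p)) * phi p) =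
        integral_cyl (fun p => g' p * phi p) -
        s * (integral_cyl (fun p => K0 Omega mu v p * phi p) -
             integral_cyl (fun p => K0 Omega mu jf p * phi p)).
      rewrite -[X in s * X]RintegralB// -RintegralZl//; last first.
        by have := integrableB mC iKv iKj; apply: eq_integrable.
      rewrite -RintegralB//; last first.
        have := integrableZl mC s (integrableB mC iKv iKj); apply: eq_integrable => //.
      by apply: eq_Rintegral => p _; ring.
    have -> : integral_cyl (fun p => W p * 'D_(e_t n) phi p) =
        integral_cyl (fun p => (g' p - s * (K0 Omega mu v p - K0 Omega mu jf p)) * phi p).
      by rewrite I1 I2 -E1 -E2 -E3; ring.
    apply: Rintegral_ge0 => -[x r] [/= Ox r0].
    have [rT|rT] := leP r T; last by rewrite phiT ?mulr0.
    rewrite mulr_ge0// subr_ge0.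
    have r0' : 0 <= r by exact: ltW.
    have bv := closed_cyl_slice_bounded Omega_open Omega_bounded r0' cv.
    have bj := closed_cyl_slice_bounded Omega_open Omega_bounded r0' cjf.
    have bz := closed_cyl_slice_bounded Omega_open Omega_bounded r0' cz.
    have rT' : 0 <= r <= T by rewrite r0'.
    have -> : K0 Omega mu v (x, r) - K0 Omega mu jf (x, r) =
        gain Omega mu (fun y => z (y, r)) x - z (x, r).
      by rewrite !K0E /= /z gainB//; lra.
    have B0 : 0 <= m * expR (4 * r) by rewrite mulr_ge0 ?expR_ge0.
    have G1 : `|gain Omega mu (fun y => z (y, r)) x| <= m * expR (4 * r).
      apply: norm_gain_le => // y' Oy'; apply: zm => //; exact: subset_closure.
    have Z1 := zm x r (subset_closure Ox) rT'.
    apply: le_trans (ler_norm _) _; rewrite normrM s1 mul1r.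
    apply: le_trans (ler_normB _ _) _.
    by rewrite /g' /=; lra.
  have W0 : W (y, t) <= W (y, 0).
    rewrite leNgt; apply/negP => h.
    have C0y : closed_cyl Omega (y, 0) by split => /=; [exact: subset_closure|].
    move/subspace_continuousP : cW => /(_ _ C0y) cW.
    have : \forall q \near (y, 0 : R), closed_cyl Omega q -> W q < W (y, t).
      by apply: (cW [set r | r < W (y, t)]); apply: open_nbhs_nbhs; split; [exact: open_lt|].
    move=> /cyl_nbhsP[e e0 he].
    pose a := Num.min e t / 2.
    have mn0 : 0 < Num.min e t by rewrite lt_min e0.
    have a0 : 0 < a by rewrite /a; lra.
    have ae : a < e by have : Num.min e t <= e by [rewrite ge_min lexx]; rewrite /a; lra.
    have at' : a < t by have : Num.min e t <= t by [rewrite ge_min lexx orbT]; rewrite /a; lra.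
    have := Wt a a0 at'; rewrite leNgt => /negP; apply; apply: he.
    - by move=> i; rewrite subrr normr0.
    - by rewrite /= sub0r normrN gtr0_norm.
    - by split => /=; [exact: subset_closure|exact: ltW].
  move: W0; rewrite /W /g /= z0// !mulr0 expR0; lra.
have zw_le y t : Omega y -> 0 < t -> t < T -> zw (y, t) <= m / 2.
  move=> Oy t0 tT; rewrite /zw /= mulNr expRN ler_pdivrMl ?expR_gt0// mulrC.
  rewrite ler_norml lerNl -mulN1r; apply/andP; split.
    by apply: key => //; rewrite normrN normr1.
  by rewrite -[z _]mul1r; apply: key => //; rewrite normr1.
have mm : m <= m / 2 by exact: (closed_cyl_le T0 czw zw_le cxm tmT).
have m00 : m = 0 by lra.
have := zm x1 t1 cx1; rewrite m00 mul0r normr_le0; apply.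
by rewrite t10 /T; lra.
Qed.

End limit_uniqueness.

Theorem theorem4p1 (R : realType) (n : nat) (n_gt0 : (0 < n)%N)
    (Omega : set 'rV[R]_n)
    (Omega_open : open Omega) (Omega_bounded : bounded_set Omega)
    (Omega_connected : connected Omega)
    (Omega_regular : smooth_boundary Omega)
    (mu : 'rV[R]_n -> R)
    (mu_ge0 : forall z, 0 <= mu z)
    (mu_L1 : (lebesgue_rV n).-integrable setT (EFin \o mu))
    (mu_mass1 : (\int[lebesgue_rV n]_z mu z) = 1)
    (u0 : 'rV[R]_n -> R) (u0_C0 : C0 Omega u0)
    (ueps : R -> 'rV[R]_n * R -> R)
    (ueps_solution : forall eps, 0 < eps ->
       viscous_solution Omega mu eps u0 (ueps eps)) :
  exists u : 'rV[R]_n * R -> R,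
    [/\ limit_solution Omega mu u0 u,
        forall v, limit_solution Omega mu u0 v ->
          forall p, closed_cyl Omega p -> v p = u p,
        forall p, cyl Omega p -> ueps eps p @[eps --> 0^'+] --> u p &
        weak_star_cvg0 (cyl Omega) ueps u].
Proof.
have frontier0 := frontier_null Omega_regular.
have [cu0 _] := u0_C0.
have [M M0 u0_le] : exists2 M, 0 <= M & forall x, closure Omega x -> `|u0 x| <= M.
  have /compact_bounded[C [_ hC]] :=
    continuous_compact cu0 (compact_closure_domain Omega_bounded).
  exists (`|C| + 1) => [|x cx]; first by rewrite addr_ge0.
  by apply: hC; [rewrite (le_lt_trans (ler_norm _))// ltrDl|exists x].
exists (jump_flow Omega mu u0); split.
- exact: jump_flow_limit_solution u0_le.
- by move=> v; exact: limit_solution_unique u0_le _.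
- by move=> p; exact: (viscous_pointwise _ _ _ _ _ _ _ _ M0 u0_le).
- exact: (viscous_weak_star _ _ _ _ _ _ _ _ M0 u0_le).
Qed.
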